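(* Let $g\in\mathbf G$ be any unipotent element in a semisimple linear algebraic group $\mathbf G$ over an algebraically closed field $\mathbb D$ of characteristic $0$. Then there is an algebraic subgroup $\mathrm{SL}_g<\mathbf G$ with Lie algebra $\mathrm{Lie}(\mathrm{SL}_g)\cong\mathfrak{sl}_2$ and $g\in\mathrm{SL}_g$. The element $\log(g)\in\mathrm{Lie}(\mathbf G)$ corresponds to $\begin{pmatrix}0&1\\0&0\end{pmatrix}\in\mathfrak{sl}_2$. Moreover, if $g\in\mathbf G(\mathbb F)$ for a field $\mathbb F\subseteq\mathbb D$, then $\mathrm{SL}_g$ can be assumed to be defined over $\mathbb F$.
   Context: A linear algebraic group is a Zariski-closed subgroup of some $\mathrm{GL}_n(\mathbb D)$; it is defined over a subfield $\mathbb F\subseteq\mathbb D$ if it is the set of common zeros of polynomials in $\mathbb F[(x_{ij}),\det(x_{ij})^{-1}]$. The group of $\mathbb F$-points $\mathbf G(\mathbb F)=\mathbf G\cap\mathrm{GL}_n(\mathbb F)$ is considered for $\mathbf G$ defined over $\mathbb F$ (or over a subfield of $\mathbb F$). A linear algebraic group is semisimple if it is Zariski-connected and every closed connected normal abelian subgroup is trivial. For unipotent $g$, $\log(g)=\sum_{k\ge1}(-1)^{k+1}(g-\mathrm{Id})^k/k$ is a finite sum, and it lies in the Lie algebra of $\mathbf G$.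
   Formalization: The unipotent element g is assumed to be different from the identity, since for g = Id one has log(g) = 0, which cannot correspond to the nonzero matrix (0 1; 0 0) in sl_2. *)

(* Defs.v *)
From HB Require Import structures.
From mathcomp Require Export all_boot all_order all_algebra.
From mathcomp Require Export mpoly.

Set Implicit Arguments.
Unset Strict Implicit.
Unset Printing Implicit Defensive.

Import GRing.Theory.
Local Open Scope ring_scope.

Section LinearAlgebraicGroups.

Variables (D : fieldType) (n : nat).
Implicit Types (g h X Y : 'M[D]_n) (G H N : 'M[D]_n -> Prop).

(* A regular function on GL_n is represented by a polynomial in n * n + 1
   variables: the first n * n stand for the entries x_ij (in the order of
   mxvec), the last one for det(x_ij)^-1. *)
Definition GL_coord g : 'I_(n * n + 1) -> D :=
  fun i => row_mx (mxvec g) ((\det g)^-1)%:M 0 i.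

(* The differential of GL_coord at the identity, applied to X: the derivative
   of det^-1 at 1 in the direction X is - tr X. *)
Definition GL_tangent_coord X : 'I_(n * n + 1) -> D :=
  fun i => row_mx (mxvec X) (- \tr X)%:M 0 i.

Definition zero_locus (I : {mpoly D[n * n + 1]} -> Prop) g : Prop :=
  g \in unitmx /\ forall p, I p -> p.@[GL_coord g] = 0.

Definition zariski_closed G : Prop :=
  exists I : {mpoly D[n * n + 1]} -> Prop, forall g, G g <-> zero_locus I g.

Definition defined_over (F : {pred D}) G : Prop :=
  exists I : {mpoly D[n * n + 1]} -> Prop,
    (forall p, I p -> p \is a mpolyOver _ F) /\
    (forall g, G g <-> zero_locus I g).

Definition subgroup_GL G : Prop :=
  [/\ forall g, G g -> g \in unitmx,
      G 1%:M,
      forall g h, G g -> G h -> G (g *m h)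
    & forall g, G g -> G (invmx g)].

Definition algebraic_group G : Prop := subgroup_GL G /\ zariski_closed G.

Definition subset_mx G H : Prop := forall g, G g -> H g.

Definition zariski_connected G : Prop :=
  forall A B : 'M[D]_n -> Prop, zariski_closed A -> zariski_closed B ->
    (forall g, G g -> A g \/ B g) ->
    (forall g, G g -> ~ (A g /\ B g)) ->
    subset_mx G A \/ subset_mx G B.

Definition normalized_by N G : Prop :=
  forall g h, G g -> N h -> N (g *m h *m invmx g).

Definition commutative_mx N : Prop :=
  forall g h, N g -> N h -> g *m h = h *m g.

Definition semisimple_group G : Prop :=
  [/\ algebraic_group G,
      zariski_connected G
    & forall N, algebraic_group N -> subset_mx N G -> zariski_connected N ->
        normalized_by N G -> commutative_mx N -> forall h, N h -> h = 1%:M].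

(* The tangent space of G at the identity: the X annihilated by the
   differentials at 1 of all regular functions on GL_n vanishing on G. *)
Definition Lie G X : Prop :=
  forall p : {mpoly D[n * n + 1]},
    (forall g, G g -> p.@[GL_coord g] = 0) ->
    \sum_i (p^`M(i)).@[GL_coord 1%:M] * GL_tangent_coord X i = 0.

Definition lie_bracket X Y : 'M[D]_n := X *m Y - Y *m X.

Definition sl X : Prop := \tr X = 0.

Definition unipotent g : Prop := exists k : nat, (g - 1%:M) ^+ k = 0.

(* For unipotent g the terms of degree k >= n of the series vanish, since
   (g - 1) ^+ n = 0. *)
Definition log_mx g : 'M[D]_n :=
  \sum_(1 <= k < n) ((-1) ^+ k.+1 / k%:R) *: (g - 1%:M) ^+ k.

End LinearAlgebraicGroups.

(* The values of phi outside L1 are irrelevant. *)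
Definition lie_isomorphism (D : fieldType) (m n : nat)
    (L1 : 'M[D]_m -> Prop) (L2 : 'M[D]_n -> Prop)
    (phi : 'M[D]_m -> 'M[D]_n) : Prop :=
  [/\ forall X, L1 X -> L2 (phi X),
      forall a X Y, L1 X -> L1 Y -> phi (a *: X + Y) = a *: phi X + phi Y,
      forall X Y, L1 X -> L1 Y ->
        phi (lie_bracket X Y) = lie_bracket (phi X) (phi Y),
      forall X Y, L1 X -> L1 Y -> phi X = phi Y -> X = Y
    & forall Y, L2 Y -> exists2 X, L1 X & phi X = Y].

(* S is an algebraic subgroup of G containing g, and some isomorphism from
   Lie(S) to sl_2 maps log(g) to the matrix with rows (0, 1) and (0, 0). *)
Definition is_SL_of (D : fieldType) (n : nat) (G : 'M[D]_n -> Prop)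
    (g : 'M[D]_n) (S : 'M[D]_n -> Prop) : Prop :=
  [/\ algebraic_group S,
      subset_mx S G,
      S g,
      Lie S (log_mx g)
    & exists phi : 'M[D]_n -> 'M[D]_2,
        lie_isomorphism (Lie S) (@sl D 2) phi /\
        phi (log_mx g) = delta_mx 0 1].

(* Main.v *)
Require Import Defs.
From Stdlib Require Import Classical IndefiniteDescription.
From mathcomp Require Import perm ring zify.
Import GRing.Theory Num.Theory.
Local Open Scope ring_scope.
Set Implicit Arguments. Unset Strict Implicit. Unset Printing Implicit Defensive.

(** Write [x] for the logarithm of [g], a nilpotent element of [Lie G] with
exponential [g].  The group [SLgroup x y] that answers the question is the
Zariski closure of the group generated by [exp x] and [exp y], where [x] and
[y] are the outer members of an sl2-triple [x, h, y] inside [Lie G].  There are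
three things to show: that such a triple exists, that the Lie algebra of the
closure is no larger than the span of the triple, and that [y] can be chosen
with entries in [F].

Existence.  Semisimplicity enters through one fact: the trace form of the given
matrix representation is nondegenerate on [Lie G] ([Lie_nondeg]).  Let R be its
radical, an ideal.  An element X of R is nilpotent ([radical_nilp]): a Q-linear
form f on the Q-span of the eigenvalues of X defines a replica Y of X, with the
same primary components and with each eigenvalue a replaced by f a; it lies in
[Lie G] ([replica_in_Lie]), and applying f to tr (X Y) = 0 gives
sum m_a (f a)^2 = 0, where m_a is the multiplicity of a, so that f vanishes on
all the eigenvalues.  If R were nonzero, its centre would be nonzero by
[engel], and the exponential of that centre would be a nontrivial closed
connected normal abelian subgroup of G.  With the
form nondegenerate, an orthogonality argument puts [x] in the image of
(ad x)^2 ([neutral_element]), and [morozov] completes [x] to a triple.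

The Lie algebra of the closure ([Lie_SLgroup]).  A polynomial identity valid on
the generated group can be differentiated at 1 along any X in the Lie algebra
of its closure.  Three families of identities suffice.  Conjugation preserves
the span of the triple, so X = s + z with s in the span and z commuting with
the triple ([normalizer_split]).  The determinants on the images of the
idempotents that commute with the triple are 1, which makes z nilpotent.  The
orbit of a highest weight vector v stays in the span of the y^k v, which makes
v an eigenvector of z; hence z v = 0.  A matrix that commutes with the triple
and kills the highest weight vectors is 0, by a Casimir argument
([comm_kills_hw]).

Rationality ([triple_over_F], [SLgroup_over]).  Once [h] is normalized by the
vanishing of some of its entries, [y] is the unique solution of a system of
polynomial equations with coefficients in [F].  If an entry of [y] were outside
[F], some ring morphism to D, trivial on [F] and defined on the ring generated
by the entries of [y], would move this entry ([other_conjugate]) and produce a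
second solution.  Finally the points of the generated group have entries in
[F], so a polynomial that vanishes on it is a combination of polynomials over
[F] that do. *)

(** * Linear algebra *)

(** Excluded middle makes a predicate closed under linear combinations a
subspace: enlarge a subspace by missing vectors until its dimension is maximal. *)
Lemma subspace_vspace (K : fieldType) (V : vectType K) (P : V -> Prop) :
  P 0 -> (forall a u v, P u -> P v -> P (a *: u + v)) ->
  exists U : {vspace V}, forall v, v \in U <-> P v.
Proof.
move=> P0 Pl.
suff [U [UP PU]] : exists U : {vspace V}, (forall v, v \in U -> P v) /\ (forall v, P v -> v \in U).
  by exists U => v; split; auto.
have H : forall d (U : {vspace V}), (\dim {:V} - \dim U <= d)%N -> (forall v, v \in U -> P v) ->
  exists U : {vspace V}, (forall v, v \in U -> P v) /\ (forall v, P v -> v \in U).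
  elim=> [|d IH] U dU UP.
    exists U; split=> // v _.
    have -> : U = fullv by apply/eqP; rewrite eqEdim subvf -subn_eq0 -leqn0.
    exact: memvf.
  case: (classic (forall v, P v -> v \in U)) => [PU|/not_all_ex_not [v]]; first by exists U.
  move=> /(imply_to_and (P v)) [Pv /negP vU].
  apply: (IH (<[v]> + U)%VS).
    have lt : (\dim U < \dim (<[v]> + U))%N.
      rewrite ltn_neqAle dimvS ?addvSr // andbT; apply: contra vU => /eqP e.
      have -> : U = (<[v]> + U)%VS by apply/eqP; rewrite eqEdim addvSr /= e.
      by rewrite memvE addvSl.
    by rewrite -ltnS (leq_trans _ dU) // ltn_sub2l // (leq_trans lt) // dimvS ?subvf.
  move=> w /memv_addP [a /vlineP [k ->]] [b bU ->].
  exact: Pl Pv (UP _ bU).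
apply: (H _ 0%VS (leqnn _)) => v; by rewrite memv0 => /eqP ->.
Qed.

Lemma separating_form (K : fieldType) (V : vectType K) (W : {vspace V}) v : v \notin W ->
  exists f : V -> K, [/\ forall a x y, f (a *: x + y) = a * f x + f y, forall w, w \in W -> f w = 0 & f v != 0].
Proof.
move=> vW; pose w x := x - projv W x.
have w0 : w v != 0.
  by rewrite subr_eq0; apply: contraNneq vW => ->; apply: memv_proj.
have [j wj] : exists j, coord (vbasis {:V}) j (w v) != 0.
  apply/existsP; rewrite -negb_forall; apply: contra w0 => /forallP h.
  rewrite (coord_vbasis (memvf (w v))) big1 // => j _.
  by move/eqP: (h j) => ->; rewrite scale0r.
exists (fun x => coord (vbasis {:V}) j (w x)); split => //.
  move=> a x y; rewrite -[a * _]/(a *: (coord (vbasis {:V}) j (w x) : K^o)) -linearP /=; congr (coord _ _ _).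
  by rewrite /w linearP opprD addrACA scalerBr.
by move=> x xW; rewrite /w projv_id // subrr linear0.
Qed.

(** Applied to the iterates of a nilpotent operator on a vector, this finds a
nonzero vector in the kernel of the operator. *)
Lemma last_nonzero (V : zmodType) (s : nat -> V) N : s 0 != 0 -> s N = 0 ->
  exists2 m, s m != 0 & s m.+1 = 0.
Proof.
elim: N => [|N IH] s0 sN; first by rewrite sN eqxx in s0.
case: (eqVneq (s N) 0) => [/(IH s0)//|sN0]; by exists N.
Qed.

Definition natr_inj0 (D : fieldType) := forall n : nat, (n%:R == 0 :> D) = (n == 0)%N.

Lemma pchar0_natf_eq0 (D : fieldType) : [pchar D] =i pred0 -> natr_inj0 D.
Proof. by move=> h n; have -> := (pcharf0P D).1 h. Qed.

Lemma natr_inj (D : fieldType) : natr_inj0 D -> injective (fun k : nat => k%:R : D).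
Proof.
move=> D0 i j; wlog ij : i j / (i <= j)%N.
  by move=> w; case: (leqP i j) => [/w//|/ltnW /w h] /esym /h.
move=> /esym/eqP; rewrite -subr_eq0 -natrB // D0 subn_eq0 => ji.
by apply/eqP; rewrite eqn_leq ij.
Qed.

(** For a full rank factorization e = C R, idempotency amounts to R C = 1. *)
Lemma mxtrace_idem (D : fieldType) n (e : 'M[D]_n) : e *m e = e -> \tr e = (\rank e)%:R.
Proof.
move=> ee; rewrite -[in LHS](mulmx_base e) mxtrace_mulC.
suff -> : row_base e *m col_base e = 1%:M by rewrite mxtrace_scalar.
have := col_base_full e; have := row_base_free e; have := mulmx_base e.
move: (row_base e) (col_base e) => R C CR fR fC.
have {}ee : C *m (R *m C) *m R = C *m R by rewrite -mulmxA -mulmxA mulmxA CR.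
have /(congr1 (mulmx^~ (pinvmx R))) := congr1 (mulmx (pinvmx C)) ee.
move: (mulVpmx fC) (mulmxVp fR); move: (pinvmx C) (pinvmx R) => C' R' C'C RR'.
by rewrite /= !mulmxA C'C !mul1mx -!mulmxA RR' mulmx1.
Qed.

(** By induction on the size: if X = C R is a full rank factorization, R C is a
smaller nilpotent matrix with the same trace. *)
Lemma mxtrace_nilp (D : fieldType) n (X : 'M[D]_n) k : X ^+ k = 0 -> \tr X = 0.
Proof.
elim/ltn_ind: n X k => n IH X k Xk.
case: (posnP n) => [n0|n_gt0]; first by move: X Xk; rewrite n0 => X _; rewrite /mxtrace big_ord0.
have rX : (\rank X < n)%N.
  rewrite ltn_neqAle rank_leq_row andbT; apply/eqP => rX.
  have : X \in unitmx by rewrite -row_free_unit /row_free rX.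
  case: n {IH} n_gt0 X Xk rX => // n _ X Xk rX uX.
  have : X ^+ k \is a GRing.unit by apply: unitrX.
  by rewrite Xk unitr0.
rewrite -(mulmx_base X) mxtrace_mulC.
apply: (IH _ rX _ k.+1).
have gen r (R : 'M[D]_(r, n)) (C : 'M[D]_(n, r)) : (R *m C) ^+ k.+1 = R *m (C *m R) ^+ k *m C.
  elim: k {Xk} => [|k IHk]; first by rewrite expr1 expr0 mulmx1.
  by rewrite exprS IHk exprS -!mulmxE !mulmxA.
by rewrite gen mulmx_base Xk mulmx0 mul0mx.
Qed.

Section Primary.
Variables (D : fieldType) (n : nat).
Implicit Types X Y Z : 'M[D]_n.+1.

(** The Bezout relation between the power of T - lam and the part of the
characteristic polynomial prime to T - lam gives the projection on the primary
component of lam as a polynomial in X.  It is 0 when lam is not an eigenvalue. *)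
Lemma primary_proj X (lam : D) : exists E : {poly D}, let e := horner_mx X E in
  [/\ (X - lam%:M) ^+ n.+1 * e = 0,
      e * e = e,
      exists v : {poly D}, 1 - e = horner_mx X v * (X - lam%:M) ^+ n.+1 &
      forall m (v : 'M_(n.+1, m)), X *m v = lam *: v -> e *m v = v].
Proof.
have [m [q /implyP ql cE]] := multiplicity_XsubC (char_poly X) lam.
have c0 : char_poly X != 0 by rewrite -size_poly_eq0 size_char_poly.
have {}ql := ql c0.
have mN : (m <= n.+1)%N.
  have /dvdp_leq : ('X - lam%:P) ^+ m %| char_poly X by rewrite cE dvdp_mulIr.
  by rewrite size_char_poly size_exp_XsubC ltnS; apply.
have /Bezout_eq1_coprimepP [[u v] /= uv] : coprimep q (('X - lam%:P) ^+ n.+1).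
  by apply: coprimep_expr; rewrite coprimep_XsubC.
have hX : horner_mx X ('X - lam%:P) = X - lam%:M by rewrite rmorphB /= horner_mx_X horner_mx_C.
have e1 : 1 - horner_mx X (u * q) = horner_mx X v * (X - lam%:M) ^+ n.+1.
  rewrite -hX -rmorphXn -rmorphM /=.
  by rewrite -[1](rmorph1 (horner_mx X)) -rmorphB /= -{1}uv addrC addKr.
have ke : (X - lam%:M) ^+ n.+1 * horner_mx X (u * q) = 0.
  rewrite -hX -rmorphXn -rmorphM /=.
  have -> : ('X - lam%:P) ^+ n.+1 * (u * q) = ('X - lam%:P) ^+ (n.+1 - m) * u * char_poly X.
    by rewrite cE -{1}(subnK mN) exprD -!mulrA; congr (_ * _); rewrite mulrC -mulrA.
  by rewrite rmorphM /= Cayley_Hamilton mulr0.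
exists (u * q); split => //.
- apply/eqP; rewrite eq_sym -subr_eq0 -{1}[horner_mx X _]mul1r -mulrBl e1 -mulrA ke mulr0 //.
- by exists v.
- move=> p w Xw; apply/eqP; rewrite eq_sym -subr_eq0 -{1}[w]mul1mx -mulmxBl e1 exprSr mulrA -mulmxE -!mulmxA.
  by rewrite mulmxBl Xw mul_scalar_mx subrr !mulmx0.
Qed.

Lemma comm_poly_mx X Y (p : {poly D}) : Y * X = X * Y -> Y * horner_mx X p = horner_mx X p * Y.
Proof. by move=> h; apply/esym; apply: comm_horner_mx; apply/esym. Qed.

Lemma coprime_kill X (lam mu : D) k l m (v : 'M_(n.+1, m)) : lam != mu ->
  (X - lam%:M) ^+ k *m v = 0 -> (X - mu%:M) ^+ l *m v = 0 -> v = 0.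
Proof.
move=> lm h1 h2.
have /Bezout_eq1_coprimepP [[u w] /= uw] : coprimep (('X - lam%:P) ^+ k) (('X - mu%:P) ^+ l).
  by apply: coprimep_expr; apply: coprimep_expl; rewrite coprimep_XsubC root_XsubC eq_sym.
have hX c : horner_mx X ('X - c%:P) = X - c%:M by rewrite rmorphB /= horner_mx_X horner_mx_C.
rewrite -[v]mul1mx -[1%:M](rmorph1 (horner_mx X)) -uw rmorphD !rmorphM !rmorphXn /= !hX.
by rewrite mulmxDl -!mulmxE -!mulmxA h1 h2 !mulmx0 addr0.
Qed.

Lemma nilp_scaled X (lam : D) k m (v : 'M_(n.+1, m)) : X ^+ k = 0 -> X *m v = lam *: v -> v != 0 -> lam = 0.
Proof.
move=> Xk Xv v0.
have : X ^+ k *m v = lam ^+ k *: v.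
  elim: k {Xk} => [|k IH]; first by rewrite !expr0 mul1mx scale1r.
  by rewrite exprSr -mulmxE -mulmxA Xv -scalemxAr IH scalerA -exprS.
by rewrite Xk mul0mx => /esym/eqP; rewrite scaler_eq0 (negPf v0) orbF expf_eq0 => /andP [_ /eqP].
Qed.

End Primary.

(** * Weights in the kernel of a raising operator *)

Section Weights.
Variables (D : fieldType) (V : lmodType D) (X W H : V -> V).
Hypothesis D0 : natr_inj0 D.
Hypotheses (linX : linear X) (linH : linear H).
Hypothesis XW : forall v, X (W v) - W (X v) = H v.
Hypothesis HX : forall v, H (X v) - X (H v) = 2%:R *: X v.
Hypothesis W0 : W 0 = 0.

Fixpoint hprod j v := if j is j'.+1 then H (hprod j' v) - j'%:R *: hprod j' v else v.

Let XD u v : X (u + v) = X u + X v. Proof. by have := linX 1 u v; rewrite !scale1r. Qed.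
Let X0 : X 0 = 0. Proof. by apply: (@addrI _ (X 0)); rewrite -XD !addr0. Qed.
Let XZ a u : X (a *: u) = a *: X u. Proof. by have := linX a u 0; rewrite X0 !addr0. Qed.
Let HD u v : H (u + v) = H u + H v. Proof. by have := linH 1 u v; rewrite !scale1r. Qed.
Let H0 : H 0 = 0. Proof. by apply: (@addrI _ (H 0)); rewrite -HD !addr0. Qed.
Let HZ a u : H (a *: u) = a *: H u. Proof. by have := linH a u 0; rewrite H0 !addr0. Qed.

(** Only the relations [X, W] = H and [H, X] = 2 X are available: in Morozov's
lemma W is at hand before one knows how H acts on it. *)
Lemma raise_lower k u : iter k.+1 X (W u) =
  W (iter k.+1 X u) + k.+1%:R *: (H (iter k X u) - k%:R *: iter k X u).
Proof.
elim: k => [|k IH].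
  by rewrite /= scale0r subr0 scale1r -XW addrC subrK.
have XB v w : X (v - w) = X v - X w by rewrite -scaleN1r XD XZ scaleN1r.
rewrite iterS IH XD XZ XB XZ -[X (W _)](subrK (W (X (iter k.+1 X u)))) XW -!iterS.
rewrite [X in X + _ = _]addrC -[LHS]addrA; congr (_ + _).
have -> : X (H (iter k X u)) = H (iter k.+1 X u) - 2%:R *: iter k.+1 X u.
  by rewrite -HX subKr.
move: (iter k.+1 X u) => b; move: (H b) => a.
rewrite -{1}[a]scale1r -addrA -opprD -scalerDl !scalerBr !scalerA addrA -scalerDl.
by congr (_ *: _ - _ *: _); rewrite -!natr1; ring.
Qed.

(** By [raise_lower], if X v = 0 then the product of the H - i for i < k, applied
to v, is X^k applied to some vector. *)
Lemma weight_prod N v : (forall u, iter N X u = 0) -> X v = 0 -> hprod N v = 0.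
Proof.
move=> XN Xv.
have Xh j : X (hprod j v) = 0.
  elim: j => //= j IH; rewrite -scaleNr XD XZ IH scaler0 addr0.
  by have := HX (hprod j v); rewrite IH H0 sub0r scaler0 => /eqP; rewrite oppr_eq0 => /eqP.
have Xp j : exists u, hprod j v = iter j X u.
  elim: j => [|j [u uE]]; first by exists v.
  exists ((j.+1%:R)^-1 *: W u).
  have iZ m a w : iter m X (a *: w) = a *: iter m X w.
    by elim: m => //= m ->; rewrite XZ.
  rewrite iZ raise_lower iterS -uE Xh W0 add0r scalerA mulVf ?scale1r //.
  by rewrite D0.
by have [u ->] := Xp N; rewrite XN.
Qed.

Lemma hprod_eigen j v c : H v = c *: v -> hprod j v = (\prod_(i < j) (c - i%:R)) *: v.
Proof.
move=> Hv; elim: j => [|j IH] /=; first by rewrite big_ord0 scale1r.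
by rewrite IH HZ Hv big_ord_recr /= !scalerA -scalerBl mulrBr [j%:R * _]mulrC.
Qed.

Lemma weight_nat N v c : (forall u, iter N X u = 0) -> X v = 0 -> H v = c *: v -> v != 0 ->
  exists2 m, (m < N)%N & c = m%:R.
Proof.
move=> XN Xv Hv v0; have := weight_prod XN Xv.
rewrite (hprod_eigen N Hv) => /eqP; rewrite scaler_eq0 (negPf v0) orbF => /prodf_eq0 [i _ /eqP /subr0_eq ->].
by exists i.
Qed.
End Weights.

(** * Commutators *)

Section Ad.
Variables (D : fieldType) (n : nat).
Implicit Types X Y Z : 'M[D]_n.+1.

Definition ad X Y : 'M[D]_n.+1 := X * Y - Y * X.

Lemma ad_linear X : linear (ad X).
Proof. by move=> a u v; rewrite /ad mulrDr mulrDl -scalerAr -scalerAl opprD addrACA scalerBr. Qed.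

(** Each application of ad X puts one more factor X on the left or on the right. *)
Lemma ad_nilp_kill X a b Y : X ^+ a * Y = 0 -> Y * X ^+ b = 0 -> iter (a + b) (ad X) Y = 0.
Proof.
have iB m u v : iter m (ad X) (u - v) = iter m (ad X) u - iter m (ad X) v.
  elim: m u v => // m IH u v; rewrite !iterSr -IH; congr (iter _ _ _).
  by rewrite /ad mulrBr mulrBl opprD addrACA -opprD.
have i0 m : iter m (ad X) 0 = 0 by elim: m => //= m ->; rewrite /ad mulr0 mul0r subrr.
move: {2}(a + b)%N (leqnn (a + b)) => c; elim: c a b Y => [|c IH] a b Y.
  by rewrite leqn0 addn_eq0 => /andP [/eqP -> /eqP ->]; rewrite expr0 mul1r.
case: a => [|a]; first by rewrite expr0 mul1r => _ -> _; rewrite i0.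
case: b => [|b]; first by rewrite expr0 mulr1 => _ _ ->; rewrite i0.
move=> le h1 h2; rewrite addSn iterSr iB.
rewrite (IH a b.+1); first last.
- by rewrite -mulrA h2 mulr0.
- by rewrite mulrA -exprSr.
- by rewrite -ltnS.
rewrite addnS -addSn (IH a.+1 b) ?subr0 //.
- by rewrite addSn -addnS -ltnS.
- by rewrite mulrA h1 mul0r.
- by rewrite -mulrA -exprS.
Qed.

Lemma ad_nilp X k : X ^+ k = 0 -> forall Y, iter (k + k) (ad X) Y = 0.
Proof. by move=> h Y; apply: ad_nilp_kill; rewrite h ?mul0r ?mulr0. Qed.

Lemma adC X Y : ad X Y = - ad Y X. Proof. by rewrite /ad opprB. Qed.
Lemma jacobi X Y Z : ad X (ad Y Z) = ad (ad X Y) Z + ad Y (ad X Z).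
Proof.
rewrite /ad !mulrBr !mulrBl !mulrA !opprB.
move: (X * Y * Z) (X * Z * Y) (Y * Z * X) (Z * Y * X) (Y * X * Z) (Z * X * Y) => a b c d e f.
apply/matrixP => i j; rewrite !mxE; ring.
Qed.
Lemma ad_mul (x a b : 'M[D]_n.+1) : ad x (a * b) = ad x a * b + a * ad x b.
Proof. by rewrite /ad mulrBl mulrBr !mulrA addrA subrK. Qed.

Lemma adB (x a b : 'M[D]_n.+1) : ad x (a - b) = ad x a - ad x b.
Proof. by rewrite -scaleN1r addrC ad_linear scaleN1r addrC. Qed.
Lemma adD (x a b : 'M[D]_n.+1) : ad x (a + b) = ad x a + ad x b.
Proof. by have := ad_linear x 1 a b; rewrite !scale1r. Qed.
Lemma ad0 (x : 'M[D]_n.+1) : ad x 0 = 0. Proof. by rewrite /ad mulr0 mul0r subr0. Qed.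
Lemma adZ (x : 'M[D]_n.+1) k a : ad x (k *: a) = k *: ad x a.
Proof. by have := ad_linear x k a 0; rewrite ad0 !addr0. Qed.
Lemma adZl (x : 'M[D]_n.+1) k a : ad (k *: x) a = k *: ad x a.
Proof. by rewrite adC adZ -scalerN -adC. Qed.

End Ad.

(** * Exponential and logarithm of nilpotent and unipotent matrices *)

Section ExpLog.
Variables (D : fieldType) (n : nat).
Hypothesis D0 : natr_inj0 D.
Implicit Types X Y g : 'M[D]_n.+1.

(** For nilpotent X the projection on the primary component of 0 is 1. *)
Lemma nilp_bound X k : X ^+ k = 0 -> X ^+ n.+1 = 0.
Proof.
move=> Xk; have [E /= [Xe ee [v ve] _]] := primary_proj X 0.
rewrite raddf0 subr0 in Xe ve.
have c : GRing.comm (horner_mx X v) (X ^+ n.+1).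
  by apply: commrX; rewrite /GRing.comm -(comm_poly_mx v (erefl (X * X))).
have id1 : (1 - horner_mx X E) * (1 - horner_mx X E) = 1 - horner_mx X E.
  by rewrite mulrBl mul1r mulrBr mulr1 ee subrr subr0.
have idk j : (1 - horner_mx X E) ^+ j.+1 = 1 - horner_mx X E.
  by elim: j => [|j IH]; [rewrite expr1 | rewrite exprS IH id1].
have e0 : 1 - horner_mx X E = 0.
  rewrite -(idk k) exprSr ve (exprMn_comm _ c) -exprM mulnC exprM Xk expr0n /=.
  case: k Xk => [|k]; last by rewrite mulr0 mul0r.
  by rewrite expr0 => /eqP; rewrite oner_eq0.
by move/subr0_eq: e0 Xe => <-; rewrite mulr1.
Qed.

Definition nilp X := X ^+ n.+1 = 0.

Lemma nilpS X k : nilp X -> (n < k)%N -> X ^+ k = 0.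
Proof. by move=> h le; rewrite -(subnK le) exprD h mulr0. Qed.

Lemma nilpN X : nilp X -> nilp (- X).
Proof. by rewrite /nilp => h; rewrite exprNn h mulr0. Qed.

Lemma nilpZ X c : nilp X -> nilp (c *: X).
Proof. by rewrite /nilp => h; rewrite exprZn h scaler0. Qed.

Lemma nilpD X Y : X * Y = Y * X -> nilp X -> nilp Y -> nilp (X + Y).
Proof.
move=> c hX hY; apply: (@nilp_bound _ (n.+1 + n.+1)).
rewrite exprDn_comm // big1 // => i _.
case: (leqP i n) => h.
  by rewrite (nilpS hX) ?mul0r ?mul0rn //; lia.
by rewrite (nilpS hY h) mulr0 mul0rn.
Qed.

Lemma nilpM X Y : X * Y = Y * X -> nilp X -> nilp (X * Y).
Proof. by rewrite /nilp => c h; rewrite exprMn_comm // h mul0r. Qed.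

Definition exp_poly : {poly D} := \poly_(k < n.+1) (k`!%:R)^-1.
Definition log_poly : {poly D} := \poly_(k < n.+1) (if k == 0%N then 0 else (-1) ^+ k.+1 / k%:R).
Definition expm X : 'M[D]_n.+1 := \sum_(k < n.+1) (k`!%:R)^-1 *: X ^+ k.

Lemma horner_mx_poly X N (E : nat -> D) :
  horner_mx X (\poly_(k < N) E k) = \sum_(k < N) E k *: X ^+ k.
Proof.
rewrite poly_def rmorph_sum /=; apply: eq_bigr => i _.
by rewrite linearZ /= rmorphXn /= horner_mx_X.
Qed.

Lemma expmE X : expm X = horner_mx X exp_poly.
Proof. by rewrite horner_mx_poly. Qed.

Lemma log_mxE g : log_mx g = horner_mx (g - 1) log_poly.
Proof.
rewrite horner_mx_poly /log_mx big_add1 /= big_mkord [RHS]big_ord_recl /= scale0r add0r.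
by apply: eq_bigr.
Qed.

Lemma expm_trunc X N : nilp X -> (n < N)%N -> expm X = \sum_(k < N) (k`!%:R)^-1 *: X ^+ k.
Proof.
move=> hX le; rewrite /expm -!(big_mkord xpredT (fun k => (k`!%:R)^-1 *: X ^+ k)).
rewrite (@big_cat_nat _ _ _ n.+1 0 N) //= [X in _ + X]big_nat_cond [X in _ + X]big1 ?addr0 //.
by move=> i /andP [/andP [h _] _]; rewrite (nilpS hX h) scaler0.
Qed.

Lemma expm_comm X Y : X * Y = Y * X -> expm X * Y = Y * expm X.
Proof. by move=> h; rewrite expmE -(comm_poly_mx _ (esym h)). Qed.

(** Both factors are values at 1 of polynomials with matrix coefficients, so that
the Cauchy product of the series is a product of polynomials. *)
Lemma expmD X Y : X * Y = Y * X -> nilp X -> nilp Y -> expm (X + Y) = expm X * expm Y.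
Proof.
move=> c hX hY.
pose A Z : {poly 'M[D]_n.+1} := \poly_(k < n.+1) ((k`!%:R)^-1 *: Z ^+ k).
have AE Z k : nilp Z -> (A Z)`_k = (k`!%:R)^-1 *: Z ^+ k.
  by move=> h; rewrite coef_poly; case: ltnP => // le; rewrite (nilpS h le) scaler0.
have A1 Z : (A Z).[1] = expm Z.
  by rewrite horner_poly; apply: eq_bigr => i _; rewrite expr1n mulr1.
rewrite -(A1 X) -(A1 Y) -hornerM_comm; last by rewrite /comm_poly mulr1 mul1r.
rewrite (@expm_trunc _ (n.+1 + n.+1)); [|exact: nilpD|by lia].
rewrite (@horner_coef_wide _ (n.+1 + n.+1)).
  apply: eq_bigr => k _; rewrite expr1n mulr1 coefM exprDn_comm // scaler_sumr.
  rewrite [RHS](reindex_inj rev_ord_inj) /=; apply: eq_bigr => i _.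
  have le : (i <= k)%N by rewrite -ltnS.
  rewrite subSS subKn // !AE // -scalerAl -scalerAr scalerA.
  rewrite -scaler_nat scalerA; congr (_ *: _).
  rewrite -(bin_fact le) !natrM; field.
  by rewrite !D0 -!lt0n bin_gt0 le !fact_gt0.
apply: leq_trans (size_polyMleq _ _) _.
by apply: (leq_trans (leq_pred _)); apply: leq_add; apply: size_poly.
Qed.

Lemma expm0 : expm 0 = 1.
Proof. by rewrite /expm big_ord_recl big1 ?addr0 ?expr0 ?fact0 ?invr1 ?scale1r // => i _; rewrite expr0n /= scaler0. Qed.

Lemma expmN X : nilp X -> expm X * expm (- X) = 1.
Proof. by move=> h; rewrite -expmD ?subrr ?expm0 ?mulrN ?mulNr //; apply: nilpN. Qed.

Lemma expm_unit X : nilp X -> expm X \in unitmx.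
Proof. by move=> h; have /mulmx1_unit [] := expmN h. Qed.

Lemma expm_inv X : nilp X -> invmx (expm X) = expm (- X).
Proof. by move=> h; rewrite -[LHS]mulmx1 -[1%:M]/(1 : 'M[D]_n.+1) -(expmN h) -mulmxE mulKmx // expm_unit. Qed.

Lemma expm_conj g X : g \in unitmx -> expm (g *m X *m invmx g) = g *m expm X *m invmx g.
Proof. by move=> ug; rewrite !expmE horner_mx_uconj. Qed.

(** The equation (1 + T) r' = r determines the coefficients of r from the constant
one.  For r = exp (log (1 + T)) - (1 + T), with truncated series, the equation
holds up to order n, whence [exp_log_poly]. *)
Lemma ode_zero (r : {poly D}) : r`_0 = 0 ->
  (forall k, (k < n)%N -> ((1 + 'X) * r^`() - r)`_k = 0) -> forall k, (k < n.+1)%N -> r`_k = 0.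
Proof.
move=> r0 h; elim=> [//|k IH] kn.
have := h k kn; rewrite coefB mulrDl mul1r coefD coef_deriv coefXM.
case: k IH kn => [|k] IH kn /=.
  by rewrite addr0 r0 subr0 mulr1n.
rewrite coef_deriv IH 1?ltnW // mul0rn addr0 subr0 => /eqP.
by rewrite -mulr_natr mulf_eq0 D0 orbF => /eqP.
Qed.

Lemma coef_Xdvd (p : {poly D}) m k : (k < m)%N -> ('X^m * p)`_k = 0.
Proof. by move=> h; rewrite coefXnM h. Qed.

Lemma log_poly_X : exists l, log_poly = 'X * l.
Proof.
have /factor_theorem [l ->] : root log_poly 0.
  by rewrite /root horner_coef0 coef_poly.
by exists l; rewrite polyC0 subr0 mulrC.
Qed.

Lemma deriv_exp_poly : exp_poly^`() = exp_poly - (n`!%:R)^-1 *: 'X^n.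
Proof.
apply/polyP => k; rewrite coef_deriv coefB coefZ coefXn !coef_poly !ltnS.
case: (ltngtP k n) => kn.
- rewrite mulr0 subr0 -[_ *+ k.+1]mulr_natr factS natrM invfM mulrAC mulVf ?mul1r // ?D0 //.
- by rewrite mul0rn mulr0 subr0.
- by rewrite kn mulr1 subrr mul0rn.
Qed.

Lemma deriv_log_poly : log_poly^`() * (1 + 'X) = 1 - (-1) ^+ n *: 'X^n.
Proof.
have E k : (log_poly^`())`_k = if (k < n)%N then (-1) ^+ k else 0.
  rewrite coef_deriv coef_poly ltnS; case: ltnP => // _; last by rewrite mul0rn.
  by rewrite /= -[_ *+ _]mulr_natr divfK ?D0 // !exprS mulrA mulrNN !mul1r.
apply/polyP => k; rewrite mulrDr mulr1 coefD coefMX coefB coef1 coefZ coefXn !E.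
case: k => [|k] /=.
  by rewrite addr0 expr0; case: n => [|m] /=; rewrite ?expr0 ?mulr1 ?subrr // mulr0 subr0.
rewrite sub0r; case: (ltngtP k.+1 n) => kn.
- by rewrite exprS mulN1r addNr mulr0 oppr0.
- by rewrite add0r mulr0 oppr0.
- by rewrite -kn add0r mulr1 exprS mulN1r opprK.
Qed.

Lemma exp_log_poly k : (k < n.+1)%N -> (exp_poly \Po log_poly - (1 + 'X))`_k = 0.
Proof.
set r := _ - _.
have [l lE] := log_poly_X.
apply: ode_zero => [|j jn].
  rewrite /r coefB coefD coef1 coefX addr0 -horner_coef0 horner_comp.
  have -> : log_poly.[0] = 0 by rewrite lE hornerM hornerX mul0r.
  by rewrite horner_coef0 coef_poly /= fact0 invr1 subrr.
have -> : (1 + 'X) * r^`() - r = 'X^n * (- ((-1) ^+ n)%:P * ((exp_poly \Po log_poly)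
   - (n`!%:R^-1)%:P * 'X^n * l ^+ n)  - (n`!%:R^-1)%:P * l ^+ n).
  have -> : (1 + 'X) * r^`() - r = (exp_poly^`() \Po log_poly) * (log_poly^`() * (1 + 'X)) - (exp_poly \Po log_poly).
    by rewrite /r derivB derivD derivC derivX add0r deriv_comp; ring.
  rewrite deriv_log_poly deriv_exp_poly comp_polyB comp_polyZ comp_Xn_poly.
  have -> : log_poly ^+ n = 'X^n * l ^+ n by rewrite lE exprMn.
  rewrite -!mul_polyC; ring.
exact: coef_Xdvd.
Qed.

Lemma horner_mx_comp X (p q : {poly D}) : horner_mx X (p \Po q) = horner_mx (horner_mx X q) p.
Proof.
elim/poly_ind: p => [|p c IH]; first by rewrite comp_poly0 !rmorph0.
by rewrite comp_polyD comp_polyM comp_polyX comp_polyC !rmorphD !rmorphM /= IH !horner_mx_X !horner_mx_C.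
Qed.

Lemma horner_mx_nilp0 X (p : {poly D}) : nilp X -> (forall k, (k < n.+1)%N -> p`_k = 0) -> horner_mx X p = 0.
Proof.
move=> hX h; rewrite -[p]coefK horner_mx_poly big1 // => i _.
case: (ltnP i n.+1) => le; first by rewrite h // scale0r.
by rewrite (nilpS hX le) scaler0.
Qed.

Lemma expm_log g : nilp (g - 1) -> expm (log_mx g) = g.
Proof.
move=> hg; apply/eqP; rewrite expmE log_mxE -horner_mx_comp -subr_eq0.
have e : g = horner_mx (g - 1) (1 + 'X) by rewrite rmorphD rmorph1 /= horner_mx_X addrC subrK.
by rewrite {2}e -rmorphB /= horner_mx_nilp0 // => k; apply: exp_log_poly.
Qed.

Lemma nilp_log g : nilp (g - 1) -> nilp (log_mx g).
Proof.
move=> h; have [l lE] := log_poly_X; rewrite log_mxE lE rmorphM /= horner_mx_X.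
by apply: nilpM => //; apply: comm_poly_mx.
Qed.

Lemma nilp_expm1 X : nilp X -> nilp (expm X - 1).
Proof.
move=> hX; have /factor_theorem [l lE] : root (exp_poly - 1) 0.
  by rewrite /root hornerD hornerN horner_coef0 coef_poly /= fact0 invr1 hornerC subrr.
have -> : expm X - 1 = horner_mx X (exp_poly - 1) by rewrite rmorphB rmorph1 expmE.
rewrite lE polyC0 subr0 mulrC rmorphM /= horner_mx_X.
by apply: nilpM => //; apply: comm_poly_mx.
Qed.

(** Multiplying exp X - 1 by a suitable power of X leaves only the last nonzero
power of X. *)
Lemma expm_eq1 X : nilp X -> expm X = 1 -> X = 0.
Proof.
move=> hX eX; apply/eqP/negPn/negP => X0.
have [|m Xm XSm] := @last_nonzero _ (fun k => X ^+ k.+1) n _ hX; first by rewrite expr1.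
case/negP: Xm; apply/eqP.
have := congr1 (fun Y => Y * X ^+ m) eX.
rewrite /= mul1r /expm big_ord_recl /= mulrDl mulr_suml fact0 invr1 scale1r expr0 mul1r => /eqP.
rewrite -subr_eq0 addrAC subrr add0r.
case: (posnP n) => n0.
  case/negP: X0; apply/eqP; rewrite -[X]expr1 -hX; congr (_ ^+ _.+1).
  by rewrite n0.
rewrite (bigD1 (Ordinal n0)) //= big1 ?addr0 => [|[i ni]].
  by rewrite /bump /= invr1 scale1r -exprD => /eqP.
rewrite -val_eqE /= /bump /= add1n -scalerAl -exprD addSnnS -lt0n => i0.
rewrite (_ : (_ + _ = i.-1 + m.+2)%N) ?exprD ?XSm ?mulr0 ?scaler0 //; lia.
Qed.

(** X and log (exp X) commute and have the same exponential, so that their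
difference has exponential 1. *)
Lemma log_expm X : nilp X -> log_mx (expm X) = X.
Proof.
move=> hX; set L := log_mx _.
have hL : nilp L by apply: nilp_log; apply: nilp_expm1.
have c : X * L = L * X.
  rewrite /L log_mxE; apply: comm_poly_mx.
  by rewrite mulrBr mulrBl mulr1 mul1r expm_comm.
have eL : expm L = expm X by apply: expm_log; apply: nilp_expm1.
apply/subr0_eq/expm_eq1; first by apply: nilpD; [rewrite mulrN mulNr c | | apply: nilpN].
by rewrite expmD ?eL ?expmN //; [rewrite mulrN mulNr c | apply: nilpN].
Qed.
End ExpLog.

(** * Polynomial functions along curves *)

Section MPolyAux.
Variables (D : fieldType) (N : nat).

Lemma mpoly_ring_ind (P : {mpoly D[N]} -> Prop) :
  (forall c, P c%:MP) -> (forall i, P 'X_i) ->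
  (forall p q, P p -> P q -> P (p + q)) -> (forall p q, P p -> P q -> P (p * q)) ->
  forall p, P p.
Proof.
move=> PC PX PD PM; elim/mpolyind => [|c m p _ _ Pp]; first by rewrite -mpolyC0.
apply: (PD _ _ _ Pp); rewrite -mul_mpolyC; apply: (PM _ _ (PC c)).
rewrite mpolyXE_id; apply: (big_ind P); [by rewrite -mpolyC1 | exact: PM |].
by move=> i _; elim: (m i) => [|k IH]; [rewrite expr0 -mpolyC1 | rewrite exprS; apply: PM].
Qed.

Lemma mmap_uniq (R : comNzRingType) (f : {rmorphism D -> R}) (phi : {rmorphism {mpoly D[N]} -> R})
    (h : 'I_N -> R) p :
  (forall c, phi c%:MP = f c) -> (forall i, phi 'X_i = h i) -> phi p = mmap f h p.
Proof.
move=> hC hX; elim/mpoly_ring_ind: p => [c|i|p q IHp IHq|p q IHp IHq].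
- by rewrite hC mmapC.
- by rewrite hX mmapX mmap1U.
- by rewrite !rmorphD /= IHp IHq.
- by rewrite !rmorphM /= IHp IHq.
Qed.

Lemma mmapXU (R : comNzRingType) (f : {rmorphism D -> R}) (h : 'I_N -> R) i : mmap f h 'X_i = h i.
Proof. by rewrite mmapX mmap1U. Qed.

(** The chain rule for p along the polynomial curve c. *)
Lemma deriv_mmap (c : 'I_N -> {poly D}) p :
  (mmap polyC c p)^`() = \sum_i mmap polyC c p^`M(i) * (c i)^`().
Proof.
elim/mpoly_ring_ind: p => [a|i|p q IHp IHq|p q IHp IHq].
- by rewrite mmapC derivC big1 // => i _; rewrite mderivC mmap0 mul0r.
- rewrite mmapXU (bigD1 i) //= mderivX mnmE eqxx scale1r.
  rewrite (_ : (U_(i) - U_(i))%MM = 0%MM); last by apply/mnmP => j; rewrite !mnmE subnn.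
  rewrite mpolyX0 rmorph1 mul1r big1 ?addr0 // => j ji.
  by rewrite mderivX mnmE eq_sym (negPf ji) scale0r mmap0 mul0r.
- rewrite !rmorphD /= derivD IHp IHq -big_split; apply: eq_bigr => i _ /=.
  by rewrite mderivD rmorphD mulrDl.
- rewrite !rmorphM /= derivM IHp IHq mulr_suml mulr_sumr -big_split; apply: eq_bigr => i _ /=.
  by rewrite mderivM rmorphD !rmorphM /=; ring.
Qed.

Lemma horner_mmap (c : 'I_N -> {poly D}) p t : (mmap polyC c p).[t] = p.@[fun i => (c i).[t]].
Proof.
rewrite -[LHS]/((horner_eval t \o mmap polyC c) p) /meval.
apply: mmap_uniq => [a|i] /=; first by rewrite mmapC /horner_eval hornerC.
by rewrite mmapXU.
Qed.

End MPolyAux.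

Lemma hornerMf (D : fieldType) (p q : {poly D}) t : (p * q).[t] = p.[t] * q.[t].
Proof. exact: hornerM. Qed.

Lemma deriv_mul2_0 (D : fieldType) (c a b r : {poly D}) : a.[0] = 0 -> b.[0] = 0 ->
  (c * (a * (b * r)))^`().[0] = 0.
Proof.
move=> a0 b0; rewrite (_ : c * _ = a * (b * (c * r))); last by ring.
by rewrite derivM hornerD (hornerMf (deriv a)) (hornerMf a) (hornerMf b) a0 b0 !mul0r mulr0 addr0.
Qed.

Lemma deriv_sum (R : nzRingType) I (r : seq I) (Q : pred I) (F : I -> {poly R}) :
  (\sum_(i <- r | Q i) F i)^`() = \sum_(i <- r | Q i) (F i)^`().
Proof. by elim/big_rec2: _ => [|i x y _ <-]; rewrite ?deriv0 ?derivD // -polyC0 derivC. Qed.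

(** * Coordinates on the general linear group *)

Section Coords.
Variable n : nat.
Local Notation N := (n.+1 * n.+1 + 1)%N.

(** A matrix and a scalar standing for the inverse of its determinant, over any
ring: points of GL_n, polynomial curves and polynomial substitutions are all of
this form. *)
Definition coords (R : nzRingType) (M : 'M[R]_n.+1) (d : R) : 'I_N -> R :=
  fun i => row_mx (mxvec M) d%:M 0 i.

Lemma coordsEl (R : nzRingType) (M : 'M[R]_n.+1) d i j : coords M d (lshift 1 (mxvec_index i j)) = M i j.
Proof. by rewrite /coords row_mxEl mxvecE. Qed.
Lemma coordsEr (R : nzRingType) (M : 'M[R]_n.+1) d : coords M d (rshift _ 0) = d.
Proof. by rewrite /coords row_mxEr mxE eqxx. Qed.

Lemma coord_ind (P : 'I_N -> Prop) :
  (forall i j, P (lshift 1 (mxvec_index i j))) -> P (rshift _ 0) -> forall i, P i.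
Proof.
move=> h1 h2 i; case: (splitP i) => j ij.
  have -> : i = lshift 1 j by apply: val_inj.
  by case/mxvec_indexP: j {ij} => a b.
have -> : i = rshift _ j by apply: val_inj.
by rewrite (ord1 j).
Qed.

Lemma coords_map (R S : nzRingType) (f : R -> S) (M : 'M[R]_n.+1) d i :
  f (coords M d i) = coords (map_mx f M) (f d) i.
Proof. by elim/coord_ind: i => [i j|]; rewrite ?coordsEl ?coordsEr ?mxE. Qed.

Lemma coords_eqfun (R : nzRingType) (M M' : 'M[R]_n.+1) d d' : M = M' -> d = d' -> coords M d =1 coords M' d'.
Proof. by move=> -> ->. Qed.

Variable D : fieldType.
Local Notation P := {mpoly D[N]}.

Definition generic_mx : 'M[P]_n.+1 := \matrix_(i, j) 'X_(lshift 1 (mxvec_index i j)).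
Definition inv_det : P := 'X_(rshift _ 0).
Notation cst := (map_mx (@mpolyC N D)).

Section Mmap.
Variables (R : comNzRingType) (f : {rmorphism D -> R}) (M : 'M[R]_n.+1) (d : R).
Lemma mmap_U : map_mx (mmap f (coords M d)) generic_mx = M.
Proof. by apply/matrixP => i j; rewrite !mxE mmapXU coordsEl. Qed.
Lemma mmap_inv_det : mmap f (coords M d) inv_det = d.
Proof. by rewrite mmapXU coordsEr. Qed.
Lemma mmap_cst (A : 'M[D]_n.+1) : map_mx (mmap f (coords M d)) (cst A) = map_mx f A.
Proof. by apply/matrixP => i j; rewrite !mxE mmapC. Qed.
End Mmap.

Definition poly_subst (M : 'M[P]_n.+1) (d : P) : P -> P := mmap (@mpolyC N D) (coords M d).

Lemma mmap_subst (R : comNzRingType) (f : {rmorphism D -> R}) (h : 'I_N -> R) M d p :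
  mmap f h (poly_subst M d p) = mmap f (coords (map_mx (mmap f h) M) (mmap f h d)) p.
Proof.
rewrite -[LHS]/((mmap f h \o mmap (@mpolyC N D) (coords M d)) p).
by apply: mmap_uniq => [c|i] /=; [rewrite !mmapC | rewrite mmapXU coords_map].
Qed.

Lemma GL_coordE (g : 'M[D]_n.+1) : GL_coord g = coords g (\det g)^-1. Proof. by []. Qed.
Lemma GL_tangentE (X : 'M[D]_n.+1) : GL_tangent_coord X = coords X (- \tr X). Proof. by []. Qed.

Definition dLie (p : P) (X : 'M[D]_n.+1) : D :=
  \sum_i (p^`M(i)).@[GL_coord 1%:M] * GL_tangent_coord X i.

(** Any polynomial curve through 1 with tangent X computes the differential of p
at 1 along X. *)
Lemma dLie_curve (p : P) X (c : 'I_N -> {poly D}) :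
  (forall i, (c i).[0] = GL_coord 1%:M i) -> (forall i, (c i)^`().[0] = GL_tangent_coord X i) ->
  (mmap polyC c p)^`().[0] = dLie p X.
Proof.
move=> c0 c1; rewrite deriv_mmap horner_sum; apply: eq_bigr => i _.
by rewrite hornerM horner_mmap c1; congr (_ * _); apply: meval_eq.
Qed.

Definition lin_mx (A B : 'M[D]_n.+1) : 'M[{poly D}]_n.+1 := map_mx polyC A + 'X *: map_mx polyC B.
(** The last coordinate is the inverse of the determinant of 1 + t X to first
order, which is all that a derivative at 0 sees. *)
Definition line (X : 'M[D]_n.+1) : 'I_N -> {poly D} := coords (lin_mx 1 X) (1 - (\tr X)%:P * 'X).

Lemma lin_mxE A B i j : lin_mx A B i j = (A i j)%:P + (B i j)%:P * 'X.
Proof. by rewrite !mxE mulrC. Qed.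

Lemma dLie_line p X : dLie p X = (mmap polyC (line X) p)^`().[0].
Proof.
apply/esym/dLie_curve => i; rewrite /line.
  elim/coord_ind: i => [i j|]; rewrite GL_coordE ?coordsEl ?coordsEr.
    by rewrite lin_mxE hornerD hornerC hornerM hornerX mulr0 addr0.
  by rewrite hornerD hornerN hornerM hornerX mulr0 subr0 hornerC det1 invr1.
elim/coord_ind: i => [i j|]; rewrite GL_tangentE ?coordsEl ?coordsEr.
  by rewrite lin_mxE derivD derivC add0r deriv_mulC derivX mulr1 hornerC.
by rewrite derivB derivC sub0r deriv_mulC derivX mulr1 hornerN hornerC.
Qed.

(** A permutation other than 1 moves two indices, so its term in the determinant of
1 + t X is divisible by t^2. *)
Lemma deriv_det_line X : (\det (lin_mx 1 X))^`().[0] = \tr X.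
Proof.
rewrite /determinant deriv_sum horner_sum (bigD1 (1%g : {perm 'I_n.+1})) //= [X in _ + X]big1 ?addr0 => [|s s1].
  rewrite perm.odd_perm1 expr0 mul1r.
  rewrite (eq_bigr (fun i => 1 + (X i i)%:P * 'X)) => [|i _]; last first.
    by rewrite perm.perm1 lin_mxE mxE eqxx.
  rewrite /mxtrace.
  suff H (r : seq 'I_n.+1) : (\prod_(i <- r) (1 + (X i i)%:P * 'X)).[0] = 1 /\
      (\prod_(i <- r) (1 + (X i i)%:P * 'X))^`().[0] = \sum_(i <- r) X i i by have [] := H (index_enum _).
  elim: r => [|i r [p0 p1]]; first by rewrite !big_nil derivC !hornerC.
  rewrite !big_cons; move: (\prod_(j <- r) _) (\sum_(j <- r) _) p0 p1 => q y p0 p1.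
  have e0 : (1 + (X i i)%:P * 'X).[0] = 1 by rewrite hornerD hornerMf hornerX !hornerC mulr0 addr0.
  have e1 : (1 + (X i i)%:P * 'X)^`().[0] = X i i.
    by rewrite derivD derivC add0r deriv_mulC derivX mulr1 hornerC.
  split; first by rewrite hornerMf e0 p0 mulr1.
  by rewrite derivM hornerD (hornerMf (deriv _)) (hornerMf (1 + _)) e0 e1 p0 p1 mulr1 mul1r.
have [i si] : exists i, s i != i.
  apply/existsP; rewrite -negb_forall; apply: contra s1 => /forallP h.
  by apply/eqP/permP => i; rewrite perm.perm1; apply/eqP.
rewrite (bigD1 i) //= (bigD1 (s i)) //=.
have z k : s k != k -> (lin_mx 1 X k (s k)).[0] = 0.
  by move=> sk; rewrite lin_mxE mxE eq_sym (negPf sk) add0r hornerMf hornerX mulr0.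
have si2 : s (s i) != s i by rewrite (inj_eq perm.perm_inj).
by apply: deriv_mul2_0; apply: z.
Qed.

Lemma lin_mx0 A B : map_mx (horner_eval 0) (lin_mx A B) = A.
Proof. by apply/matrixP => i j; rewrite mxE lin_mxE /horner_eval hornerD hornerMf hornerX mulr0 addr0 hornerC. Qed.

Definition dmx (A : 'M[{poly D}]_n.+1) : 'M[D]_n.+1 := \matrix_(i, j) (A i j)^`().[0].
Definition emx (A : 'M[{poly D}]_n.+1) : 'M[D]_n.+1 := map_mx (horner_eval 0) A.

Lemma dmxM A B : dmx (A *m B) = dmx A *m emx B + emx A *m dmx B.
Proof.
apply/matrixP => i j; rewrite !mxE deriv_sum horner_sum -big_split; apply: eq_bigr => k _.
by rewrite derivM hornerD !hornerMf !mxE.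
Qed.
Lemma emxM A B : emx (A *m B) = emx A *m emx B.
Proof. exact: map_mxM. Qed.
Lemma dmx_lin A B : dmx (lin_mx A B) = B.
Proof. by apply/matrixP => i j; rewrite mxE lin_mxE derivD derivC add0r deriv_mulC derivX mulr1 hornerC. Qed.
Lemma emx_lin A B : emx (lin_mx A B) = A. Proof. exact: lin_mx0. Qed.
Lemma dmx_cst A : dmx (map_mx polyC A) = 0.
Proof. by apply/matrixP => i j; rewrite !mxE derivC hornerC. Qed.
Lemma emx_cst A : emx (map_mx polyC A) = A.
Proof. by apply/matrixP => i j; rewrite !mxE /horner_eval hornerC. Qed.
Lemma dmx_tr A : (\tr A)^`().[0] = \tr (dmx A).
Proof. by rewrite /mxtrace deriv_sum horner_sum; apply: eq_bigr => i _; rewrite mxE. Qed.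

Lemma curve_at0 (M : 'M[{poly D}]_n.+1) d i : (coords M d i).[0] = coords (emx M) d.[0] i.
Proof. exact: (coords_map (horner_eval 0)). Qed.
Lemma curve_deriv0 (M : 'M[{poly D}]_n.+1) d i : (coords M d i)^`().[0] = coords (dmx M) (d^`().[0]) i.
Proof.
rewrite (coords_map (fun q : {poly D} => q^`().[0])); apply: coords_eqfun => //.
by apply/matrixP => k l; rewrite !mxE.
Qed.

(** The inverse of 1 + t X to first order in t. *)
Definition inv_line X : 'M[{poly D}]_n.+1 := (1 - (\tr X)%:P * 'X) *: \adj (lin_mx 1 X).

Lemma emx_inv_line X : emx (inv_line X) = 1.
Proof.
apply/matrixP => i j; rewrite 2!mxE /horner_eval hornerMf hornerD hornerN hornerMf hornerX mulr0 subr0 hornerC mul1r.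
have h : map_mx (horner_eval 0) (\adj (lin_mx 1 X)) = 1 by rewrite map_mx_adj lin_mx0 adj1.
by have := congr1 (fun A : 'M[D]_n.+1 => A i j) h; rewrite mxE.
Qed.

Lemma dmx_inv_line X : dmx (inv_line X) = - X.
Proof.
have h : lin_mx 1 X *m inv_line X = ((1 - (\tr X)%:P * 'X) * \det (lin_mx 1 X))%:M.
  by rewrite /inv_line -scalemxAr mul_mx_adj scale_scalar_mx.
have := congr1 dmx h; rewrite dmxM dmx_lin emx_lin emx_inv_line mulmx1 mul1mx.
have d0 : (\det (lin_mx 1 X)).[0] = 1.
  by rewrite -[LHS]/(horner_eval 0 _) -det_map_mx lin_mx0 det1.
have -> : dmx ((1 - (\tr X)%:P * 'X) * \det (lin_mx 1 X))%:M = 0; last first.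
  by move=> /eqP; rewrite addrC addr_eq0 => /eqP.
apply/matrixP => i j; rewrite !mxE; case: (i == j); rewrite ?mulr0n ?derivC ?hornerC // mulr1n.
rewrite derivM hornerD !hornerMf deriv_det_line d0 derivB derivC sub0r deriv_mulC derivX mulr1.
by rewrite hornerN hornerD hornerN hornerMf hornerX mulr0 subr0 !hornerC mul1r mulr1 addNr.
Qed.

End Coords.

(** * The Lie algebra of an algebraic group *)

Section LieGroup.
Variables (D : fieldType) (n : nat).
Hypothesis D0 : natr_inj0 D.
Local Notation N := (n.+1 * n.+1 + 1)%N.
Local Notation P := {mpoly D[N]}.
Local Notation cst := (map_mx (@mpolyC N D)).
Local Notation U := (generic_mx n D).
Local Notation dl := (inv_det n D).
Implicit Types (X Y g : 'M[D]_n.+1) (p : P).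

(** In characteristic 0 the natural numbers are infinitely many points, so they
suffice to check identities between one-parameter groups. *)
Lemma poly_nat_roots (q : {poly D}) : (forall k : nat, q.[k%:R] = 0) -> q = 0.
Proof.
move=> h; apply/eqP/negPn/negP => q0.
have := @max_poly_roots _ q [seq k%:R | k <- iota 0 (size q)] q0.
rewrite size_map size_iota ltnn => h'; suff: false by [].
apply: h'; first by apply/allP => _ /mapP [k _ ->]; rewrite /root h.
by rewrite map_inj_uniq ?iota_uniq //; apply: natr_inj.
Qed.

Lemma meval_subst (h : 'I_N -> D) M d p :
  (poly_subst M d p).@[h] = p.@[coords (map_mx (meval h) M) (d.@[h])].
Proof. exact: (mmap_subst idfun). Qed.
Lemma meval_U g d : map_mx (meval (coords g d)) U = g.
Proof. exact: (mmap_U idfun). Qed.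
Lemma meval_dl g d : dl.@[coords g d] = d.
Proof. exact: (mmap_inv_det idfun). Qed.
Lemma meval_cst (h : 'I_N -> D) X : map_mx (meval h) (cst X) = X.
Proof. by apply/matrixP => i j; rewrite !mxE mevalC. Qed.

Definition vanish (G : 'M[D]_n.+1 -> Prop) p := forall g, G g -> p.@[GL_coord g] = 0.

Variable G : 'M[D]_n.+1 -> Prop.
Hypothesis GG : algebraic_group G.

Lemma alg_unit g : G g -> g \in unitmx. Proof. by case: GG => [[h _ _ _] _]; apply: h. Qed.
Lemma alg1 : G 1. Proof. by case: GG => [[_ h _ _] _]. Qed.
Lemma algM g h : G g -> G h -> G (g * h). Proof. by case: GG => [[_ _ H _] _]; apply: H. Qed.
Lemma algV g : G g -> G (invmx g). Proof. by case: GG => [[_ _ _ h] _]; apply: h. Qed.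
Lemma algX g k : G g -> G (g ^+ k).
Proof. by move=> h; elim: k => [|k IH]; rewrite ?exprS; [apply: alg1 | apply: algM]. Qed.
Lemma alg_mem g : g \in unitmx -> (forall p, vanish G p -> p.@[GL_coord g] = 0) -> G g.
Proof.
case: GG => _ [I hI] ug h; apply/hI; split=> // p Ip; apply: h => k /hI [_]; exact.
Qed.

Lemma Lie0 : Lie G 0.
Proof.
move=> p _; rewrite big1 // => i _; rewrite GL_tangentE (_ : coords _ _ i = 0) ?mulr0 //.
by elim/coord_ind: i => [i j|]; rewrite ?coordsEl ?coordsEr ?mxE ?mxtrace0 ?oppr0.
Qed.

Lemma tangent_linear a X Y i :
  GL_tangent_coord (a *: X + Y) i = a * GL_tangent_coord X i + GL_tangent_coord Y i.
Proof.
rewrite !GL_tangentE; elim/coord_ind: i => [i j|]; rewrite ?coordsEl ?coordsEr ?mxE //.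
by rewrite mxtraceD mxtraceZ opprD mulrN.
Qed.

Lemma dLie_linear p a X Y : dLie p (a *: X + Y) = a * dLie p X + dLie p Y.
Proof.
rewrite /dLie mulr_sumr -big_split; apply: eq_bigr => i _ /=.
by rewrite tangent_linear mulrDr mulrCA.
Qed.

Lemma Lie_linear a X Y : Lie G X -> Lie G Y -> Lie G (a *: X + Y).
Proof.
move=> hX hY p vp; rewrite -/(dLie p _) dLie_linear.
by have -> : dLie p X = 0 := hX p vp; have -> : dLie p Y = 0 := hY p vp; rewrite mulr0 addr0.
Qed.

Definition ltrans g : P -> P := poly_subst (cst g *m U) ((\det g)^-1%:MP * dl).

(** The left-invariant vector field with value X at 1, as a derivation. *)
Definition lder X p : P := \sum_i p^`M(i) * coords (U *m cst X) (dl * (- \tr X)%:MP) i.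

Lemma ltransE g h p : g \in unitmx -> h \in unitmx -> (ltrans g p).@[GL_coord h] = p.@[GL_coord (g *m h)].
Proof.
move=> ug uh; rewrite /ltrans meval_subst; apply: meval_eq; apply: coords_eqfun.
  by rewrite map_mxM meval_cst GL_coordE meval_U.
by rewrite mevalM mevalC GL_coordE meval_dl det_mulmx invfM.
Qed.

Lemma lderE X p g : g \in unitmx -> (lder X p).@[GL_coord g] = dLie (ltrans g p) X.
Proof.
move=> ug; rewrite dLie_line /ltrans mmap_subst deriv_mmap horner_sum /lder raddf_sum /=.
apply: eq_bigr => i _; rewrite mevalM hornerMf; congr (_ * _).
  rewrite horner_mmap; apply: meval_eq => {}i; rewrite curve_at0 map_mxM mmap_cst mmap_U emxM emx_cst emx_lin mulmx1.
  rewrite rmorphM /= mmapC mmap_inv_det hornerMf hornerC.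
  by rewrite hornerD hornerN hornerMf hornerX mulr0 subr0 hornerC mulr1.
rewrite curve_deriv0 [LHS](coords_map (meval (GL_coord g))).
rewrite [X in dmx X]map_mxM mmap_cst mmap_U dmxM emx_cst dmx_cst dmx_lin mul0mx add0r.
rewrite GL_coordE map_mxM meval_cst meval_U; apply: coords_eqfun => //.
rewrite mevalM mevalC meval_dl rmorphM /= mmapC mmap_inv_det deriv_mulC hornerMf hornerC.
by rewrite derivB derivC sub0r deriv_mulC derivX mulr1 hornerN hornerC.
Qed.

(** Left translations by G preserve the ideal of G, so a left-invariant vector
field tangent to G at 1 is tangent to G everywhere. *)
Lemma vanish_lder X p : Lie G X -> vanish G p -> vanish G (lder X p).
Proof.
move=> LX vp g Gg; rewrite lderE ?alg_unit //; apply: LX => h Gh.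
by rewrite ltransE ?alg_unit //; apply: vp; apply: algM.
Qed.

(** The polynomial curve t |-> exp (t X). *)
Definition exp_curve X : 'M[{poly D}]_n.+1 :=
  \matrix_(i, j) \poly_(k < n.+1) ((k`!%:R)^-1 * (X ^+ k) i j).

Lemma exp_curveE X t : map_mx (horner_eval t) (exp_curve X) = expm (t *: X).
Proof.
apply/matrixP => i j; rewrite !mxE /horner_eval horner_poly /expm summxE.
by apply: eq_bigr => k _; rewrite exprZn !mxE -mulrA [_ * t ^+ _]mulrC.
Qed.

Lemma exp_curve_deriv X : nilp X -> map_mx (@deriv D) (exp_curve X) = exp_curve X *m map_mx polyC X.
Proof.
move=> hX; apply/matrixP => i j; rewrite !mxE; apply/polyP => k.
rewrite coef_deriv coef_poly coef_sum.
rewrite (eq_bigr (fun l => (if (k < n.+1)%N then (k`!%:R)^-1 * (X ^+ k) i l else 0) * X l j)); last first.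
  by move=> l _; rewrite !mxE coefMC coef_poly.
have e : (X ^+ k.+1) i j = \sum_l (X ^+ k) i l * X l j by rewrite exprSr mxE.
case: (ltnP k n.+1) => kn; last first.
  by rewrite ltnNge leqW //= mul0rn big1 // => l _; rewrite mul0r.
under eq_bigr do rewrite -mulrA.
rewrite -mulr_sumr -e; case: ltnP => kn2; last by rewrite (nilpS hX kn2) mxE mulr0 mul0rn.
rewrite -[_ *+ k.+1]mulr_natl mulrA factS natrM invfM mulrA mulfV ?mul1r // D0 //.
Qed.

Definition expc X : 'I_N -> {poly D} := coords (exp_curve X) 1.

(** The curve t |-> exp (t X) is an integral curve of the left-invariant field. *)
Lemma expc_deriv X p : nilp X -> (mmap polyC (expc X) p)^`() = mmap polyC (expc X) (lder X p).
Proof.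
move=> hX; rewrite deriv_mmap /lder raddf_sum /=; apply: eq_bigr => i _; rewrite rmorphM /=; congr (_ * _).
rewrite [LHS](coords_map (@deriv D)) [RHS](coords_map (mmap _ _)) exp_curve_deriv // map_mxM mmap_cst mmap_U.
rewrite rmorphM /= mmapC mmap_inv_det.
by rewrite (mxtrace_nilp hX) oppr0 mulr0 derivC.
Qed.

(** Taylor expansion at 0: the coefficients are the q k at 0, up to factorials. *)
Lemma deriv_zero (q : nat -> {poly D}) : (forall k, (q k)^`() = q k.+1) -> (forall k, (q k).[0] = 0) -> q 0%N = 0.
Proof.
move=> qd q0; apply/polyP => k; rewrite coef0.
have H : forall k j, (q j)`_k = 0.
  elim=> [|m IH] j; first by rewrite -horner_coef0.
  have := IH j.+1; rewrite -qd coef_deriv -mulr_natr => /eqP.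
  by rewrite mulf_eq0 D0 orbF => /eqP.
exact: H.
Qed.

(** The determinant of exp (t X) is an invertible polynomial in t, so a constant. *)
Lemma det_expm X : nilp X -> \det (expm X) = 1.
Proof.
move=> hX.
have E : exp_curve X *m exp_curve (- X) = 1%:M.
  apply/matrixP => i j; apply/subr0_eq; apply: poly_nat_roots => k.
  have h : map_mx (horner_eval k%:R) (exp_curve X *m exp_curve (- X)) = 1.
    by rewrite map_mxM !exp_curveE scalerN mulmxE expmN //; apply: nilpZ.
  have := congr1 (fun M : 'M[D]_n.+1 => M i j) h; rewrite mxE /horner_eval hornerD hornerN => ->.
  by rewrite !mxE; case: eqP => _; rewrite ?mulr1n ?mulr0n ?hornerC subrr.
have h : \det (exp_curve X) * \det (exp_curve (- X)) = 1 by rewrite -det_mulmx E det1.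
have : size (\det (exp_curve X)) == 1.
  have : \det (exp_curve X) \is a GRing.unit by apply/unitrPr; exists (\det (exp_curve (- X))).
  by rewrite poly_unitE => /andP [].
move=> /size_poly1P [c c0 dc].
have dt t : \det (expm (t *: X)) = c.
  by have := det_map_mx (horner_eval t) (exp_curve X); rewrite exp_curveE dc => ->; apply: hornerC.
by rewrite -[X]scale1r dt -(dt 0) scale0r expm0 det1.
Qed.

Lemma det_unip g : nilp (g - 1) -> \det g = 1.
Proof. by move=> h; rewrite -(expm_log D0 h) det_expm //; apply: nilp_log. Qed.

Lemma expc_eval X p t : nilp X -> (mmap polyC (expc X) p).[t] = p.@[GL_coord (expm (t *: X))].
Proof.
move=> hX; rewrite horner_mmap; apply: meval_eq => i.
rewrite /expc [LHS](coords_map (horner_eval t)) exp_curveE GL_coordE det_expm ?invr1; last exact: nilpZ.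
by apply: coords_eqfun => //; rewrite /horner_eval hornerC.
Qed.

(** The derivatives at 0 of t |-> p (exp (t X)) are the values at 1 of the iterated
images of p by the left-invariant field of X, which lie in the ideal of G. *)
Lemma exp_in_group X : Lie G X -> nilp X -> G (expm X).
Proof.
move=> LX hX; apply: alg_mem => [|p vp]; first exact: expm_unit.
rewrite -[X]scale1r -expc_eval //.
suff -> : mmap polyC (expc X) p = 0 by rewrite horner0.
pose q k := mmap polyC (expc X) (iter k (lder X) p).
apply: (@deriv_zero q) => k; rewrite /q ?expc_deriv //.
rewrite expc_eval // scale0r expm0.
have : vanish G (iter k (lder X) p) by elim: k => //= k; apply: vanish_lder.
by apply; apply: alg1.
Qed.

(** If p vanishes on G, then t |-> p (exp (t log g)) is a polynomial vanishing at
the natural numbers, where its argument is a power of g. *)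
Lemma log_in_Lie g : G g -> nilp (g - 1) -> Lie G (log_mx g).
Proof.
move=> Gg hg; have hX := nilp_log hg; set X := log_mx g in hX *.
move=> p vp; rewrite -/(dLie p X).
have -> : dLie p X = (mmap polyC (expc X) p)^`().[0].
  apply/esym/dLie_curve => i; rewrite /expc.
    by rewrite curve_at0 /emx exp_curveE scale0r expm0 hornerC GL_coordE det1 invr1.
  rewrite [LHS](coords_map (fun q : {poly D} => q^`().[0])) GL_tangentE (mxtrace_nilp hX) oppr0.
  apply: coords_eqfun; last by rewrite derivC hornerC.
  have -> : map_mx (fun q : {poly D} => q^`().[0]) (exp_curve X) = map_mx (horner_eval 0) (map_mx (@deriv D) (exp_curve X)).
    by apply/matrixP => j k; rewrite !mxE.
  by rewrite exp_curve_deriv // map_mxM exp_curveE scale0r expm0 mul1mx; apply: emx_cst.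
suff -> : mmap polyC (expc X) p = 0 by rewrite deriv0 horner0.
apply: poly_nat_roots => k; rewrite expc_eval //; apply: vp.
have -> : expm (k%:R *: X) = g ^+ k; last exact: algX.
elim: k => [|k IH]; first by rewrite scale0r expm0 expr0.
rewrite -natr1 scalerDl scale1r expmD ?IH //.
- by rewrite expm_log // -exprSr.
- by rewrite -scalerAl -scalerAr.
- exact: nilpZ.
Qed.

(** Conjugation by g preserves the ideal of G; its differential at 1 is the adjoint
action. *)
Lemma Lie_conj g X : G g -> Lie G X -> Lie G (g *m X *m invmx g).
Proof.
move=> Gg LX p vp; rewrite -/(dLie p _); have ug := alg_unit Gg.
pose q := poly_subst (cst g *m U *m cst (invmx g)) dl p.
have vq : vanish G q.
  move=> h Gh; rewrite /q meval_subst !map_mxM !meval_cst GL_coordE meval_U meval_dl.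
  have uh := alg_unit Gh.
  have -> : (\det h)^-1 = (\det (g *m h *m invmx g))^-1.
    by rewrite !det_mulmx det_inv mulrAC mulfV ?mul1r // -unitfE -unitmxE.
  by apply: vp; apply: algM; [apply: algM | apply: algV].
have := LX q vq; rewrite -/(dLie q X) => <-.
rewrite (dLie_line q) /q mmap_subst; apply/esym; apply: dLie_curve => i.
  rewrite curve_at0 !map_mxM !mmap_cst mmap_U mmap_inv_det !emxM !emx_cst emx_lin mulmx1 mulmxV //.
  by rewrite hornerD hornerN hornerMf hornerX mulr0 subr0 hornerC GL_coordE det1 invr1.
rewrite curve_deriv0 !map_mxM !mmap_cst mmap_U mmap_inv_det !dmxM !emxM !emx_cst !dmx_cst dmx_lin emx_lin.
rewrite mulmx0 mul0mx addr0 add0r derivB derivC sub0r deriv_mulC derivX mulr1 hornerN hornerC.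
by rewrite GL_tangentE mxtrace_mulC mulmxA mulVmx // mul1mx.
Qed.

(** The linear forms on matrices are the traces X |-> tr (B X); this is the B of
f. *)
Definition dual_mx (f : 'M[D]_n.+1 -> D) : 'M[D]_n.+1 := \matrix_(i, j) f (delta_mx j i).
Lemma dual_mxE (f : 'M[D]_n.+1 -> D) X : (forall a X Y, f (a *: X + Y) = a * f X + f Y) -> f X = \tr (dual_mx f *m X).
Proof.
move=> fl; have f0 : f 0 = 0.
  by have := fl (-1) 0 0; rewrite scaler0 addr0 mulN1r addNr.
have fS I (r : seq I) (F : I -> 'M[D]_n.+1) : f (\sum_(i <- r) F i) = \sum_(i <- r) f (F i).
  elim: r => [|i r IH]; first by rewrite !big_nil.
  by rewrite !big_cons -[F i]scale1r fl mul1r IH scale1r.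
rewrite {1}[X]matrix_sum_delta fS.
rewrite /mxtrace; under eq_bigr do rewrite fS.
rewrite exchange_big /=; apply: eq_bigr => i _; rewrite mxE; apply: eq_bigr => j _.
by rewrite mxE -[_ *: _]addr0 fl f0 addr0 mulrC.
Qed.

(** The function u |-> tr (B u Y u^-1); its differential is ad, as X |-> tr (B [X, Y]). *)
Definition conj_poly (B Y : 'M[D]_n.+1) : P := \tr (cst B *m (U *m cst Y *m (dl *: \adj U))).

Lemma conj_polyE B Y g : g \in unitmx -> (conj_poly B Y).@[GL_coord g] = \tr (B *m (g *m Y *m invmx g)).
Proof.
move=> ug; rewrite /conj_poly -[LHS]/(meval (GL_coord g) _) -trace_map_mx !map_mxM !meval_cst map_mxZ map_mx_adj.
by rewrite GL_coordE meval_U /= meval_dl /invmx ug.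
Qed.

Lemma conj_poly_dLie B Y X : dLie (conj_poly B Y) X = \tr (B *m (X *m Y - Y *m X)).
Proof.
rewrite dLie_line /conj_poly -trace_map_mx dmx_tr !map_mxM !mmap_cst map_mxZ map_mx_adj mmap_U /= mmap_inv_det.
rewrite -/(inv_line X) !dmxM !emxM !dmx_cst !emx_cst dmx_lin emx_lin dmx_inv_line emx_inv_line.
by rewrite mul0mx add0r mulmx0 addr0 mulmx1 mul1mx mulmxN.
Qed.

(** The differential at 1 of p in the ideal of G is X |-> tr (B X) for some B.  By
[Lie_conj], the function u |-> tr (B u Y u^-1) vanishes on G, and its derivative
along X is tr (B [X, Y]). *)
Lemma Lie_bracket X Y : Lie G X -> Lie G Y -> Lie G (X *m Y - Y *m X).
Proof.
move=> LX LY p vp; rewrite -/(dLie p _) (dual_mxE _ (dLie_linear p)) -conj_poly_dLie.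
apply: LX => g Gg; rewrite conj_polyE ?alg_unit // -(dual_mxE _ (dLie_linear p)).
exact: Lie_conj vp.
Qed.

End LieGroup.

(** * Primary components of an operator on a stable subspace *)

Section Stable.
Variables (D : fieldType) (V : lmodType D) (T : V -> V) (I : V -> Prop).
Hypothesis linT : linear T.
Hypothesis I0 : I 0.
Hypothesis Ilin : forall a u v, I u -> I v -> I (a *: u + v).
Hypothesis IT : forall v, I v -> I (T v).

Definition shift mu v := T v - mu *: v.
(** The vector space may have infinite dimension: it will be the coordinate ring of
GL_n.  So generalized eigenvectors carry their own exponents. *)
Definition gen_eigen mu v := exists k, iter k (shift mu) v = 0.

Let TD u v : T (u + v) = T u + T v. Proof. by have := linT 1 u v; rewrite !scale1r. Qed.
Let T0 : T 0 = 0. Proof. by apply: (@addrI _ (T 0)); rewrite -TD !addr0. Qed.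
Let TZ a u : T (a *: u) = a *: T u. Proof. by have := linT a u 0; rewrite T0 !addr0. Qed.

Lemma shift_lin mu a u v : shift mu (a *: u + v) = a *: shift mu u + shift mu v.
Proof. by rewrite /shift TD TZ scalerDr opprD addrACA scalerBr !scalerA mulrC. Qed.
Lemma shift0 mu : shift mu 0 = 0. Proof. by rewrite /shift T0 scaler0 subrr. Qed.
Lemma shiftC mu nu v : shift mu (shift nu v) = shift nu (shift mu v).
Proof.
have h a b : shift a (shift b v) = T (T v) - (a + b) *: T v + (a * b) *: v.
  rewrite /shift -(scaleNr b) TD TZ scalerDr scalerA opprD addrA mulrN scaleNr scaleNr opprK.
  by rewrite scalerDl opprD addrA [X in X + _ = _]addrAC.
by rewrite !h addrC mulrC [mu + nu]addrC addrC.
Qed.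
Lemma iter_lin mu k a u v : iter k (shift mu) (a *: u + v) = a *: iter k (shift mu) u + iter k (shift mu) v.
Proof. by elim: k => //= k ->; rewrite shift_lin. Qed.
Lemma iter0 mu k : iter k (shift mu) 0 = 0. Proof. by elim: k => //= k ->; rewrite shift0. Qed.
Lemma iterC mu nu k l v : iter k (shift mu) (iter l (shift nu) v) = iter l (shift nu) (iter k (shift mu) v).
Proof.
have h m w : shift nu (iter m (shift mu) w) = iter m (shift mu) (shift nu w).
  by elim: m => //= m IH; rewrite shiftC IH.
by elim: l v => //= l IH v; rewrite -h IH.
Qed.

Let ID u v : I u -> I v -> I (u + v). Proof. by move=> hu hv; rewrite -[u]scale1r; apply: Ilin. Qed.
Let IZ a u : I u -> I (a *: u). Proof. by move=> hu; rewrite -[_ *: _]addr0; apply: Ilin. Qed.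
Let Ishift mu v : I v -> I (shift mu v).
Proof. by move=> h; rewrite /shift -scaleNr; apply: ID; [apply: IT | apply: IZ]. Qed.

Lemma gen_eigen_iter mu nu k v : gen_eigen mu v -> gen_eigen mu (iter k (shift nu) v).
Proof. by case=> l h; exists l; rewrite iterC h iter0. Qed.

Lemma stable_back1 mu nu v : mu != nu -> gen_eigen mu v -> I (shift nu v) -> I v.
Proof.
move=> mn [l]; elim: l v => [|l IH] v; first by move=> /= ->.
rewrite iterSr => h1 h2.
have h3 : I (shift mu v) by apply: IH => //; rewrite shiftC; apply: Ishift.
have : I (shift nu v - shift mu v) by rewrite -[- _]scaleN1r addrC; apply: Ilin.
have -> : shift nu v - shift mu v = (mu - nu) *: v.
  by rewrite /shift scalerBl opprB addrC addrA subrK.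
by move=> /(IZ (mu - nu)^-1); rewrite scalerA mulVf ?scale1r // subr_eq0.
Qed.

(** T - nu is invertible on the generalized eigenvectors for mu, with an inverse
that is a polynomial in T on each of them. *)
Lemma stable_back mu nu k v : mu != nu -> gen_eigen mu v -> I (iter k (shift nu) v) -> I v.
Proof.
move=> mn; elim: k v => // k IH v gv; rewrite iterSr => h.
apply: (stable_back1 mn gv); apply: IH h; exact: (gen_eigen_iter nu 1).
Qed.

(** Applying a power of T - nu removes the component for nu from a sum in I;
[stable_back] then undoes its effect on the other components. *)
Lemma stable_primary (r : seq D) (Q : D -> V) : uniq r -> (forall mu, gen_eigen mu (Q mu)) ->
  I (\sum_(mu <- r) Q mu) -> forall mu, mu \in r -> I (Q mu).
Proof.
elim: r Q => // nu r IH Q /= /andP [nur ur] gQ; rewrite big_cons => Is.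
have [k hk] := gQ nu.
have h : forall mu, mu \in r -> I (Q mu).
  move=> mu mur; apply: (@stable_back _ nu k) (gQ mu) _.
    by apply: contraNneq nur => <-.
  apply: (IH (fun mu => iter k (shift nu) (Q mu))) mur => // [la|]; first exact: gen_eigen_iter.
  have -> : \sum_(la <- r) iter k (shift nu) (Q la) = iter k (shift nu) (Q nu + \sum_(la <- r) Q la).
    rewrite -[Q nu]scale1r iter_lin hk scaler0 add0r; elim: (r) => [|a s IHs]; first by rewrite !big_nil iter0.
    by rewrite !big_cons IHs -[Q a]scale1r iter_lin !scale1r.
  by move: Is; move: (Q nu + _); elim: (k) => // j IHj w /IHj; apply: Ishift.
move=> mu; rewrite inE => /orP [/eqP ->|]; last exact: h.
have -> : Q nu = (-1) *: (\sum_(la <- r) Q la) + (Q nu + \sum_(la <- r) Q la).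
  by rewrite scaleN1r addrC addrK.
apply: Ilin => //; rewrite big_seq; elim/big_ind: _ => //.
Qed.

(** In the triples of s, the second scalar depends only on the first, which is the
eigenvalue; grouping the vectors by eigenvalue gives primary components, which
[stable_primary] puts in I one by one. *)
Lemma stable_replica (s : seq (D * D * V)) :
  (forall x y, x \in s -> y \in s -> x.1.1 = y.1.1 -> x.1.2 = y.1.2) ->
  (forall x, x \in s -> gen_eigen x.1.1 x.2) ->
  I (\sum_(x <- s) x.2) -> I (\sum_(x <- s) x.1.2 *: x.2).
Proof.
move=> fs gs Is.
pose r := undup [seq x.1.1 | x <- s].
pose Q mu := \sum_(x <- s | x.1.1 == mu) x.2.
have part (F : D * D * V -> V) : \sum_(x <- s) F x = \sum_(mu <- r) \sum_(x <- s | x.1.1 == mu) F x.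
  rewrite (exchange_big_dep xpredT) //= big_seq [RHS]big_seq; apply: eq_bigr => x xs.
  rewrite -big_filter (_ : [seq _ <- _ | _] = [:: x.1.1]) ?big_seq1 //.
  have xr : x.1.1 \in r by rewrite mem_undup; apply/mapP; exists x.
  have := filter_pred1_uniq (undup_uniq _) xr; rewrite -/r => <-.
  by apply: eq_filter => y /=; rewrite eq_sym.
have gQ mu : gen_eigen mu (Q mu).
  rewrite /Q big_seq_cond; elim/big_ind: _ => [|u v [k hk] [l hl]|x /andP [xs /eqP <-]]; last exact: gs.
    by exists 0%N.
  exists (k + l)%N; rewrite -[u]scale1r iter_lin scale1r {1}addnC !iterD hk hl !iter0 addr0 //.
have IQ mu : mu \in r -> I (Q mu).
  by apply: stable_primary => //; [apply: undup_uniq | rewrite -part].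
rewrite part big_seq; elim/big_ind: _ => // mu mur.
have /mapP [y ys ey] : mu \in [seq x.1.1 | x <- s] by rewrite -mem_undup.
rewrite big_seq_cond (eq_bigr (fun x => y.1.2 *: x.2)); last first.
  by move=> x /andP [xs /eqP xm]; rewrite (fs x y) // xm.
by rewrite -big_seq_cond -scaler_sumr; apply: IZ; apply: IQ.
Qed.
End Stable.

(** * Rational numbers in a field of characteristic 0 *)

Section RatEmb.
Variable D : fieldType.
Hypothesis D0 : natr_inj0 D.

Lemma intr_eq0_char0 (m : int) : (m%:~R == 0 :> D) = (m == 0).
Proof. by case: m => k; rewrite ?NegzE ?rmorphN ?oppr_eq0 /= -?pmulrn D0. Qed.

Definition ratD (x : rat) : D := (numq x)%:~R / (denq x)%:~R.

Lemma ratD_frac (a b : int) : b != 0 -> ratD (a%:~R / b%:~R) = a%:~R / b%:~R.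
Proof.
move=> b0; rewrite /ratD; set x : rat := a%:~R / b%:~R.
have d0 : denq x != 0 by rewrite denq_eq0.
have h : numq x * b = a * denq x.
  have := divq_num_den x; rewrite {3}/x => /eqP.
  by rewrite eqr_div ?intr_eq0 // -!intrM eqr_int => /eqP.
apply/eqP; rewrite eqr_div ?intr_eq0_char0 //.
by rewrite -!rmorphM /= h.
Qed.

Lemma ratDD x y : ratD (x + y) = ratD x + ratD y.
Proof.
rewrite -{1}(divq_num_den x) -{1}(divq_num_den y) addf_div ?intr_eq0 ?denq_eq0 //.
rewrite -!rmorphM -rmorphD ratD_frac ?mulf_neq0 ?denq_eq0 //.
by rewrite rmorphD !rmorphM /= /ratD addf_div ?intr_eq0_char0 ?denq_eq0.
Qed.
Lemma ratDM x y : ratD (x * y) = ratD x * ratD y.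
Proof.
rewrite -{1}(divq_num_den x) -{1}(divq_num_den y) mulf_div -!rmorphM ratD_frac ?mulf_neq0 ?denq_eq0 //.
by rewrite !rmorphM /= /ratD mulf_div.
Qed.
Lemma ratD0 : ratD 0 = 0. Proof. by rewrite /ratD mul0r. Qed.
Lemma ratD1 : ratD 1 = 1. Proof. by rewrite /ratD divr1. Qed.
Lemma ratDN x : ratD (- x) = - ratD x.
Proof. by apply/eqP; rewrite -addr_eq0 -ratDD addNr ratD0. Qed.
Lemma ratD_nat k : ratD k%:R = k%:R.
Proof. by elim: k => [|k IH]; rewrite ?ratD0 // -!natr1 ratDD IH ratD1. Qed.
End RatEmb.

(** * Replicas of an element of the Lie algebra *)

Section Replica.
Variables (D : closedFieldType) (n : nat).
Hypothesis D0 : natr_inj0 D.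
Local Notation N := (n.+1 * n.+1 + 1)%N.
Local Notation P := {mpoly D[N]}.
Local Notation cst := (map_mx (@mpolyC N D)).
Local Notation U := (generic_mx n D).
Local Notation dl := (inv_det n D).
Implicit Types (X Y g : 'M[D]_n.+1) (p q : P).

Record primary_family X (r : seq D) (e : D -> 'M[D]_n.+1) : Prop := PrimaryFamily {
  pf_uniq : uniq r;
  pf_comm : forall lam Y, Y * X = X * Y -> Y * e lam = e lam * Y;
  pf_nilp : forall lam, (X - lam%:M) ^+ n.+1 * e lam = 0;
  pf_idem : forall lam, e lam * e lam = e lam;
  pf_orth : forall lam mu, lam != mu -> e lam * e mu = 0;
  pf_neq0 : forall lam, lam \in r -> e lam != 0;
  pf_sum : \sum_(lam <- r) e lam = 1 }.

(** Let S be the sum of the projections.  Each 1 - e lam is a multiple of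
(X - lam)^(n+1) and fixes 1 - S, so 1 - S is a multiple of the product of these
powers over the eigenvalues, which is 0 by Cayley-Hamilton. *)
Lemma primary_decomp X : exists r e, primary_family X r e.
Proof.
have [E hE] := functional_choice _ (primary_proj X).
pose e lam := horner_mx X (E lam).
have eN lam : (X - lam%:M) ^+ n.+1 * e lam = 0 by have [] := hE lam.
have eI lam : e lam * e lam = e lam by have [] := hE lam.
have eC lam Y : Y * X = X * Y -> Y * e lam = e lam * Y by apply: comm_poly_mx.
have eO lam mu : lam != mu -> e lam * e mu = 0.
  move=> lm; apply: (coprime_kill lm (k := n.+1) (l := n.+1) (X := X)).
    by rewrite mulmxE mulrA eN mul0r.
  have c : GRing.comm (e lam) ((X - mu%:M) ^+ n.+1).
    apply: commrX; apply/esym/eC; rewrite mulrBl mulrBr; congr (_ - _).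
    by rewrite -mulmxE scalar_mxC.
  by rewrite mulmxE mulrA -c -mulrA eN mulr0.
have [rs rsE] := closed_field_poly_normal (char_poly X).
pose r := undup rs.
have S1 : \sum_(lam <- r) e lam = 1.
  apply/esym/eqP; rewrite -subr_eq0; apply/eqP.
  set R := 1 - _.
  have eR lam : lam \in r -> (1 - e lam) * R = R.
    move=> lr; rewrite mulrBl mul1r -[RHS]subr0; congr (_ - _).
    rewrite /R mulrBr mulr1 mulr_sumr (bigD1_seq lam) ?undup_uniq //= eI.
    rewrite big1 ?addr0 ?subrr // => mu ml; apply: eO; by rewrite eq_sym.
  have hX c : horner_mx X ('X - c%:P) = X - c%:M by rewrite rmorphB /= horner_mx_X horner_mx_C.
  have [w hw] : exists w, R = horner_mx X (w * (\prod_(lam <- r) ('X - lam%:P)) ^+ n.+1) * R.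
    have : {subset r <= r} by [].
    elim: {1 3}r => [|lam s IH] sub.
      by exists 1; rewrite big_nil expr1n mulr1 rmorph1 mul1r.
    have [|w hw] := IH; first by move=> x xs; apply: sub; rewrite inE xs orbT.
    have [_ _ [v hv] _] := hE lam.
    exists (v * w); rewrite big_cons exprMn.
    have -> : v * w * (('X - lam%:P) ^+ n.+1 * (\prod_(j <- s) ('X - j%:P)) ^+ n.+1) =
      (v * ('X - lam%:P) ^+ n.+1) * (w * (\prod_(j <- s) ('X - j%:P)) ^+ n.+1) by ring.
    rewrite rmorphM /= -mulrA -hw rmorphM /= rmorphXn /= hX -hv -/(e lam) eR //.
    by apply: sub; rewrite inE eqxx.
  have /dvdpP [u hu] : char_poly X %| (\prod_(lam <- r) ('X - lam%:P)) ^+ n.+1.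
    have c1 : lead_coef (char_poly X) = 1 by apply/eqP; apply: char_poly_monic.
    rewrite rsE c1 scale1r.
    have <- : size rs = n.+1.
      have := size_char_poly X; rewrite {1}rsE c1 scale1r size_prod_XsubC => [[]] //.
    have : {subset rs <= r} by move=> x; rewrite mem_undup.
    elim: {1 2 3}rs => [|a s IH] sub; first by rewrite big_nil dvd1p.
    rewrite big_cons /= exprS; apply: dvdp_mul; last by apply: IH => x xs; apply: sub; rewrite inE xs orbT.
    by rewrite (bigD1_seq a) ?undup_uniq ?sub ?inE ?eqxx //= dvdp_mulr.
  by rewrite hw hu mulrA rmorphM /= Cayley_Hamilton mulr0 mul0r.
exists [seq lam <- r | e lam != 0], e; split => //.
- by rewrite filter_uniq ?undup_uniq.
- by move=> lam; rewrite mem_filter => /andP [].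
- rewrite big_filter -S1 [RHS](bigID (fun lam => e lam != 0)) /= [X in _ = _ + X]big1 ?addr0 //.
  by move=> lam /negbNE /eqP.
Qed.

Lemma trace_primary X r e lam : primary_family X r e -> \tr (X * e lam) = lam * (\rank (e lam))%:R.
Proof.
move=> pf; rewrite -mxtrace_idem ?mulmxE ?(pf_idem pf) // -[X](subrK lam%:M) mulrDl mxtraceD.
have c : X * e lam = e lam * X by apply: (pf_comm pf).
rewrite (_ : \tr ((X - lam%:M) * e lam) = 0) ?add0r.
  by rewrite -mulmxE mul_scalar_mx mxtraceZ.
apply: (@mxtrace_nilp _ _ _ n.+1); rewrite exprMn_comm; last first.
  by rewrite /GRing.comm mulrBl mulrBr c -mulmxE scalar_mxC.
by rewrite [e lam ^+ _]exprS mulrA (pf_nilp pf) mul0r.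
Qed.

Lemma lder_linear X : linear (lder X : P -> P).
Proof.
move=> a p q; rewrite /lder scaler_sumr -big_split; apply: eq_bigr => i _ /=.
by rewrite mderivD mderivZ mulrDl scalerAl.
Qed.
Lemma lderM X p q : lder X (p * q) = lder X p * q + p * lder X q.
Proof.
rewrite /lder mulr_suml mulr_sumr -big_split; apply: eq_bigr => i _ /=.
by rewrite mderivM; ring.
Qed.
Lemma lderC X c : lder X c%:MP = 0 :> P.
Proof. by rewrite /lder big1 // => i _; rewrite mderivC mul0r. Qed.
Lemma lder_var X i : lder X 'X_i = coords (U *m cst X) (dl * (- \tr X)%:MP) i.
Proof.
rewrite /lder (bigD1 i) //= mderivX mnmE eqxx scale1r.
rewrite (_ : (U_(i) - U_(i))%MM = 0%MM); last by apply/mnmP => j; rewrite !mnmE subnn.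
rewrite mpolyX0 mul1r big1 ?addr0 // => j ji.
by rewrite mderivX mnmE eq_sym (negPf ji) scale0r mul0r.
Qed.
Lemma lder_dl X : lder X dl = (- \tr X) *: dl.
Proof. by rewrite lder_var coordsEr mulrC mul_mpolyC. Qed.
Lemma lder_U X (A : 'M[D]_n.+1) i j : lder X ((U *m cst A) i j) = (U *m cst (X *m A)) i j.
Proof.
have sumE I (r : seq I) (F : I -> P) : lder X (\sum_(k <- r) F k) = \sum_(k <- r) lder X (F k).
  elim: r => [|k r IH]; first by rewrite !big_nil -mpolyC0 lderC.
  by rewrite !big_cons -[F k]scale1r lder_linear !scale1r IH.
rewrite map_mxM mulmxA mxE sumE [RHS]mxE; apply: eq_bigr => k _.
by rewrite lderM [cst A k j]mxE lderC mulr0 addr0 [U i k]mxE lder_var coordsEl.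
Qed.
Lemma lder_at1 X p : (lder X p).@[GL_coord 1] = dLie p X.
Proof.
rewrite /lder /dLie raddf_sum /=; apply: eq_bigr => i _; rewrite mevalM; congr (_ * _).
rewrite [LHS](coords_map (meval (GL_coord 1))) GL_tangentE map_mxM meval_cst GL_coordE meval_U mul1mx.
by apply: coords_eqfun => //; rewrite mevalM meval_dl mevalC det1 invr1 mul1r.
Qed.

(** The Leibniz rule for the derivation [lder X] shifted by its eigenvalues. *)
Lemma gen_eigenM X mu nu p q : gen_eigen (lder X) mu p -> gen_eigen (lder X) nu q -> gen_eigen (lder X) (mu + nu) (p * q).
Proof.
have hornerMf a b u v : shift (lder X) (a + b) (u * v) = shift (lder X) a u * v + u * shift (lder X) b v.
  by rewrite /shift lderM scalerDl mulrBl mulrBr -scalerAl -scalerAr opprD addrACA.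
have iD k u v : iter k (shift (lder X) (mu + nu)) (u + v) =
   iter k (shift (lder X) (mu + nu)) u + iter k (shift (lder X) (mu + nu)) v.
  by have := iter_lin (lder_linear X) (mu + nu) k 1 u v; rewrite !scale1r.
case=> k + [l]; move: {2}(k + l)%N (leqnn (k + l)) => c.
elim: c k l p q => [|c IH] k l p q.
  by rewrite leqn0 addn_eq0 => /andP [/eqP -> /eqP ->] /= -> _; exists 0%N; rewrite mul0r.
case: k => [|k]; first by move=> _ /= -> _; exists 0%N; rewrite mul0r.
case: l => [|l]; first by move=> _ _ /= ->; exists 0%N; rewrite mulr0.
rewrite iterSr => le h1; rewrite iterSr => h2.
have [a ha] : gen_eigen (lder X) (mu + nu) (shift (lder X) mu p * q).
  by apply: (IH k l.+1) => //; rewrite iterSr.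
have [b hb] : gen_eigen (lder X) (mu + nu) (p * shift (lder X) nu q).
  by apply: (IH k.+1 l) => //; [move: le; rewrite addnS ltnS | rewrite iterSr].
exists (a + b)%N.+1; rewrite iterSr hornerMf iD {1}(addnC a b) !iterD ha hb.
by rewrite !(iter0 (lder_linear X)) addr0.
Qed.

Section ReplicaOf.
Variables (X : 'M[D]_n.+1) (r : seq D) (e : D -> 'M[D]_n.+1) (c : D -> D).
Hypothesis pf : primary_family X r e.
Variable Rel : D -> D -> Prop.
Hypotheses (Rel0 : Rel 0 0) (RelN : forall a b, Rel a b -> Rel (- a) (- b)).
Hypothesis RelD : forall a b a' b', Rel a b -> Rel a' b' -> Rel (a + a') (b + b').
Hypothesis Relc : forall lam, lam \in r -> Rel lam (c lam).
Hypothesis Relf : forall a b b', Rel a b -> Rel a b' -> b = b'.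

(** The relation Rel is an additive function, given by its graph and defined at
least on the additive group generated by the eigenvalues of X, and c is its
restriction to the eigenvalues: so c respects their integral linear relations. *)
Definition replica := \sum_(lam <- r) c lam *: e lam.

Lemma replica_e lam : lam \in r -> replica * e lam = c lam *: e lam.
Proof.
move=> lr; rewrite /replica mulr_suml (bigD1_seq lam) ?(pf_uniq pf) //= -scalerAl (pf_idem pf).
by rewrite big1 ?addr0 // => mu ml; rewrite -scalerAl (pf_orth pf) ?scaler0.
Qed.

Lemma Rel_nat k a b : Rel a b -> Rel (a * k%:R) (b * k%:R).
Proof.
move=> h; elim: k => [|k IH]; first by rewrite !mulr0.
by rewrite -natr1 !mulrDr !mulr1; apply: RelD.
Qed.

Lemma Rel_tr : Rel (\tr X) (\tr replica).
Proof.
have tE Z : \tr Z = \sum_(lam <- r) \tr (Z * e lam).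
  by rewrite -raddf_sum /= -mulr_sumr (pf_sum pf) mulr1.
rewrite (tE X) (tE replica) big_seq [X in Rel _ X]big_seq.
elim/big_rec2: _ => // lam y1 y2 lr; apply: RelD.
rewrite (trace_primary _ pf) replica_e // mxtraceZ mxtrace_idem ?mulmxE ?(pf_idem pf) //.
by apply: Rel_nat; apply: Relc.
Qed.

(** Sums of vectors that are generalized eigenvectors for the derivation of X and
eigenvectors for that of the replica, with eigenvalues related by Rel. *)
Definition replica_sum p := exists s : seq (D * D * P), [/\ p = \sum_(x <- s) x.2,
  forall x, x \in s -> Rel x.1.1 x.1.2,
  forall x, x \in s -> gen_eigen (lder X) x.1.1 x.2 &
  forall x, x \in s -> lder replica x.2 = x.1.2 *: x.2].

Lemma replica_sum1 p a b : Rel a b -> gen_eigen (lder X) a p -> lder replica p = b *: p -> replica_sum p.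
Proof.
move=> h1 h2 h3; exists [:: (a, b, p)]; split; first by rewrite big_seq1.
all: by move=> x; rewrite inE => /eqP ->.
Qed.

Lemma replica_sumD p q : replica_sum p -> replica_sum q -> replica_sum (p + q).
Proof.
move=> [s [-> s1 s2 s3]] [t [-> t1 t2 t3]]; exists (s ++ t); split; first by rewrite big_cat.
all: by move=> x; rewrite mem_cat => /orP []; auto.
Qed.

Lemma replica_sumM p q : replica_sum p -> replica_sum q -> replica_sum (p * q).
Proof.
move=> [s [-> s1 s2 s3]] [t [-> t1 t2 t3]].
exists [seq (x.1.1 + y.1.1, x.1.2 + y.1.2, x.2 * y.2) | x <- s, y <- t]; split.
- rewrite mulr_suml big_allpairs_dep /=; apply: eq_bigr => x _; exact: mulr_sumr.
- by move=> x /allpairsP [[u v] /= [us vt ->]] /=; apply: RelD; auto.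
- by move=> x /allpairsP [[u v] /= [us vt ->]] /=; apply: gen_eigenM; auto.
- move=> x /allpairsP [[u v] /= [us vt ->]] /=.
  by rewrite lderM s3 // t3 // scalerDl -scalerAl -scalerAr.
Qed.

(** The coordinate functions are of this kind because the replica acts by scalars
on the primary components of X; eigenvalues of derivations add up in products,
and Rel is additive. *)
Lemma replica_sum_all p : replica_sum p.
Proof.
elim/mpoly_ring_ind: p => [a|i|p q|p q]; [ | | exact: replica_sumD | exact: replica_sumM].
  apply: (replica_sum1 Rel0); last by rewrite lderC scale0r.
  by exists 1%N; rewrite /= /shift lderC scale0r subr0.
elim/coord_ind: i => [i j|]; last first.
  apply: (replica_sum1 (RelN Rel_tr)); last exact: lder_dl.
  by exists 1%N; rewrite /= /shift lder_dl subrr.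
have -> : 'X_(lshift 1 (mxvec_index i j)) = \sum_(lam <- r) (U *m cst (e lam)) i j.
  rewrite -summxE -mulmx_sumr -raddf_sum (pf_sum pf) /= map_mx1 mulmx1 mxE //.
rewrite big_seq; elim/big_ind: _ => [|p q|lam lr]; [|exact: replica_sumD|].
  exists [::]; split => //; by rewrite big_nil.
apply: (replica_sum1 (Relc lr)); last first.
  rewrite lder_U (replica_e lr : replica *m e lam = _) map_mxZ /= -scalemxAr mxE mul_mpolyC //.
exists n.+1.
have -> k : iter k (shift (lder X) lam) ((U *m cst (e lam)) i j) = (U *m cst ((X - lam%:M) ^+ k *m e lam)) i j.
  elim: k => [|k IH]; first by rewrite expr0 mul1mx.
  rewrite iterS IH /shift lder_U exprS -mulmxE -mulmxA mulmxBl map_mxB mulmxBr mul_scalar_mx.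
  by rewrite map_mxZ /= -scalemxAr !mxE mul_mpolyC.
by rewrite (pf_nilp pf lam : _ *m e lam = 0) map_mx0 mulmx0 mxE.
Qed.

(** The derivation of the replica acts on each primary component of that of X by a
scalar, so it preserves the ideal of G as the derivation of X does. *)
Lemma replica_in_Lie G : algebraic_group G -> Lie G X -> Lie G replica.
Proof.
move=> GG LX p vp; rewrite -/(dLie p _) -lder_at1.
suff : vanish G (lder replica p) by apply; apply: alg1.
have [s [pE s1 s2 s3]] := replica_sum_all p.
have -> : lder replica p = \sum_(x <- s) x.1.2 *: x.2.
  rewrite pE (_ : lder replica _ = \sum_(x <- s) lder replica x.2).
    by rewrite big_seq [RHS]big_seq; apply: eq_bigr => x xs; apply: s3.
  elim: (s) => [|a t IH]; first by rewrite !big_nil -mpolyC0 lderC.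
  by rewrite !big_cons -IH -[a.2]scale1r lder_linear !scale1r.
apply: (@stable_replica _ _ (lder X) (vanish G)).
- exact: lder_linear.
- by move=> g _; rewrite meval0.
- by move=> a u v hu hv g Gg; rewrite mevalD mevalZ hu // hv // mulr0 addr0.
- by move=> v; apply: vanish_lder.
- by move=> x y xs ys exy; apply: (Relf (s1 x xs)); rewrite exy; apply: s1.
- exact: s2.
- by rewrite -pE.
Qed.
End ReplicaOf.

(** A nonzero eigenvalue mu would be separated from 0 by a Q-linear form f on the
span of the eigenvalues.  The replica Y of X given by f is in [Lie G], and f
applied to tr (X Y) is the sum of the m_a (f a)^2, a positive rational number. *)
Lemma radical_nilp G X : algebraic_group G -> Lie G X ->
  (forall Y, Lie G Y -> \tr (X *m Y) = 0) -> nilp X.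
Proof.
move=> GG LX tX; have [r [e pf]] := primary_decomp X.
suff z mu : mu \in r -> mu = 0.
  rewrite /nilp -[_ ^+ _]mulr1 -(pf_sum pf) mulr_sumr big_seq big1 // => lam lr.
  by have := pf_nilp pf lam; rewrite (z lam lr) raddf0 subr0.
pose m := size r.
pose lam (i : 'I_m) := r`_i.
have lr i : lam i \in r by apply: mem_nth.
(* A vector a of rationals stands for the combination ev a of the eigenvalues.
   The kernel L of ev consists of their rational relations, so the forms that
   vanish on L are the Q-linear forms on the span of the eigenvalues. *)
pose ev (a : 'rV[rat]_m) := \sum_i ratD D (a 0 i) * lam i.
have evl k a b : ev (k *: a + b) = ratD D k * ev a + ev b.
  rewrite /ev mulr_sumr -big_split; apply: eq_bigr => i _ /=.
  by rewrite !mxE ratDD // ratDM // mulrDl mulrA.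
have ev0 : ev 0 = 0 by rewrite /ev big1 // => i _; rewrite mxE ratD0 mul0r.
have [|a u v hu hv|L LP] := @subspace_vspace _ _ (fun a => ev a = 0) => //.
  by rewrite evl hu hv mulr0 addr0.
have evd i : ev (delta_mx 0 i) = lam i.
  rewrite /ev (bigD1 i) //= mxE !eqxx ratD1 mul1r big1 ?addr0 // => j ji.
  by rewrite mxE eqxx (negPf ji) ratD0 mul0r.
move=> mur; apply/eqP/negPn/negP => mu0.
have imu : (index mu r < m)%N by rewrite index_mem.
pose i0 := Ordinal imu.
have l0 : lam i0 = mu by rewrite /lam nth_index.
have [|f [fl fL fi0]] := @separating_form _ _ L (delta_mx 0 i0).
  by apply/negP => /LP; rewrite evd l0 => h; rewrite h eqxx in mu0.
have f0 : f 0 = 0 by apply: fL; apply/LP.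
have fE a : f a = \sum_i a 0 i * f (delta_mx 0 i).
  have fS (s : seq 'I_m) F : f (\sum_(i <- s) F i) = \sum_(i <- s) f (F i).
    by elim: s => [|i s IH]; rewrite ?big_nil // !big_cons -[F i]scale1r fl mul1r IH scale1r.
  rewrite {1}[a]row_sum_delta fS; apply: eq_bigr => i _.
  by rewrite -[_ *: _]addr0 fl f0 addr0.
pose c (x : D) := ratD D (f (delta_mx 0 (insubd i0 (index x r)))).
have cE i : c (lam i) = ratD D (f (delta_mx 0 i)).
  rewrite /c (_ : insubd _ _ = i) //; apply: val_inj; rewrite val_insubd /lam index_uniq ?(pf_uniq pf) //.
  by rewrite -/m ltn_ord.
pose Rel a b := exists v, a = ev v /\ b = ratD D (f v).
have LY : Lie G (replica r e c).
  apply: (@replica_in_Lie X r e c pf Rel) => //.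
  - by exists 0; rewrite ev0 f0 ratD0.
  - move=> _ _ [v [-> ->]]; exists ((-1) *: v + 0); rewrite evl fl ev0 f0 !addr0.
    by rewrite mulN1r !ratDN // ratD1 mulN1r.
  - move=> _ _ _ _ [v [-> ->]] [w [-> ->]]; exists (1 *: v + w).
    by rewrite evl fl ratD1 !mul1r ratDD.
  - move=> x xr; have ix : (index x r < m)%N by rewrite index_mem.
    have -> : x = lam (Ordinal ix) by rewrite /lam nth_index.
    by exists (delta_mx 0 (Ordinal ix)); rewrite evd cE.
  - move=> _ _ _ [v [-> ->]] [w [evw ->]]; congr (ratD D _).
    have := fL ((-1) *: w + v); rewrite fl mulN1r => h; apply/eqP; rewrite eq_sym -subr_eq0 -oppr_eq0 opprB addrC h //.
    by apply/LP; rewrite evl ratDN // ratD1 mulN1r evw addNr.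
have := tX _ LY.
pose b : 'rV[rat]_m := \row_i (f (delta_mx 0 i) * (\rank (e (lam i)))%:R).
have -> : \tr (X *m replica r e c) = ev b.
  rewrite /replica mulmx_sumr raddf_sum (big_nth 0) big_mkord /ev; apply: eq_bigr => i _.
  rewrite -/(lam i) -scalemxAr /= mxtraceZ cE mulmxE (trace_primary _ pf) mxE ratDM // ratD_nat //.
  by rewrite mulrA mulrAC.
move/LP/fL; rewrite fE => /eqP; rewrite psumr_eq0; last first.
  by move=> i _; rewrite mxE mulrAC mulr_ge0 ?ler0n // -expr2 sqr_ge0.
move/allP/(_ i0 (mem_index_enum _)) => /=.
rewrite mxE !mulf_eq0 (negPf fi0) /= orbF pnatr_eq0 mxrank_eq0.
by apply/negP/(pf_neq0 pf).
Qed.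
End Replica.

(** * Engel's theorem *)

Section Engel.
Variables (D : fieldType) (n : nat).
Local Notation gl := ('M[D]_n.+1).
Local Notation VS := {vspace 'M[D]_n.+1}.

Lemma last_outside (U : VS) (s : nat -> gl) N : s 0%N \notin U -> s N \in U ->
  exists2 m, s m \notin U & s m.+1 \in U.
Proof.
elim: N => [|N IH] s0 sN; first by rewrite sN in s0.
by case: (boolP (s N \in U)) => [/(IH s0)//|sN0]; exists N.
Qed.

Definition stable (K U : VS) := forall k u, k \in K -> u \in U -> ad k u \in U.

Lemma adDl (X Y Z : gl) a : ad (a *: X + Y) Z = a *: ad X Z + ad Y Z.
Proof. by rewrite adC ad_linear opprD -scalerN -!adC. Qed.

(** The conclusion of Engel's theorem for K acting on the quotients U / U', given as
pairs of subspaces: the action of K on L / K by ad is the case that makes the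
induction work. *)
Definition engel_prop (K : VS) := forall U' U : VS, (U' <= U)%VS -> (exists2 v, v \in U & v \notin U') ->
  stable K U' -> stable K U -> exists v, [/\ v \in U, v \notin U' & forall k, k \in K -> ad k v \in U'].

(** The vectors of U that K sends into U' are stable under z, because z normalizes
K, and ad z is nilpotent on them. *)
Lemma engel_ext (K : VS) z : engel_prop K -> nilp z -> (forall k, k \in K -> ad k z \in K) ->
  engel_prop (K + <[z]>)%VS.
Proof.
move=> PK nz nK U' U UU [v0 v0U v0U'] sU' sU.
have Kz : z \in (K + <[z]>)%VS by apply: (subvP (addvSr _ _)); apply: memv_line.
have Kk k : k \in K -> k \in (K + <[z]>)%VS by apply: (subvP (addvSl _ _)).
pose PW v := v \in U /\ forall k, k \in K -> ad k v \in U'.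
have [v [vU vU' hv]] : exists v, [/\ v \in U, v \notin U' & forall k, k \in K -> ad k v \in U'].
  by apply: PK => //; [exists v0 | move=> k u kK; apply: sU'; apply: Kk | move=> k u kK; apply: sU; apply: Kk].
have W j : PW (iter j (ad z) v).
  elim: j => [//|j [h1 h2]]; split; first by apply: sU.
  move=> k kK; rewrite iterS jacobi; apply: memvD; first by apply: h2; apply: nK.
  by apply: sU' => //; apply: h2.
have [m mU mU'] : exists2 m, iter m (ad z) v \notin U' & iter m.+1 (ad z) v \in U'.
  apply: (@last_outside U' (fun j => iter j (ad z) v) (n.+1 + n.+1)) => //.
  by rewrite (ad_nilp nz) mem0v.
have [h1 h2] := W m.
exists (iter m (ad z) v); split => // k /memv_addP [a aK [b /vlineP [c ->] ->]].
by rewrite addrC adDl; apply: memvD; [apply: memvZ | apply: h2].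
Qed.

(** For K properly contained in L, the property of K applied to the action on L / K
gives an element z normalizing K, and [engel_ext] enlarges K by z until K = L. *)
Lemma engel (L : VS) : (forall X, X \in L -> nilp X) -> stable L L -> L != 0%VS ->
  exists v, [/\ v \in L, v != 0 & forall X, X \in L -> ad X v = 0].
Proof.
move=> nL sL L0.
suff H : forall d (K : VS), (\dim L - \dim K <= d)%N -> (K <= L)%VS -> stable K K -> engel_prop K -> engel_prop L.
  have PL : engel_prop L.
    apply: (H _ 0%VS (leqnn _)); first exact: sub0v.
      by move=> k u /[!memv0] /eqP -> /eqP ->; rewrite /ad mulr0 subr0.
    move=> U' U UU [v vU vU'] _ _; exists v; split => // k; rewrite memv0 => /eqP ->.
    by rewrite /ad mul0r mulr0 subr0 mem0v.
  have [|||v [vL v0 hv]] := PL 0%VS L (sub0v _).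
  - by exists (vpick L); rewrite ?memv_pick // memv0 vpick0.
  - by move=> k u _; rewrite !memv0 => /eqP ->; rewrite /ad mulr0 mul0r subr0.
  - exact: sL.
  exists v; split => //; first by rewrite memv0 in v0.
  by move=> X /hv; rewrite memv0 => /eqP.
elim=> [|d IH] K dK KL sK PK.
  suff -> : L = K by [].
  by apply/esym/eqP; rewrite eqEdim KL -subn_eq0 -leqn0.
case: (eqVneq K L) => [<-//|nKL].
have [z [zL zK hz]] : exists z, [/\ z \in L, z \notin K & forall k, k \in K -> ad k z \in K].
  apply: PK => //; last by move=> k u kK uL; apply: sL => //; apply: (subvP KL).
  have /subvPn [v vL vK] : ~~ (L <= K)%VS by apply: contra nKL => h; rewrite eqEsubv KL h.
  by exists v.
have lt : (\dim K < \dim (K + <[z]>))%N.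
  rewrite ltn_neqAle dimvS ?addvSl // andbT; apply: contra zK => /eqP e.
  have -> : K = (K + <[z]>)%VS by apply/eqP; rewrite eqEdim addvSl /= e.
  by apply: (subvP (addvSr _ _)); apply: memv_line.
have K'L : (K + <[z]> <= L)%VS.
  apply/subvP => x /memv_addP [a aK [_ /vlineP [c ->] ->]].
  by apply: memvD; [apply: (subvP KL) | apply: memvZ].
apply: (IH (K + <[z]>)%VS).
- have le : (\dim (K + <[z]>) <= \dim L)%N.
    exact: dimvS.
  lia.
- exact: K'L.
- move=> k u /memv_addP [a aK [_ /vlineP [c ->] ->]] /memv_addP [b bK [_ /vlineP [c' ->] ->]].
  apply: (subvP (addvSl _ _)); rewrite addrC adDl [b + _]addrC !ad_linear.
  rewrite (_ : ad z z = 0) ?scaler0 ?add0r; last by rewrite /ad subrr.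
  apply: memvD.
    by apply: memvZ; rewrite adC rpredN; apply: hz.
  by apply: memvD; [apply: memvZ; apply: hz | apply: sK].
- by apply: engel_ext => //; apply: nL.
Qed.
End Engel.

(** * Nondegeneracy of the trace form *)

Section Nondegenerate.
Variables (D : closedFieldType) (n : nat).
Hypothesis D0 : natr_inj0 D.
Local Notation gl := ('M[D]_n.+1).
Local Notation VS := {vspace 'M[D]_n.+1}.
Local Notation N := (n.+1 * n.+1 + 1)%N.
Local Notation P := {mpoly D[N]}.
Local Notation cst := (map_mx (@mpolyC N D)).
Local Notation U := (generic_mx n D).
Implicit Types X Y g : gl.

Section ExpSpace.
Variable Z : VS.
Hypothesis nZ : forall X, X \in Z -> nilp X.
Hypothesis cZ : forall X Y, X \in Z -> Y \in Z -> X * Y = Y * X.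

Definition exp_space g := exists2 X, X \in Z & g = expm X.

Lemma exp_space_group : subgroup_GL exp_space.
Proof.
split.
- by move=> _ [X /nZ hX ->]; apply: expm_unit.
- by exists 0; rewrite ?mem0v ?expm0.
- move=> _ _ [X XZ ->] [Y YZ ->]; exists (X + Y); first exact: memvD.
  by rewrite expmD //; auto.
- by move=> _ [X XZ ->]; exists (- X); rewrite ?rpredN ?expm_inv //; apply: nZ.
Qed.

Definition log_gen : 'M[P]_n.+1 := horner_mx (U - 1) (map_poly (@mpolyC N D) (log_poly D n)).

Lemma log_genE g d : map_mx (meval (coords g d)) log_gen = log_mx g.
Proof.
rewrite /log_gen map_horner_mx -map_poly_comp map_poly_id => [|c _]; last by rewrite /= mevalC.
by rewrite rmorphB rmorph1 /= meval_U log_mxE.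
Qed.

(** The equations are (g - 1)^(n+1) = 0 and f (log g) = 0 for the linear forms f
that vanish on Z; on unipotent matrices the logarithm is a polynomial. *)
Lemma exp_space_closed : zariski_closed exp_space.
Proof.
exists (vanish exp_space) => g; split.
  by move=> gE; split; [have [h _ _ _] := exp_space_group; apply: h | move=> p; apply].
case=> ug h.
have hg : nilp (g - 1).
  apply/matrixP => i j; pose p := ((U - 1) ^+ n.+1) i j.
  have pE k : p.@[GL_coord k] = ((k - 1) ^+ n.+1) i j.
    have : map_mx (meval (GL_coord k)) ((U - 1) ^+ n.+1) = (k - 1) ^+ n.+1.
      by rewrite rmorphXn rmorphB rmorph1 /= GL_coordE meval_U.
    by move=> /(congr1 (fun A : gl => A i j)); rewrite mxE.
  rewrite -pE; rewrite h ?mxE // => k [X XZ ->].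
  by rewrite pE (_ : _ ^+ _ = 0) ?mxE //; apply: nilp_expm1; apply: nZ.
exists (log_mx g); last by rewrite expm_log.
apply/negPn/negP => lZ; have [f [fl fZ fg]] := separating_form lZ.
have := h (\tr (cst (dual_mx f) *m log_gen)).
have E k : (\tr (cst (dual_mx f) *m log_gen)).@[GL_coord k] = f (log_mx k).
  by rewrite -[LHS]/(meval (GL_coord k) _) -trace_map_mx map_mxM meval_cst GL_coordE log_genE -dual_mxE.
rewrite E => h'; case/negP: fg; apply/eqP; apply: h' => _ [X XZ ->].
by rewrite E log_expm ?fZ //; apply: nZ.
Qed.

(** On the curve t |-> exp (t X) two polynomials with product 0 cannot both be
nonzero, so the closed set that contains 1 contains exp X. *)
Lemma exp_space_connected : zariski_connected exp_space.
Proof.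
move=> A B cA cB cov dis.
wlog A1 : A B cA cB cov dis / A 1.
  have E1 : exp_space 1 by exists 0; rewrite ?mem0v ?expm0.
  move=> w; case: (cov 1 E1) => [A1|B1]; first exact: w.
  suff [] : subset_mx exp_space B \/ subset_mx exp_space A by [right | left].
  apply: w => // g gE; last by move=> [h1 h2]; apply: (dis g gE).
  by have [] := cov g gE; [right | left].
left=> _ [X XZ ->]; apply: NNPP => nA.
have hX := nZ XZ.
have XtZ t : exp_space (expm (t *: X)) by exists (t *: X); rewrite ?memvZ.
have nB1 : ~ B 1.
  by move=> B1; apply: (dis 1) => //; exists 0; rewrite ?mem0v ?expm0.
have [IA hA] := cA; have [IB hB] := cB.
have [p Ip pX] : exists2 p, IA p & p.@[GL_coord (expm X)] <> 0.
  apply: NNPP => h; apply: nA; apply/hA; split; first exact: expm_unit.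
  by move=> p Ip; apply: NNPP => h'; apply: h; exists p.
have [p' Ip' pX'] : exists2 p, IB p & p.@[GL_coord 1] <> 0.
  apply: NNPP => h; apply: nB1; apply/hB; split; first exact: unitmx1.
  by move=> q Iq; apply: NNPP => h'; apply: h; exists q.
have : mmap polyC (expc X) p * mmap polyC (expc X) p' = 0.
  apply: (poly_nat_roots D0) => k; rewrite hornerMf !expc_eval //.
  have [/hA [_ h]|/hB [_ h]] := cov _ (XtZ k%:R); first by rewrite h ?mul0r.
  by rewrite [X in _ * X]h ?mulr0.
move=> /eqP; rewrite mulf_eq0 => /orP [] /eqP /(congr1 (fun q : {poly D} => q.[_])) e.
  by have := e 1; rewrite expc_eval // scale1r horner0.
by have := e 0; rewrite expc_eval // scale0r expm0 horner0.
Qed.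

Lemma exp_space_comm : commutative_mx exp_space.
Proof.
move=> _ _ [X XZ ->] [Y YZ ->]; by rewrite mulmxE -(expmD D0 (cZ XZ YZ) (nZ XZ) (nZ YZ)) -(expmD D0 (cZ YZ XZ) (nZ YZ) (nZ XZ)) addrC.
Qed.
End ExpSpace.

Variable G : gl -> Prop.
Hypothesis ssG : semisimple_group G.

(** The radical of the form is an ideal of nilpotent matrices, stable under G.  If
it were nonzero so would be its centre Z, by Engel's theorem, and exp Z would be
a nontrivial closed connected normal abelian subgroup. *)
Lemma Lie_nondeg X0 : Lie G X0 -> (forall Y, Lie G Y -> \tr (X0 *m Y) = 0) -> X0 = 0.
Proof.
have [GG _ ss] := ssG.
pose PR X := Lie G X /\ forall Y, Lie G Y -> \tr (X *m Y) = 0.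
have [||R RP] := @subspace_vspace _ _ PR.
- by split; [exact: Lie0 | move=> Y _; rewrite mul0mx mxtrace0].
- move=> a u v [u1 u2] [v1 v2]; split; first exact: Lie_linear.
  by move=> Y LY; rewrite mulmxDl -scalemxAl mxtraceD mxtraceZ u2 // v2 // mulr0 addr0.
suff R0 : R = 0%VS.
  by move=> LX tX; apply/eqP; rewrite -memv0 -R0; apply/RP.
apply/eqP/negPn/negP => R0.
have nR Y : Y \in R -> nilp Y by move/RP => [h1 h2]; apply: (radical_nilp D0 GG).
have sR : stable R R.
  move=> u v /RP [u1 u2] /RP [v1 v2]; apply/RP; split; first exact: Lie_bracket.
  move=> Y LY.
  have -> : \tr (ad u v *m Y) = \tr (u *m (v *m Y - Y *m v)).
    rewrite /ad mulmxBl mulmxBr !raddfB /= -!mulmxE -!mulmxA; congr (_ - _).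
    by rewrite mxtrace_mulC -mulmxA.
  by apply: u2; apply: Lie_bracket.
have [v [vR v0 hv]] := engel nR sR R0.
pose PZ X := X \in R /\ forall Y, Y \in R -> ad Y X = 0.
have [||Z ZP] := @subspace_vspace _ _ PZ.
- by split; [exact: mem0v | move=> Y _; rewrite /ad mulr0 mul0r subr0].
- move=> a x y [x1 x2] [y1 y2]; split; first by apply: memvD => //; apply: memvZ.
  by move=> Y YR; rewrite ad_linear x2 // y2 // scaler0 addr0.
have nZ Y : Y \in Z -> nilp Y by move/ZP => [h _]; apply: nR.
have cZ x y : x \in Z -> y \in Z -> x * y = y * x.
  by move=> /ZP [xR _] /ZP [_ hy]; apply/subr0_eq; exact: (hy x xR).
case/negP: v0; apply/eqP; apply: expm_eq1; first exact: nR.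
apply: (ss (exp_space Z)); last by exists v => //; apply/ZP.
- by split; [apply: exp_space_group | apply: exp_space_closed].
- by move=> _ [X /[dup] /nZ hX /ZP [/RP [LX _] _] ->]; apply: exp_in_group.
- exact: exp_space_connected.
- move=> g h Gg [X /[dup] /nZ hX /ZP [/RP [LX tX] cX] ->].
  have ug := alg_unit GG Gg.
  exists (g *m X *m invmx g); last by rewrite expm_conj.
  have conjR k Y : G k -> Y \in R -> k *m Y *m invmx k \in R.
    move=> Gk /RP [LY tY]; apply/RP; split; first exact: Lie_conj.
    move=> W LW; rewrite -!mulmxA mxtrace_mulC -!mulmxA.
    apply: tY.
    have := Lie_conj GG (algV GG Gk) LW; rewrite invmxK -!mulmxA //.
  apply/ZP; split; first by apply: conjR => //; apply/RP.
  move=> Y YR; have YE : Y = g *m (invmx g *m Y *m g) *m invmx g.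
    by rewrite !mulmxA mulmxV // mul1mx -mulmxA mulmxV // mulmx1.
  have /cX : invmx g *m Y *m g \in R.
    by have := conjR _ _ (algV GG Gg) YR; rewrite invmxK.
  move: (invmx g *m Y *m g) YE => Y' -> /subr0_eq; rewrite -mulmxE => h'.
  rewrite /ad -!mulmxE !mulmxA -(mulmxA _ (invmx g) g) mulVmx // mulmx1 -(mulmxA g) h'.
  by rewrite -(mulmxA _ (invmx g) g) mulVmx // mulmx1 !mulmxA subrr.
- exact: exp_space_comm.
Qed.
End Nondegenerate.

(** * The theorem of Jacobson and Morozov *)

Section JM.
Variables (D : closedFieldType) (n : nat).
Hypothesis D0 : natr_inj0 D.
Local Notation gl := ('M[D]_n.+1).
Local Notation VS := {vspace 'M[D]_n.+1}.
Implicit Types (X Y x y z h w c : gl).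

Lemma nilp_criterion X :
  (forall e, (forall Y, Y * X = X * Y -> Y * e = e * Y) -> e * e = e -> \tr (X * e) = 0) -> nilp X.
Proof.
move=> hX; have [r [e pf]] := primary_decomp X.
rewrite /nilp -[_ ^+ _]mulr1 -(pf_sum pf) mulr_sumr big_seq big1 // => lam lr.
have := pf_nilp pf lam; suff -> : lam = 0 by rewrite raddf0 subr0.
have := hX (e lam) (fun Y => pf_comm pf lam (Y := Y)) (pf_idem pf lam).
rewrite (trace_primary _ pf) => /eqP; rewrite mulf_eq0 => /orP [/eqP //|].
by rewrite D0 mxrank_eq0 (negPf (pf_neq0 pf lr)).
Qed.

(** Jacobson's lemma.  As ad x is a derivation killing c = [x, z], the m-th power of
ad x sends z^m to m! c^m; and ad x is nilpotent. *)
Lemma ad_nilp_commutator x z : nilp x -> ad x (ad x z) = 0 -> nilp (ad x z).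
Proof.
move=> nx; set c := ad x z => cx.
have ad0 k : iter k (ad x) 0 = 0 by elim: k => //= k ->; rewrite /ad mulr0 mul0r subr0.
have H k w : iter k.+1 (ad x) (z * w) = z * iter k.+1 (ad x) w + k.+1%:R *: (c * iter k (ad x) w).
  elim: k => [|k IH]; first by rewrite /= ad_mul scale1r addrC.
  rewrite iterS IH addrC ad_linear !ad_mul cx mul0r add0r -/c -!iterS.
  by rewrite addrA -[X in _ + X + _]scale1r -scalerDl natr1 addrC.
have M m : iter m (ad x) (z ^+ m) = m`!%:R *: c ^+ m /\ iter m.+1 (ad x) (z ^+ m) = 0.
  elim: m => [|m [IH1 IH2]].
    by rewrite /= !expr0 fact0 scale1r /ad mulr1 mul1r subrr.
  rewrite exprS; split; rewrite H.
    rewrite IH2 mulr0 add0r IH1 -scalerAr scalerA -natrM -factS exprS //.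
  by rewrite IH2 iterS IH2 /ad !mulr0 mul0r subr0 mulr0 scaler0 addr0.
apply: (@nilp_bound _ _ _ (n.+1 + n.+1)).
have [] := M (n.+1 + n.+1)%N; rewrite (ad_nilp nx) => /esym/eqP.
by rewrite scaler_eq0 D0 eqn0Ngt fact_gt0 /= => /eqP.
Qed.

(** x z preserves the kernels of the powers of x and acts on their successive
quotients through multiples of the nilpotent matrix c = [x, z]; so it is
nilpotent. *)
Lemma trace_commutator x z : nilp x -> ad x (ad x z) = 0 -> \tr (x * z) = 0.
Proof.
move=> nx h; have nc := ad_nilp_commutator nx h; set c := ad x z in h nc *.
have xc : x * c = c * x by apply/subr0_eq.
have xz : x * z = z * x + c by rewrite /c /ad addrC subrK.
have xkz j : x ^+ j.+1 * z = z * x ^+ j.+1 + j.+1%:R *: (c * x ^+ j).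
  elim: j => [|j IH]; first by rewrite expr1 expr0 mulr1 scale1r.
  rewrite exprS -mulrA IH mulrDr mulrA xz mulrDl -mulrA -exprS -addrA; congr (_ + _).
  by rewrite -scalerAr mulrA xc -mulrA -exprS -[X in X + _]scale1r -scalerDl addrC natr1.
have step j (M : gl) k : x ^+ j.+1 * M = 0 ->
    x ^+ j.+1 * ((x * z) ^+ k * M) = 0 /\ x ^+ j * ((x * z) ^+ k * M) = (j.+1 ^ k)%:R *: (c ^+ k * (x ^+ j * M)).
  move=> xM; elim: k => [|k [IH1 IH2]].
    by rewrite !expr0 !mul1r scale1r.
  rewrite [(x * z) ^+ k.+1]exprS -!mulrA; move: IH1 IH2; set M' := _ ^+ k * M => IH1 IH2; split.
    rewrite mulrA -exprSr mulrA xkz mulrDl -mulrA exprS -mulrA IH1 !mulr0 add0r.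
    by rewrite -scalerAl -mulrA IH1 mulr0 scaler0.
  rewrite mulrA -exprSr mulrA xkz mulrDl -mulrA IH1 mulr0 add0r.
  by rewrite -scalerAl -mulrA IH2 -scalerAr scalerA -natrM -expnS mulrA -exprS.
apply: (@mxtrace_nilp _ _ _ (n.+1 * n.+1)).
have H j : (j <= n.+1)%N -> x ^+ (n.+1 - j) * (x * z) ^+ (n.+1 * j) = 0.
  elim: j => [|j IH] jn; first by rewrite subn0 nx mul0r.
  have := IH (ltnW jn); rewrite -(subnSK jn) => h1.
  have [_] := step _ _ n.+1 h1.
  by rewrite -exprD -mulnS nc mul0r scaler0.
by have := H n.+1 (leqnn _); rewrite subnn expr0 mul1r.
Qed.

(** The Gram matrix of the form in a basis of L is invertible. *)
Lemma trace_form_repr (L : VS) (f : gl -> D) :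
  (forall X, X \in L -> (forall Y, Y \in L -> \tr (X *m Y) = 0) -> X = 0) ->
  (forall a X Y, f (a *: X + Y) = a * f X + f Y) ->
  exists2 z, z \in L & forall y, y \in L -> \tr (z *m y) = f y.
Proof.
move=> nd fl; set d := \dim L; pose b := vbasis L.
have bL i : b`_i \in L.
  case: (ltnP i (size b)) => h; first by apply: (vbasis_mem (mem_nth _ h)).
  by rewrite nth_default ?mem0v.
pose B : 'M[D]_d := \matrix_(i, j) \tr (b`_i *m b`_j).
have fS I (r : seq I) F : f (\sum_(i <- r) F i) = \sum_(i <- r) f (F i).
  have f0 : f 0 = 0 by have := fl (-1) 0 0; rewrite scaler0 addr0 mulN1r addNr.
  by elim: r => [|i r IH]; rewrite ?big_nil // !big_cons -[F i]scale1r fl mul1r IH scale1r.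
have fZ a X : f (a *: X) = a * f X.
  by have := fl a X 0; rewrite addr0 => ->; have := fS _ [::] (fun _ : nat => X); rewrite !big_nil => ->; rewrite addr0.
have tE (v : 'rV[D]_d) (j : 'I_d) : \tr ((\sum_i v 0 i *: b`_i) *m b`_j) = (v *m B) 0 j.
  rewrite mulmx_suml raddf_sum mxE; apply: eq_bigr => i _.
  by rewrite mxE -scalemxAl /= mxtraceZ.
have LE y : y \in L -> y = \sum_i coord b i y *: b`_i by apply: coord_vbasis.
have uB : B \in unitmx.
  rewrite -row_free_unit; apply: inj_row_free => v vB.
  have z0 : \sum_i v 0 i *: b`_i = 0.
    apply: nd => [|Y YL]; first by apply: memv_suml => i _; apply: memvZ.
    rewrite (LE Y YL) mulmx_sumr raddf_sum big1 // => j _.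
    by rewrite -scalemxAr /= mxtraceZ tE vB mxE mulr0.
  apply/rowP => i; rewrite mxE; have /freeP := basis_free (vbasisP L).
  exact.
pose v := \row_j f b`_j *m invmx B.
exists (\sum_i v 0 i *: b`_i); first by apply: memv_suml => i _; apply: memvZ.
move=> y yL; rewrite (LE y yL) mulmx_sumr raddf_sum fS; apply: eq_bigr => j _.
by rewrite -scalemxAr /= mxtraceZ tE mulmxKV // mxE fZ.
Qed.

Definition triple x h y := [/\ ad h x = 2%:R *: x, ad h y = - (2%:R *: y) & ad x y = h].

Section Morozov.
Variables (L : VS) (x h w : gl).
Hypothesis sL : stable L L.
Hypotheses (xL : x \in L) (nx : nilp x) (xw : ad x w = h) (hx : ad h x = 2%:R *: x).

Let XW v : ad x (ad w v) - ad w (ad x v) = ad h v.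
Proof. by rewrite jacobi xw addrK. Qed.
Let HX v : ad h (ad x v) - ad x (ad h v) = 2%:R *: ad x v.
Proof. by rewrite jacobi hx addrK /ad -scalerAl -scalerAr -scalerBr. Qed.
Let N := (n.+1 + n.+1)%N.
Let xN v : iter N (ad x) v = 0. Proof. exact: ad_nilp. Qed.
Let w0 : ad w 0 = 0. Proof. by rewrite /ad mulr0 mul0r subr0. Qed.

(** In the kernel of ad x the weights of ad h are natural numbers. *)
Lemma lower_unique z : ad x z = 0 -> ad h z = - (2%:R *: z) -> z = 0.
Proof.
move=> xz hz; apply/eqP/negPn/negP => z0.
have hz' : ad h z = (- 2%:R) *: z by rewrite hz scaleNr.
have [m _ /eqP] := weight_nat D0 (ad_linear x) (ad_linear h) XW HX w0 xN xz hz' z0.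
by rewrite eq_sym -addr_eq0 -natrD D0 addn2.
Qed.

(** On the kernel of ad x a product of factors ad h - i vanishes by [weight_prod],
and ad h + 2 is i + 2, hence invertible, modulo ad h - i.  The induction inverts
it one factor at a time, from the last one. *)
Lemma shift_surj v : h \in L -> v \in L -> ad x v = 0 ->
  exists z, [/\ z \in L, ad x z = 0 & ad h z + 2%:R *: z = v].
Proof.
move=> hL vL xv; pose hp j := hprod (ad h) j v.
have hpL j : hp j \in L.
  by elim: j => //= j IH; apply: memvB; [apply: sL | apply: memvZ].
have hpx j : ad x (hp j) = 0.
  elim: j => [//|j IH]; rewrite /hp /= adB adZ -/(hp j) IH scaler0 subr0.
  have := HX (hp j); rewrite IH scaler0 /ad !(mulr0, mul0r, subr0) sub0r => /eqP.
  by rewrite oppr_eq0 => /eqP.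
have H k j : (j + k = N)%N -> exists z, [/\ z \in L, ad x z = 0 & ad h z + 2%:R *: z = hp j].
  elim: k j => [|k IH] j jk.
    exists 0; rewrite mem0v /ad !(mulr0, mul0r, subr0) scaler0 addr0; split => //.
    rewrite addn0 in jk; rewrite jk; apply/esym.
    exact: (weight_prod D0 (ad_linear x) (ad_linear h) XW HX w0 xN xv).
  have [|z [zL xz hz]] := IH j.+1; first by rewrite addSn -addnS.
  exists (j.+2%:R^-1 *: (hp j - z)); split.
  - by apply: memvZ; apply: memvB.
  - by rewrite adZ adB hpx xz subr0 scaler0.
  have e : ad h (hp j - z) + 2%:R *: (hp j - z) = j.+2%:R *: hp j.
    rewrite adB scalerBr addrACA -opprD hz -[hp j.+1]/(ad h (hp j) - j%:R *: hp j).
    by rewrite opprB addrC -addrA addKr -scalerDl -natrD addn2.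
  by rewrite adZ scalerA mulrC -scalerA -scalerDr e scalerA mulVf ?scale1r // D0.
exact: (H N 0%N).
Qed.

(** [shift_surj] gives the correction of w by an element of the kernel of ad x that
makes it an eigenvector of ad h for -2 without changing its commutator with x. *)
Lemma morozov : h \in L -> w \in L -> exists2 y, y \in L & triple x h y.
Proof.
move=> hL wL.
have [||z [zL xz hz]] := @shift_surj (ad h w + 2%:R *: w) hL.
- by apply: memvD; [apply: sL | apply: memvZ].
- rewrite adD adZ jacobi xw (adC x h) hx -scaleNr adZl scaleNr xw.
  by rewrite {1}/ad subrr addr0 addNr.
exists (w - z); first exact: memvB.
split => //; last by rewrite adB xw xz subr0.
by rewrite adB; apply/eqP; rewrite -addr_eq0 scalerBr addrACA -opprD hz subrr.
Qed.
End Morozov.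

(** It suffices that x be in (ad x)^2 L.  Otherwise a linear form that vanishes on
(ad x)^2 L and not at x is Y |-> tr (z Y) for some z in L; invariance of the
form gives (ad x)^2 z = 0, and then tr (z x) = 0 by [trace_commutator]. *)
Lemma neutral_element (L : VS) x : stable L L ->
  (forall X, X \in L -> (forall Y, Y \in L -> \tr (X *m Y) = 0) -> X = 0) ->
  x \in L -> nilp x -> exists2 w, w \in L & ad (ad x w) x = 2%:R *: x.
Proof.
move=> sL nd xL nx.
pose PW v := exists2 u, u \in L & v = ad x (ad x u).
have [||W WP] := @subspace_vspace _ _ PW.
- by exists 0; rewrite ?mem0v ?ad0.
- move=> a _ _ [u uL ->] [v vL ->]; exists (a *: u + v); first by rewrite memvD ?memvZ.
  by rewrite (adD x (a *: u) v) (adZ x a u) adD (adZ x a (ad x u)).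
have trA a b : \tr (a *m ad x b) = - \tr (ad x a *m b).
  apply/eqP; rewrite -addr_eq0 -mxtraceD addrC -[_ + _]/(ad x a * b + a * ad x b) -ad_mul.
  by rewrite /ad raddfB /= -!mulmxE mxtrace_mulC subrr.
have [/WP [u uL xE]|xW] := boolP (x \in W).
  exists ((- 2%:R) *: u); first exact: memvZ.
  by rewrite adC !adZ scaleNr opprK -xE.
have [f [fl fW fx]] := separating_form xW.
have [z zL zE] := trace_form_repr nd fl.
have h : ad x (ad x z) = 0.
  apply: nd => [|Y YL]; first exact: (sL _ _ xL (sL _ _ xL zL)).
  have xY := sL _ _ xL (sL _ _ xL YL).
  have := trA z (ad x Y); rewrite zE // trA opprK => <-.
  by apply: fW; apply/WP; exists Y.
case/negP: fx; rewrite -zE // mxtrace_mulC mulmxE; apply/eqP.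
exact: trace_commutator.
Qed.

(** If e commutes with y then tr ([h, y] e) = 0, while [h, y] = - 2 y. *)
Lemma triple_nilp x h y : triple x h y -> nilp y.
Proof.
move=> [_ hy _]; apply: nilp_criterion => e ce _; have ey := ce y erefl.
have : \tr (ad h y * e) = 0.
  rewrite /ad mulrBl raddfB /= -!mulmxE -[h *m y *m e]mulmxA (ey : y *m e = e *m y).
  by rewrite mulmxA mxtrace_mulC !mulmxA subrr.
rewrite hy -mulmxE mulNmx raddfN /= -scalemxAl mxtraceZ => /eqP.
by rewrite oppr_eq0 mulf_eq0 D0 /= => /eqP.
Qed.

End JM.

(** * Highest weight vectors *)

Section SemisimpleAction.
Variables (D : closedFieldType) (n : nat).
Hypothesis D0 : natr_inj0 D.
Local Notation gl := ('M[D]_n.+1).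
Variables x h y : gl.
Hypotheses (tr3 : triple x h y) (nx : nilp x) (ny : nilp y).
Implicit Types (v w u : 'cV[D]_n.+1).

Let hx : h * x = x * h + 2%:R *: x.
Proof. by have [e _ _] := tr3; rewrite -e /ad addrC subrK. Qed.
Let hy : h * y = y * h - 2%:R *: y.
Proof. by have [_ e _] := tr3; rewrite -e /ad addrC subrK. Qed.
Let xy : x * y = y * x + h.
Proof. by have [_ _ e] := tr3; rewrite -e /ad addrC subrK. Qed.

Definition highest_weight m v := x *m v = 0 /\ h *m v = m%:R *: v.

Let lin (A : gl) : linear (fun v => A *m v).
Proof. by move=> a u v; rewrite mulmxDr -scalemxAr. Qed.
Let XW v : x *m (y *m v) - y *m (x *m v) = h *m v.
Proof. by rewrite !mulmxA -mulmxBl !mulmxE xy addrC addKr. Qed.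
Let HX v : h *m (x *m v) - x *m (h *m v) = 2%:R *: (x *m v).
Proof. by rewrite !mulmxA -mulmxBl !mulmxE hx addrC addKr -scalemxAl. Qed.
Let iterM (A : gl) k v : iter k (fun v => A *m v) v = A ^+ k *m v.
Proof. by elim: k => [|k IH]; rewrite ?expr0 ?mul1mx // iterS IH exprS -mulmxE mulmxA. Qed.
Let xN v : iter n.+1 (fun v => x *m v) v = 0.
Proof. by rewrite iterM nx mul0mx. Qed.

Lemma hprod_poly k v : hprod (fun v => h *m v) k v = horner_mx h (\prod_(i < k) ('X - i%:R%:P)) *m v.
Proof.
elim: k => [|k IH] /=; first by rewrite big_ord0 rmorph1 mul1mx.
rewrite IH big_ord_recr [X in _ = horner_mx h X *m v]mulrC rmorphM /= rmorphB /= horner_mx_X horner_mx_C.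
by rewrite -mulmxE -mulmxA mulmxBl mul_scalar_mx.
Qed.

Let commV (A B : gl) v : A * B = B * A -> A *m (B *m v) = B *m (A *m v).
Proof. by move=> c; rewrite !mulmxA !mulmxE c. Qed.

(** [weight_prod] gives a polynomial in h with simple roots that kills v. *)
Lemma ker_semisimple mu a v : x *m v = 0 -> (h - mu%:M) ^+ a *m v = 0 -> h *m v = mu *: v.
Proof.
move=> xv hv; have := weight_prod D0 (lin x) (lin h) XW HX (mulmx0 _ y) xN xv.
rewrite hprod_poly => pv.
have hX c : horner_mx h ('X - c%:P) = h - c%:M by rewrite rmorphB /= horner_mx_X horner_mx_C.
have kill (p : {poly D}) w : ~~ root p mu -> horner_mx h p *m w = 0 -> (h - mu%:M) ^+ a *m w = 0 -> w = 0.
  move=> pm h1 h2.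
  have /Bezout_eq1_coprimepP [[s t] /= st] : coprimep p (('X - mu%:P) ^+ a).
    by apply: coprimep_expr; rewrite coprimep_XsubC.
  rewrite -[w]mul1mx -[1%:M](rmorph1 (horner_mx h)) -st rmorphD !rmorphM !rmorphXn /= hX.
  by rewrite mulmxDl -!mulmxE -!mulmxA h1 h2 !mulmx0 addr0.
case: (boolP (root (\prod_(i < n.+1) ('X - (i%:R : D)%:P)) mu)) => [|rp]; last first.
  by rewrite (kill _ v rp) // mulmx0 scaler0.
rewrite /root horner_prod prodf_seq_eq0 => /hasP [i _ /=].
rewrite hornerXsubC subr_eq0 => /eqP mi.
apply/subr0_eq; rewrite -mul_scalar_mx -mulmxBl.
apply: (kill (\prod_(j < n.+1 | j != i) ('X - (j%:R : D)%:P))).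
- rewrite /root horner_prod prodf_seq_eq0; apply/hasPn => j _ /=; rewrite hornerXsubC subr_eq0 mi.
  apply/negP => /andP [ji /eqP e]; case/negP: ji; apply/eqP/val_inj => /=.
  have : (i%:R : D) == j%:R by apply/eqP.
  by move/eqP/(natr_inj D0).
- rewrite mulmxA -hX mi mulmxE -rmorphM mulrC; move: pv; rewrite (bigD1 i) //= => <-.
- rewrite mulmxA mulmxE -exprSr exprS -mulmxE -mulmxA hv mulmx0 //.
Qed.

(** Suppose z <> 0 and choose a highest weight vector v = z w, of weight m.  The
Casimir element and h commute with z, so w may be taken in their generalized
eigenspaces for the eigenvalues of v.  If u = x^k w is nonzero and killed by x,
it is a highest weight vector of weight m + 2 k; comparing the values of the
Casimir element forces k = 0, so w = u is a highest weight vector and z w = 0. *)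
Lemma comm_kills_hw z : z * x = x * z -> z * y = y * z ->
  (forall m v, highest_weight m v -> z *m v = 0) -> z = 0.
Proof.
move=> zx zy kz; apply/eqP/negPn/negP => z0.
have zh : z * h = h * z.
  have [_ _ <-] := tr3; rewrite /ad mulrBr mulrBl.
  by rewrite mulrA zx -mulrA zy mulrA (mulrA z y x) zy -(mulrA y z x) zx !mulrA.
(* The Casimir element, in the form adapted to vectors killed by x. *)
pose Om := h * h + 2%:R *: h + 4%:R *: (y * x).
have hOm : h * Om = Om * h.
  rewrite /Om !mulrDr !mulrDl -!scalerAr -!scalerAl mulrA; congr (_ + _ + _ *: _).
  by rewrite mulrA hy mulrBl -!mulrA hx mulrDr -scalerAl -scalerAr addrK.
have xh : x * h = h * x - 2%:R *: x by rewrite hx addrK.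
have xOm : x * Om = Om * x.
  have e1 : x * (h * h) = h * h * x - 4%:R *: (h * x) + 4%:R *: x.
    rewrite mulrA xh mulrBl -(mulrA h x h) xh mulrBr -scalerAl xh -scalerAr mulrA scalerBr.
    by move: (h * h * x) (h * x) => a b; apply/matrixP => i j; rewrite !mxE; ring.
  rewrite /Om !mulrDr !mulrDl -!scalerAr -!scalerAl e1 xh mulrA xy mulrDl.
  move: (h * h * x) (h * x) (y * x * x) => a b c0.
  by apply/matrixP => i j; rewrite !mxE; ring.
have zOm : z * Om = Om * z.
  rewrite /Om !mulrDr !mulrDl -!scalerAr -!scalerAl; congr (_ + _ *: _ + _ *: _) => //.
    by rewrite mulrA zh -mulrA zh mulrA.
  by rewrite mulrA zy -mulrA zx mulrA.
have [w0 zw0] : exists w : 'cV[D]_n.+1, z *m w != 0.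
  case/matrix0Pn: z0 => i [j zij]; exists (delta_mx j 0); apply/matrix0Pn; exists i, 0.
  by rewrite -colE mxE.
have [||k1 v1n v1z] := @last_nonzero _ (fun k => x ^+ k *m (z *m w0)) n.+1.
- by rewrite expr0 mul1mx.
- by rewrite nx mul0mx.
have powC (A B : gl) k : A * B = B * A -> A * B ^+ k = B ^+ k * A.
  by move=> c; apply: (@commrX _ A B k c).
pose w1 := x ^+ k1 *m w0; pose v1 := z *m w1.
have v1E : v1 = x ^+ k1 *m (z *m w0) by rewrite /v1 /w1 !mulmxA !mulmxE powC.
rewrite -v1E in v1n.
have xv1 : x *m v1 = 0 by rewrite v1E mulmxA mulmxE -exprS.
have [m vn vz] := @last_nonzero _ (fun k => hprod (fun v => h *m v) k v1) n.+1 v1n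
  (weight_prod D0 (lin x) (lin h) XW HX (mulmx0 _ y) xN xv1).
set v := hprod _ m v1 in vn.
have hv : h *m v = m%:R *: v by apply/subr0_eq.
have xv : x *m v = 0.
  rewrite /v; elim: (m) => //= k IH; rewrite mulmxBr -scalemxAr IH scaler0 subr0.
  by have := HX (hprod (fun v => h *m v) k v1); rewrite IH mulmx0 scaler0 sub0r => /eqP; rewrite oppr_eq0 => /eqP.
pose w2 := horner_mx h (\prod_(i < m) ('X - (i%:R : D)%:P)) *m w1.
have vE : v = z *m w2.
  by rewrite /v hprod_poly /w2 /v1 !mulmxA !mulmxE -(comm_poly_mx _ zh).
pose c : D := (m * m + 2 * m)%:R.
have Omk u mu : x *m u = 0 -> h *m u = mu *: u -> Om *m u = (mu * mu + 2%:R * mu) *: u.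
  move=> xu hu; rewrite /Om !mulmxDl -!scalemxAl -!mulmxE -!mulmxA xu mulmx0 scaler0 addr0 hu.
  by rewrite -scalemxAr hu !scalerA -scalerDl.
have Omv : Om *m v = c *: v by rewrite (Omk _ _ xv hv) /c natrD !natrM.
have [E1 [e1N _ _ e1v]] := primary_proj h (m%:R : D).
have [E2 [e2N _ _ e2v]] := primary_proj Om c.
set e1 := horner_mx h E1 in e1N e1v; set e2 := horner_mx Om E2 in e2N e2v.
have e1Om : e1 * Om = Om * e1 by apply/esym/comm_poly_mx.
have e12 : e1 * e2 = e2 * e1 by apply: comm_poly_mx.
(* The projections e1 and e2 are polynomials in h and in the Casimir element,
   hence commute with z, and they fix v. *)
pose w := e2 *m (e1 *m w2).
have zw : z *m w = v.
  have z1 : z * e1 = e1 * z by apply: comm_poly_mx.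
  have z2 : z * e2 = e2 * z by apply: comm_poly_mx.
  by rewrite /w (commV _ z2) (commV _ z1) -vE (e1v _ _ hv) (e2v _ _ Omv).
have wOm : (Om - c%:M) ^+ n.+1 *m w = 0.
  by rewrite /w (mulmxA _ e2) [X in X *m _]e2N mul0mx.
have wh : (h - m%:R%:M) ^+ n.+1 *m w = 0.
  by rewrite /w (commV _ (esym e12)) (mulmxA _ e1) [X in X *m _]e1N mul0mx.
have w_n0 : w != 0 by apply: contraNneq vn => w0'; rewrite -zw w0' mulmx0.
have [||k un uz] := @last_nonzero _ (fun k => x ^+ k *m w) n.+1.
- by rewrite expr0 mul1mx.
- by rewrite nx mul0mx.
set u := x ^+ k *m w in un.
have xu : x *m u = 0 by rewrite /u mulmxA mulmxE -exprS.
have uOm : (Om - c%:M) ^+ n.+1 *m u = 0.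
  have xOc : x * (Om - c%:M) = (Om - c%:M) * x.
    by rewrite mulrBr mulrBl xOm -mulmxE scalar_mxC.
  by rewrite /u commV ?wOm ?mulmx0 //; apply: (powC _ x _ (esym (powC x _ _ xOc))).
have uh : (h - (m + 2 * k)%:R%:M) ^+ n.+1 *m u = 0.
  have H : (h - (m + 2 * k)%:R%:M) ^+ n.+1 * x ^+ k = x ^+ k * (h - m%:R%:M) ^+ n.+1.
    have H1 j : (h - (m + 2 * j.+1)%:R%:M) * x = x * (h - (m + 2 * j)%:R%:M).
      have -> : (m + 2 * j.+1)%:R = 2%:R + (m + 2 * j)%:R :> D.
        by rewrite -natrD mulnS addnCA.
      rewrite mulrBl mulrBr hx -!mulmxE mul_scalar_mx mul_mx_scalar (scalerDl x 2%:R) opprD addrA.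
      by rewrite addrK.
    have H2 j l : (h - (m + 2 * j.+1)%:R%:M) ^+ l * x = x * (h - (m + 2 * j)%:R%:M) ^+ l.
      by elim: l => [|l IH]; rewrite ?expr0 ?mul1r ?mulr1 // !exprS -mulrA IH mulrA H1 -mulrA.
    elim: (k) => [|j IH]; first by rewrite muln0 addn0 expr0 mulr1 mul1r.
    by rewrite [x ^+ j.+1]exprS mulrA H2 -mulrA IH mulrA.
  by rewrite /u mulmxA mulmxE H -mulmxE -mulmxA wh mulmx0.
have hu := ker_semisimple xu uh.
have Omu := Omk _ _ xu hu.
have k0 : k = 0%N.
  have Pk l : (Om - c%:M) ^+ l *m u = ((m + 2 * k)%:R * (m + 2 * k)%:R + 2%:R * (m + 2 * k)%:R - c) ^+ l *: u.
    elim: l => [|l IH]; first by rewrite !expr0 mul1mx scale1r.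
    rewrite exprS -mulmxE -mulmxA IH -scalemxAr mulmxBl Omu mul_scalar_mx -scalerBl scalerA mulrC -exprS //.
  move: uOm; rewrite Pk => /eqP; rewrite scaler_eq0 (negPf un) orbF expf_eq0 /= subr_eq0.
  rewrite /c -!natrM -natrD => /eqP /(natr_inj D0); nia.
move: un; rewrite /u k0 expr0 mul1mx => _.
case/negP: vn; rewrite -zw; apply/eqP; apply: (kz m); split.
  by move: xu; rewrite /u k0 expr0 mul1mx.
by move: hu; rewrite /u k0 expr0 mul1mx muln0 addn0.
Qed.
End SemisimpleAction.

(** * Zariski closures of groups *)

Section Closure.
Variables (D : fieldType) (n : nat).
Local Notation gl := ('M[D]_n.+1).
Local Notation N := (n.+1 * n.+1 + 1)%N.
Local Notation P := {mpoly D[N]}.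
Local Notation cst := (map_mx (@mpolyC N D)).
Local Notation U := (generic_mx n D).
Local Notation dl := (inv_det n D).
Variable H : gl -> Prop.
Hypothesis HG : subgroup_GL H.

(** The ideal of all polynomials that vanish on H is the largest one with this zero
locus, so that every identity on H can be differentiated along [Lie zclosure]. *)
Definition zclosure g := zero_locus (vanish H) g.

Lemma sub_zclosure g : H g -> zclosure g.
Proof. by move=> Hg; have [h _ _ _] := HG; split; [apply: h | move=> p; apply]. Qed.

Definition rtrans (g : gl) : P -> P := poly_subst (U *m cst g) ((\det g)^-1%:MP * dl).
Lemma rtransE g h p : g \in unitmx -> h \in unitmx -> (rtrans g p).@[GL_coord h] = p.@[GL_coord (h *m g)].
Proof.
move=> ug uh; rewrite /rtrans meval_subst; apply: meval_eq; apply: coords_eqfun.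
  by rewrite map_mxM meval_cst GL_coordE meval_U.
by rewrite mevalM mevalC GL_coordE meval_dl det_mulmx invfM mulrC.
Qed.

Definition invsub : P -> P := poly_subst (dl *: \adj U) (\det U).
Lemma invsubE h p : h \in unitmx -> (invsub p).@[GL_coord h] = p.@[GL_coord (invmx h)].
Proof.
move=> uh; rewrite /invsub meval_subst; apply: meval_eq; apply: coords_eqfun.
  by rewrite map_mxZ map_mx_adj GL_coordE meval_U /= meval_dl /invmx uh.
by rewrite -det_map_mx GL_coordE meval_U det_inv invrK.
Qed.

(** Left translations by H, then right translations by the closure, and inversion
are polynomial substitutions, so they preserve the closure. *)
Lemma zclosure_group : algebraic_group zclosure.
Proof.
have [uH H1 HM HV] := HG.
have cu g : zclosure g -> g \in unitmx by case.
split; last by exists (vanish H).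
have left g u : H g -> zclosure u -> zclosure (g *m u).
  move=> Hg [uu hu]; split; first by rewrite unitmx_mul uH.
  move=> p vp; rewrite -(ltransE _ (uH _ Hg) uu); apply: hu => k Hk.
  by rewrite (ltransE _ (uH _ Hg) (uH _ Hk)); apply: vp; apply: HM.
split => //.
- exact: sub_zclosure.
- move=> g u cg zu; split; first by rewrite unitmx_mul !cu.
  move=> p vp; rewrite -(rtransE _ (cu _ zu) (cu _ cg)); case: cg => _; apply => k Hk.
  by rewrite (rtransE _ (cu _ zu) (uH _ Hk)); have [_] := left k u Hk zu; apply.
- move=> g cg; split; first by rewrite unitmx_inv cu.
  move=> p vp; rewrite -(invsubE _ (cu _ cg)); case: cg => _; apply => k Hk.
  by rewrite (invsubE _ (uH _ Hk)); apply: vp; apply: HV.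
Qed.

Lemma zclosure_sub G : algebraic_group G -> subset_mx H G -> subset_mx zclosure G.
Proof.
move=> GG HsG g [ug h]; apply: (alg_mem GG) => // p vp; apply: h => k Hk.
by apply: vp; apply: HsG.
Qed.

Lemma Lie_zclosure p X : vanish H p -> Lie zclosure X -> dLie p X = 0.
Proof. by move=> vp; apply => g [_]; apply. Qed.

Definition lin_poly (B : gl) : P := \tr (cst B *m U).
Lemma lin_polyE B g : (lin_poly B).@[GL_coord g] = \tr (B *m g).
Proof. by rewrite -[LHS]/(meval (GL_coord g) _) -trace_map_mx map_mxM meval_cst GL_coordE meval_U. Qed.
Lemma lin_poly_dLie B X : dLie (lin_poly B) X = \tr (B *m X).
Proof.
rewrite dLie_line /lin_poly -trace_map_mx dmx_tr map_mxM mmap_cst mmap_U.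
by rewrite dmxM dmx_cst emx_cst dmx_lin mul0mx add0r.
Qed.

(** For an idempotent e commuting with g, the determinant of g on the image of e. *)
Definition det_poly (e : gl) : P := \det (U *m cst e + cst (1 - e)).
Lemma det_polyE e g : (det_poly e).@[GL_coord g] = \det (g *m e + (1 - e)).
Proof. by rewrite -[LHS]/(meval (GL_coord g) _) -det_map_mx map_mxD map_mxM !meval_cst GL_coordE meval_U. Qed.
Lemma det_poly_dLie e X : dLie (det_poly e - 1) X = \tr (X *m e).
Proof.
rewrite dLie_line rmorphB rmorph1 derivB derivC subr0 /det_poly -det_map_mx map_mxD map_mxM !mmap_cst mmap_U.
rewrite -deriv_det_line; congr ((\det _)^`()).[0].
by rewrite /lin_mx mulmxDl -scalemxAl -!map_mxM mul1mx addrAC -map_mxD [e + _]addrC subrK.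
Qed.
End Closure.

(** * The group generated by two exponentials *)

Section ExpConj.
Variables (D : fieldType) (n : nat).
Hypothesis D0 : natr_inj0 D.
Local Notation gl := ('M[D]_n.+1).

(** For a linear form f vanishing on W, the derivatives at 0 of the polynomial
t |-> f (exp (t x) s exp (- t x)) are the values of f at the (ad x)^k s. *)
Lemma exp_conj_stable (W : {vspace gl}) x s : nilp x -> (forall w, w \in W -> ad x w \in W) ->
  s \in W -> expm x *m s *m expm (- x) \in W.
Proof.
move=> nx sW sS; apply/negPn/negP => nW.
have [f [fl fW fn]] := separating_form nW; case/negP: fn; apply/eqP.
rewrite (dual_mxE _ fl); set B := dual_mx f.
pose Q w : {poly D} := \tr (map_mx polyC B *m (exp_curve x *m map_mx polyC w *m exp_curve (- x))).
have hC t (A : gl) : map_mx (horner_eval t) (map_mx polyC A) = A.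
  by apply/matrixP => a b; rewrite !mxE; exact: hornerC.
have QE w t : (Q w).[t] = f (expm (t *: x) *m w *m expm (t *: - x)).
  rewrite (dual_mxE _ fl) -/B -[LHS]/(horner_eval t (Q w)) /Q -trace_map_mx !map_mxM !exp_curveE !hC.
  by [].
have dM (A C : 'M[{poly D}]_n.+1) : map_mx (@deriv D) (A *m C) = map_mx (@deriv D) A *m C + A *m map_mx (@deriv D) C.
  apply/matrixP => i j; rewrite !mxE deriv_sum -big_split; apply: eq_bigr => k _.
  by rewrite !mxE derivM.
have dC (A : gl) : map_mx (@deriv D) (map_mx polyC A) = 0.
  by apply/matrixP => i j; rewrite !mxE derivC.
have nx' := nilpN nx.
have cx : exp_curve (- x) *m map_mx polyC (- x) = map_mx polyC (- x) *m exp_curve (- x).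
  apply/matrixP => i j; apply/subr0_eq; apply: (poly_nat_roots D0) => k.
  have h : map_mx (horner_eval k%:R) (exp_curve (- x) *m map_mx polyC (- x)) = map_mx (horner_eval k%:R) (map_mx polyC (- x) *m exp_curve (- x)).
    rewrite !map_mxM hC exp_curveE mulmxE expm_comm //.
    by rewrite -scalerAl -scalerAr.
  have e (M : 'M[{poly D}]_n.+1) : (M i j).[k%:R] = map_mx (horner_eval k%:R) M i j by rewrite mxE.
  by rewrite hornerD hornerN !e h subrr.
have Qd w : (Q w)^`() = Q (ad x w).
  rewrite /Q /mxtrace deriv_sum; apply: eq_bigr => i _.
  have -> (A : 'M[{poly D}]_n.+1) : (A i i)^`() = (map_mx (@deriv D) A) i i by rewrite mxE.
  congr (fun_of_matrix _ i i); rewrite !dM !dC mul0mx add0r mulmx0 addr0 !exp_curve_deriv //.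
  rewrite cx /ad map_mxB !map_mxM mulmxBr mulmxBl !mulmxA !map_mxN mulmxN !mulNmx //.
pose q k := Q (iter k (ad x) s).
have q0 : Q s = 0.
  apply: (@deriv_zero _ D0 q) => k; first by rewrite /q Qd.
  rewrite /q QE !scale0r !expm0 mulmx1 mul1mx; apply: fW.
  by elim: k => //= k; apply: sW.
by have := QE s 1; rewrite q0 horner0 !scale1r (dual_mxE _ fl) => <-.
Qed.
End ExpConj.

Section GenGroup.
Variables (D : fieldType) (n : nat).
Hypothesis D0 : natr_inj0 D.
Local Notation gl := ('M[D]_n.+1).
Variables x y : gl.
Hypotheses (nx : nilp x) (ny : nilp y).

Definition sgn (b : bool) (a : gl) : gl := (-1) ^+ b *: a.

Inductive gen_group : gl -> Prop :=
| gen_one : gen_group 1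
| gen_x b u : gen_group u -> gen_group (expm (sgn b x) *m u)
| gen_y b u : gen_group u -> gen_group (expm (sgn b y) *m u).

Lemma sgnN b a : sgn (~~ b) a = - sgn b a.
Proof. by case: b; rewrite /sgn ?expr0 ?expr1 ?scale1r ?scaleN1r ?opprK. Qed.
Lemma nilp_sgn b a : nilp a -> nilp (sgn b a). Proof. exact: nilpZ. Qed.

Lemma gen_mul u v : gen_group u -> gen_group v -> gen_group (u *m v).
Proof.
move=> gu gv; elim: gu => [|b w _ IH|b w _ IH]; first by rewrite mul1mx.
  by rewrite -mulmxA; apply: gen_x.
by rewrite -mulmxA; apply: gen_y.
Qed.

Lemma gen_unit u : gen_group u -> u \in unitmx.
Proof.
by elim=> [|b w _ IH|b w _ IH]; rewrite ?unitmx1 // unitmx_mul IH expm_unit //; apply: nilp_sgn.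
Qed.

Lemma gen_group_GL : subgroup_GL gen_group.
Proof.
split; [exact: gen_unit | exact: gen_one | exact: gen_mul |].
have invM (a b : gl) : a \in unitmx -> b \in unitmx -> invmx (a *m b) = invmx b *m invmx a.
  by move=> ua ub; apply: invrM.
move=> u; elim=> [|b w gw IH|b w gw IH].
- by rewrite invmx1; apply: gen_one.
- have nb := nilp_sgn b nx.
  rewrite (invM _ _ (expm_unit D0 nb) (gen_unit gw)) (expm_inv D0 nb) -sgnN; apply: gen_mul => //.
  by rewrite -[expm _]mulmx1; apply: gen_x; apply: gen_one.
- have nb := nilp_sgn b ny.
  rewrite (invM _ _ (expm_unit D0 nb) (gen_unit gw)) (expm_inv D0 nb) -sgnN; apply: gen_mul => //.
  by rewrite -[expm _]mulmx1; apply: gen_y; apply: gen_one.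
Qed.

Lemma gen_in (G : gl -> Prop) : algebraic_group G -> G (expm x) -> G (expm y) -> subset_mx gen_group G.
Proof.
move=> GG Gx Gy u; elim=> [|b w _ IH|b w _ IH]; first exact: alg1.
  apply: algM => //; case: b; rewrite /sgn ?expr0 ?expr1 ?scale1r ?scaleN1r //.
  by rewrite -expm_inv //; apply: algV.
apply: algM => //; case: b; rewrite /sgn ?expr0 ?expr1 ?scale1r ?scaleN1r //.
by rewrite -expm_inv //; apply: algV.
Qed.

Lemma gen_expx : gen_group (expm x).
Proof. by rewrite -[expm x]mulmx1 -[x]scale1r -(expr0 (-1)); apply: (gen_x false); apply: gen_one. Qed.
Lemma gen_expy : gen_group (expm y).
Proof. by rewrite -[expm y]mulmx1 -[y]scale1r -(expr0 (-1)); apply: (gen_y false); apply: gen_one. Qed.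

(** The exponential of a nilpotent matrix commuting with e is unipotent on the
image of e, and the determinant there is multiplicative. *)
Lemma gen_det e u : x * e = e * x -> y * e = e * y -> e * e = e -> gen_group u ->
  u * e = e * u /\ \det (u *m e + (1 - e)) = 1.
Proof.
move=> xe ye ee.
have H a : nilp a -> a * e = e * a -> expm a * e = e * expm a /\ \det (expm a *m e + (1 - e)) = 1.
  move=> na ae; have c : expm a * e = e * expm a by apply: expm_comm.
  split => //; apply: (det_unip D0).
  have -> : expm a *m e + (1 - e) - 1 = (expm a - 1) * e.
    by rewrite mulrBl mul1r -addrA [1 - e - 1]addrAC subrr add0r.
  by apply: nilpM; [rewrite mulrBl mulrBr c mul1r mulr1 | apply: nilp_expm1].
have M a u' : a * e = e * a -> u' * e = e * u' -> \det (a *m e + (1 - e)) = 1 -> \det (u' *m e + (1 - e)) = 1 ->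
   (a *m u') * e = e * (a *m u') /\ \det (a *m u' *m e + (1 - e)) = 1.
  move=> ae ue d1 d2; split; first by rewrite mulmxE -mulrA ue mulrA ae mulrA.
  rewrite -[RHS]mulr1 -{1}d1 -d2 -det_mulmx; congr (\det _).
  have e0 : e * (1 - e) = 0 by rewrite mulrBr mulr1 ee subrr.
  have e1 : (1 - e) * e = 0 by rewrite mulrBl mul1r ee subrr.
  have h1 : a * e * (u' * e) = a * u' * e by rewrite -!mulrA (mulrA e) -ue -mulrA ee.
  have h2 : (1 - e) * (u' * e) = 0 by rewrite ue mulrA e1 mul0r.
  have h3 : (1 - e) * (1 - e) = 1 - e by rewrite mulrBr mulr1 e1 subr0.
  have h4 : a * e * (1 - e) = 0 by rewrite -mulrA e0 mulr0.
  by rewrite !mulmxE (mulrDl (a * e)) (mulrDr (a * e)) (mulrDr (1 - e) (u' * e)) h1 h2 h3 h4 addr0 add0r.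
elim=> [|b w _ [IH1 IH2]|b w _ [IH1 IH2]].
- by rewrite mul1r mulr1 mul1mx addrCA subrr addr0 det1.
- have [|h1 h2] := H (sgn b x) (nilp_sgn b nx); first by rewrite -scalerAl -scalerAr xe.
  exact: M.
- have [|h1 h2] := H (sgn b y) (nilp_sgn b ny); first by rewrite -scalerAl -scalerAr ye.
  exact: M.
Qed.

Lemma gen_stable (W : {vspace gl}) u s : (forall w, w \in W -> ad x w \in W) -> (forall w, w \in W -> ad y w \in W) ->
  s \in W -> gen_group u -> u *m s *m invmx u \in W.
Proof.
move=> sx sy sW gu.
have step a w : gen_group w -> w *m s *m invmx w \in W -> nilp a -> (forall v, v \in W -> ad a v \in W) ->
    expm a *m w *m s *m invmx (expm a *m w) \in W.
  move=> gw IH na sa.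
  have -> : invmx (expm a *m w) = invmx w *m expm (- a).
    by rewrite -(expm_inv D0 na); apply: invrM; [apply: expm_unit | apply: gen_unit].
  have -> : expm a *m w *m s *m (invmx w *m expm (- a)) = expm a *m (w *m s *m invmx w) *m expm (- a).
    by rewrite !mulmxA.
  exact: exp_conj_stable.
elim: gu => [|b w gw IH|b w gw IH]; first by rewrite invmx1 mulmx1 mul1mx.
  apply: step => //; first exact: nilp_sgn.
  by move=> v vW; rewrite /sgn adZl; apply: memvZ; apply: sx.
apply: step => //; first exact: nilp_sgn.
by move=> v vW; rewrite /sgn adZl; apply: memvZ; apply: sy.
Qed.

(** A space of linear forms stable under x and y is stable under the polynomials
exp x and exp y in them. *)
Lemma gen_annihilator (A : 'rV[D]_n.+1 -> Prop) l u : A 0 -> (forall a p q, A p -> A q -> A (a *: p + q)) ->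
  (forall p, A p -> A (p *m x)) -> (forall p, A p -> A (p *m y)) -> A l -> gen_group u -> A (l *m u).
Proof.
move=> A0 Al Ax Ay Al0 gu.
have step a b p : (forall q, A q -> A (q *m a)) -> A p -> A (p *m expm (sgn b a)).
  move=> sa pA; have AZ c q : A q -> A (c *: q) by move=> qA; rewrite -[_ *: _]addr0; apply: Al.
  rewrite /expm mulmx_sumr; elim/big_ind: _ => [//|q r hq hr|k _]; first by rewrite -[q]scale1r; apply: Al.
  rewrite -scalemxAr; apply: (AZ); elim: (nat_of_ord k) => [|j IHj]; first by rewrite expr0 mulmx1.
  by rewrite exprSr -mulmxE mulmxA -scalemxAr; apply: (AZ); apply: sa.
elim: gu l Al0 => [|b w gw IH|b w gw IH] l lA; first by rewrite mulmx1.
  by rewrite mulmxA; apply: IH; apply: step.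
by rewrite mulmxA; apply: IH; apply: step.
Qed.
End GenGroup.

(** * The Lie algebra of the closure *)

Section LieS.
Variables (D : closedFieldType) (n : nat).
Hypothesis D0 : natr_inj0 D.
Local Notation gl := ('M[D]_n.+1).
Variables x h y : gl.
Hypotheses (tr3 : triple x h y) (nx : nilp x) (ny : nilp y) (x0 : x != 0).

Definition SLgroup := zclosure (gen_group x y).

Lemma SLgroup_alg : algebraic_group SLgroup.
Proof. by apply: zclosure_group; apply: gen_group_GL. Qed.

Lemma Lie_triple : [/\ Lie SLgroup x, Lie SLgroup h & Lie SLgroup y].
Proof.
have Sg := SLgroup_alg.
have sub u : gen_group x y u -> SLgroup u by apply: sub_zclosure; apply: gen_group_GL.
have Lx : Lie SLgroup x.
  rewrite -(log_expm D0 nx); apply: log_in_Lie => //; last exact: nilp_expm1.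
  by apply: sub; apply: gen_expx.
have Ly : Lie SLgroup y.
  rewrite -(log_expm D0 ny); apply: log_in_Lie => //; last exact: nilp_expm1.
  by apply: sub; apply: gen_expy.
by split => //; have [_ _ <-] := tr3; apply: Lie_bracket.
Qed.

Let hx : ad h x = 2%:R *: x. Proof. by have [] := tr3. Qed.
Let hy : ad h y = - (2%:R *: y). Proof. by have [] := tr3. Qed.
Let xy : ad x y = h. Proof. by have [] := tr3. Qed.
Let hh : ad h h = 0. Proof. by rewrite /ad subrr. Qed.

Definition comb a b c : gl := a *: x + b *: h + c *: y.

Lemma ad_comb (A : gl) a b c : ad A (comb a b c) = a *: ad A x + b *: ad A h + c *: ad A y.
Proof. by rewrite /comb !adD !adZ. Qed.

Let two0 : (2%:R : D) != 0. Proof. by rewrite D0. Qed.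
Let four0 : (4%:R : D) != 0. Proof. by rewrite D0. Qed.

(** Two applications of ad h separate the three weights 2, 0 and -2. *)
Lemma comb_eq0 a b c : comb a b c = 0 -> [/\ a = 0, b = 0 & c = 0].
Proof.
have h0 : h != 0.
  by apply: contra_neq x0 => h0; move: hx; rewrite h0 /ad mul0r mulr0 subr0 => /esym/eqP; rewrite scaler_eq0 (negPf two0) => /eqP.
have y0 : y != 0 by apply: contra_neq h0 => y0; rewrite -xy y0 ad0.
move=> e0.
have e1 : comb (2%:R * a) 0 (- (2%:R * c)) = 0.
  have := congr1 (ad h) e0; rewrite ad_comb hx hh hy ad0 /comb !scaler0 scale0r scalerN !scalerA.
  by rewrite scaleNr [a * _]mulrC [c * _]mulrC.
have e2 : comb (4%:R * a) 0 (4%:R * c) = 0.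
  have := congr1 (ad h) e1; rewrite ad_comb hx hh hy ad0 /comb !scaler0 scale0r scalerN !scalerA => e.
  by rewrite -[RHS]e /comb; apply/matrixP => i j; rewrite !mxE; ring.
have a0 : a = 0.
  have : comb (4%:R * a) 0 (4%:R * c) + 2%:R *: comb (2%:R * a) 0 (- (2%:R * c)) = 0 by rewrite e1 e2 scaler0 addr0.
  have -> : comb (4%:R * a) 0 (4%:R * c) + 2%:R *: comb (2%:R * a) 0 (- (2%:R * c)) = (8%:R * a) *: x.
    by rewrite /comb; apply/matrixP => i j; rewrite !mxE; ring.
  by move=> /eqP; rewrite scaler_eq0 (negPf x0) orbF mulf_eq0 D0 /= => /eqP.
have c0 : c = 0.
  move: e2; rewrite /comb a0 mulr0 !scale0r !add0r => /eqP.
  by rewrite scaler_eq0 (negPf y0) orbF mulf_eq0 (negPf four0) => /eqP.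
split=> //; move: e0; rewrite /comb a0 c0 !scale0r addr0 add0r => /eqP.
by rewrite scaler_eq0 (negPf h0) orbF => /eqP.
Qed.

Definition triple_span : {vspace gl} := (<[x]> + <[h]> + <[y]>)%VS.

Lemma triple_spanP A : reflect (exists a b c, A = comb a b c) (A \in triple_span).
Proof.
apply: (iffP idP) => [/memv_addP [_ /memv_addP [_ /vlineP [a ->] [_ /vlineP [b ->] ->]] [_ /vlineP [c ->] ->]]|[a [b [c ->]]]].
  by exists a, b, c.
by apply: memv_add; [apply: memv_add|]; apply: memvZ; apply: memv_line.
Qed.

Lemma triple_span_comb a b c : comb a b c \in triple_span. Proof. by apply/triple_spanP; exists a, b, c. Qed.
Lemma triple_spanx : x \in triple_span. Proof. by have -> : x = comb 1 0 0; [rewrite /comb scale1r !scale0r !addr0 | apply: triple_span_comb]. Qed.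
Lemma triple_spanh : h \in triple_span. Proof. by have -> : h = comb 0 1 0; [rewrite /comb scale1r !scale0r addr0 add0r | apply: triple_span_comb]. Qed.
Lemma triple_spany : y \in triple_span. Proof. by have -> : y = comb 0 0 1; [rewrite /comb scale1r !scale0r !add0r | apply: triple_span_comb]. Qed.

Lemma triple_span_adx w : w \in triple_span -> ad x w \in triple_span.
Proof.
move=> /triple_spanP [a [b [c ->]]]; rewrite ad_comb (adC x h) hx xy {1}/ad subrr scaler0 add0r scalerN scalerA -scaleNr.
by apply: memvD; apply: memvZ; [apply: triple_spanx | apply: triple_spanh].
Qed.
Lemma triple_span_ady w : w \in triple_span -> ad y w \in triple_span.
Proof.
move=> /triple_spanP [a [b [c ->]]]; rewrite ad_comb (adC y x) xy (adC y h) hy opprK /ad subrr scaler0 addr0 scalerN -scaleNr.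
by apply: memvD; apply: memvZ; [apply: triple_spanh | apply: memvZ; apply: triple_spany].
Qed.

Lemma ad_comb2 a b c a' b' c' : ad (comb a b c) (comb a' b' c') =
  comb (2%:R * (b * a' - a * b')) (a * c' - c * a') (2%:R * (c * b' - b * c')).
Proof.
have xx : ad x x = 0 by rewrite /ad subrr.
have yy : ad y y = 0 by rewrite /ad subrr.
have xh : ad x h = - (2%:R *: x) by rewrite adC hx.
have yh : ad y h = 2%:R *: y by rewrite adC hy opprK.
have yx : ad y x = - h by rewrite adC xy.
have E A : ad (comb a b c) A = - (a *: ad A x + b *: ad A h + c *: ad A y) by rewrite adC ad_comb.
rewrite ad_comb !E xx xh xy hx hh hy yx yh yy.
rewrite /comb; apply/matrixP => i j; rewrite !mxE.
move: (x i j) (h i j) (y i j) => X H Y; ring.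
Qed.

Lemma comb_inj a b c a' b' c' : comb a b c = comb a' b' c' -> [/\ a = a', b = b' & c = c'].
Proof.
move=> e; have /comb_eq0 [] : comb (a - a') (b - b') (c - c') = 0.
  have -> : comb (a - a') (b - b') (c - c') = comb a b c - comb a' b' c'.
    by rewrite /comb; apply/matrixP => i j; rewrite !mxE; ring.
  by rewrite e subrr.
by split; apply/subr0_eq.
Qed.

Lemma comb_x : x = comb 1 0 0. Proof. by rewrite /comb scale1r !scale0r !addr0. Qed.
Lemma comb_h : h = comb 0 1 0. Proof. by rewrite /comb scale1r !scale0r addr0 add0r. Qed.
Lemma comb_y : y = comb 0 0 1. Proof. by rewrite /comb scale1r !scale0r !add0r. Qed.
Lemma combZ k a b c : k *: comb a b c = comb (k * a) (k * b) (k * c).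
Proof. by rewrite /comb !scalerDr !scalerA. Qed.
Lemma combD a b c a' b' c' : comb a b c + comb a' b' c' = comb (a + a') (b + b') (c + c').
Proof. by rewrite /comb; apply/matrixP => i j; rewrite !mxE; ring. Qed.

Lemma ad_comb_x a b c : ad (comb a b c) x = comb (2%:R * b) (- c) 0.
Proof. by rewrite [X in ad _ X]comb_x ad_comb2; congr comb; ring. Qed.
Lemma ad_comb_h a b c : ad (comb a b c) h = comb (- (2%:R * a)) 0 (2%:R * c).
Proof. by rewrite [X in ad _ X]comb_h ad_comb2; congr comb; ring. Qed.
Lemma ad_comb_y a b c : ad (comb a b c) y = comb 0 a (- (2%:R * b)).
Proof. by rewrite [X in ad _ X]comb_y ad_comb2; congr comb; ring. Qed.

(** The derivations of sl2 are inner: the three Jacobi identities determine the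
coordinates of ad X on the triple, and s is read off from them. *)
Lemma normalizer_split X : ad X x \in triple_span -> ad X h \in triple_span -> ad X y \in triple_span ->
  exists2 s, s \in triple_span & [/\ ad (X - s) x = 0, ad (X - s) h = 0 & ad (X - s) y = 0].
Proof.
move=> /triple_spanP [p [q [r Xx]]] /triple_spanP [a [b [c Xh]]] /triple_spanP [p' [q' [r' Xy]]].
have N1 u v w : - comb u v w = comb (- u) (- v) (- w).
  by rewrite /comb !scaleNr !opprD.
have := jacobi X h x; rewrite hx adZ Xx Xh ad_comb_x adC ad_comb_h N1 combZ combD.
have := jacobi X h y; rewrite hy -scaleNr adZ Xy Xh ad_comb_y adC ad_comb_h N1 combZ combD.
have := jacobi X x y; rewrite xy Xh Xx Xy ad_comb_y adC ad_comb_x N1 combD.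
move=> /comb_inj [A1 A2 A3] /comb_inj [B1 B2 B3] /comb_inj [C1 C2 C3].
have adBl A B C : ad (A - B) C = ad A C - ad B C.
  by rewrite /ad mulrBl mulrBr opprD addrACA -opprD.
have mul2 (u v : D) : 2%:R * u = 2%:R * v -> u = v by apply: mulfI.
have b0 : b = 0.
  by apply: mul2; apply: (@addIr _ (2%:R * p)); rewrite mulr0 add0r [RHS]C1; ring.
have r0 : r = 0.
  by apply: (mulfI four0); transitivity (2%:R * r + 2%:R * r); [ring | rewrite {1}C3; ring].
have qE : 2%:R * q = - c by rewrite C2; ring.
have p'0 : p' = 0.
  apply: (mulfI four0); transitivity (2%:R * p' - (- 2%:R * p')); first by ring.
  by rewrite B1; ring.
have q'E : 2%:R * q' = - a.
  by apply: oppr_inj; rewrite opprK -mulNr B2; ring.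
have r'E : r' = - p.
  by apply/eqP; rewrite -addr_eq0; apply/eqP; transitivity b; [rewrite A2; ring | exact: b0].
have d2 (u : D) : 2%:R * (u / 2%:R) = u by rewrite mulrC divfK.
exists (comb (- a / 2%:R) (p / 2%:R) (c / 2%:R)); first exact: triple_span_comb.
have z3 u v w : u = 0 -> v = 0 -> w = 0 -> comb u v w = 0.
  by move=> -> -> ->; rewrite /comb !scale0r !addr0.
split; rewrite adBl.
- rewrite Xx ad_comb_x N1 combD r0; apply: z3; rewrite ?d2 ?subrr //.
  by apply: mul2; rewrite opprK mulrDr d2 qE mulr0 addNr.
- by rewrite Xh ad_comb_h N1 combD b0; apply: z3; rewrite ?d2 ?subrr // ?opprK ?subrr // mulNr ?mulrN d2 opprK subrr.
- rewrite Xy ad_comb_y N1 combD p'0 r'E; apply: z3; rewrite ?d2 ?subrr // ?opprK ?addNr //.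
  by apply: mul2; rewrite mulrDr mulrN d2 q'E mulr0 opprK addNr.
Qed.

Lemma dual_line (v w : 'cV[D]_n.+1) : (forall l : 'rV[D]_n.+1, l *m v = 0 -> l *m w = 0) ->
  exists c, w = c *: v.
Proof.
move=> hl; case: (eqVneq v 0) => [v0|].
  exists 0; rewrite scale0r; apply/colP => i.
  have := hl (delta_mx 0 i); rewrite v0 mulmx0 => /(_ erefl) /(congr1 (fun M : 'M[D]_1 => M 0 0)).
  by rewrite -rowE !mxE.
move=> /matrix0Pn [i [j vij]]; rewrite (ord1 j) in vij.
exists (w i 0 / v i 0); apply/colP => k; rewrite mxE.
pose l := delta_mx 0 k - (v k 0 / v i 0) *: (delta_mx 0 i : 'rV[D]_n.+1).
have lE (u : 'cV[D]_n.+1) : (l *m u) 0 0 = u k 0 - v k 0 / v i 0 * u i 0.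
  by rewrite /l mulmxBl -scalemxAl -!rowE !mxE.
have lv : l *m v = 0.
  by apply/matrixP => a b; rewrite (ord1 a) (ord1 b) lE mxE divfK ?subrr.
have := lE w; rewrite (hl _ lv) mxE => /esym/subr0_eq ->.
by rewrite mulrAC [RHS]mulrAC [v k 0 * _]mulrC.
Qed.

Let hyM : h * y = y * h - 2%:R *: y. Proof. by rewrite -hy /ad addrC subrK. Qed.
Let xyM : x * y = y * x + h. Proof. by rewrite -xy /ad addrC subrK. Qed.

Lemma highest_weight_lower m v k : highest_weight x h m v -> h *m (y ^+ k *m v) = (m%:R - 2%:R * k%:R) *: (y ^+ k *m v).
Proof.
move=> [_ hv]; elim: k => [|k IH]; first by rewrite mulr0 subr0 expr0 mul1mx.
rewrite exprS -mulmxE -mulmxA mulmxA mulmxE hyM mulmxBl -!mulmxE -[y *m h *m _]mulmxA IH.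
by rewrite -scalemxAr -scalemxAl -scalerBl; congr (_ *: _); rewrite -[k.+1%:R]natr1; ring.
Qed.

Lemma highest_weight_raise m v k : highest_weight x h m v -> exists a, x *m (y ^+ k.+1 *m v) = a *: (y ^+ k *m v).
Proof.
move=> hwv; elim: k => [|k [a IH]].
  exists m%:R; have [xv hv] := hwv.
  by rewrite expr1 expr0 mul1mx mulmxA mulmxE xyM mulmxDl -mulmxE -mulmxA xv mulmx0 add0r.
exists (a + (m%:R - 2%:R * k.+1%:R)).
rewrite [y ^+ k.+2]exprS -mulmxE -mulmxA mulmxA mulmxE xyM mulmxDl -mulmxE -mulmxA IH.
rewrite (highest_weight_lower _ hwv) -scalemxAr (mulmxA y) mulmxE -exprS scalerDl //.
Qed.

(** The span of the y^k v is stable under x and y. *)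
Lemma gen_highest_weight m v (l : 'rV[D]_n.+1) u : highest_weight x h m v -> (forall k, l *m (y ^+ k *m v) = 0) -> gen_group x y u -> l *m (u *m v) = 0.
Proof.
move=> hwv lv gu; pose A (p : 'rV[D]_n.+1) := forall k, p *m (y ^+ k *m v) = 0.
have : A (l *m u).
  apply: (@gen_annihilator _ _ x y A l u) => //.
  - by move=> k; rewrite mul0mx.
  - by move=> a p q hp hq k; rewrite mulmxDl -scalemxAl hp hq scaler0 addr0.
  - move=> p hp [|k]; rewrite -mulmxA.
      by have [xv _] := hwv; rewrite expr0 mul1mx xv mulmx0.
    by have [a ->] := highest_weight_raise k hwv; rewrite -scalemxAr hp scaler0.
  - by move=> p hp k; rewrite -mulmxA (mulmxA y) mulmxE -exprS hp.
by move=> /(_ 0%N); rewrite expr0 mul1mx mulmxA.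
Qed.

(** An element of the Lie algebra is tested on three families of polynomials: the
matrix coefficients of the adjoint action on the span of the triple, the
determinants [det_poly], and the coefficients of the orbits of highest weight
vectors. *)
Lemma Lie_SLgroup X : Lie SLgroup X <-> X \in triple_span.
Proof.
have Sg := SLgroup_alg; have [Lx Lh Ly] := Lie_triple.
split; last first.
  move=> /triple_spanP [a [b [c ->]]].
  have -> : comb a b c = a *: x + (b *: h + (c *: y + 0)) by rewrite addr0 addrA.
  exact: (Lie_linear a Lx (Lie_linear b Lh (Lie_linear c Ly (@Lie0 _ _ _)))).
move=> LX.
have cn s : s \in triple_span -> ad X s \in triple_span.
  move=> sW; apply/negPn/negP => nW.
  have [f [fl fW fn]] := separating_form nW; case/negP: fn; apply/eqP.
  rewrite (dual_mxE _ fl) -[ad X s]/(X *m s - s *m X) -conj_poly_dLie.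
  apply: (Lie_zclosure _ LX) => u gu.
  rewrite conj_polyE; last exact: (gen_unit D0 nx ny gu).
  rewrite -(dual_mxE _ fl); apply: fW.
  exact: (gen_stable D0 nx ny triple_span_adx triple_span_ady sW gu).
have [s sW [zx zh zy]] := normalizer_split (cn x triple_spanx) (cn h triple_spanh) (cn y triple_spany).
set z := X - s in zx zh zy.
have XE : X = s + z by rewrite /z addrC subrK.
have zxM : z * x = x * z by apply/subr0_eq.
have zhM : z * h = h * z by apply/subr0_eq.
have zyM : z * y = y * z by apply/subr0_eq.
(* For an idempotent e commuting with the triple, u |-> det (u on im e) is
   constant on the group; its derivative at X is tr (X e), while tr (s e) = 0
   because the triple consists of commutators. *)
have nz : nilp z.
  apply: (nilp_criterion D0) => e ce ee.
  have xe := ce x (esym zxM); have ye := ce y (esym zyM); have he := ce h (esym zhM).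
  have tX : \tr (X *m e) = 0.
    rewrite -det_poly_dLie; apply: (Lie_zclosure _ LX) => u gu.
    have [_ d1] := gen_det D0 nx ny xe ye ee gu.
    by rewrite mevalB meval1 det_polyE d1 subrr.
  have trad a b : b * e = e * b -> \tr (ad a b * e) = 0.
    move=> be; rewrite /ad mulrBl raddfB /= -!mulmxE -[a *m b *m e]mulmxA [b *m e]be -mulmxE.
    by rewrite mulmxA mxtrace_mulC !mulmxA subrr.
  have te a : \tr (2%:R *: a * e) = 0 -> \tr (a * e) = 0.
    by rewrite -scalerAl mxtraceZ => /eqP; rewrite mulf_eq0 (negPf two0) => /eqP.
  have tx : \tr (x * e) = 0 by apply: te; rewrite -hx; apply: trad.
  have th : \tr (h * e) = 0 by rewrite -xy; apply: trad.
  have ty : \tr (y * e) = 0.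
    by apply: te; rewrite -[2%:R *: y]opprK -hy mulNr raddfN /= trad ?oppr0.
  have ts : \tr (s * e) = 0.
    have /triple_spanP [a [b [c ->]]] := sW.
    by rewrite /comb !mulrDl !mxtraceD -!scalerAl !mxtraceZ tx th ty !mulr0 !addr0.
  by move: tX; rewrite XE mulmxE mulrDl mxtraceD ts add0r.
(* The projection e on the primary component of h for m isolates v among the
   y^k v.  So if l v = 0, the form l e kills the orbit of v, whence l z v = 0:
   z v is on the line of v, and z is nilpotent. *)
have kz m v : highest_weight x h m v -> z *m v = 0.
  move=> hwv; have [xv hv] := hwv.
  have [E [eN _ _ ev]] := primary_proj h (m%:R : D); set e := horner_mx h E in eN ev.
  have ze : z * e = e * z by apply: comm_poly_mx.
  have he : h * e = e * h by apply: comm_poly_mx.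
  have [|c zv] := @dual_line v (z *m v).
    move=> l lv.
    have l'y k : (l *m e) *m (y ^+ k *m v) = 0.
      rewrite -mulmxA; case: k => [|k]; first by rewrite expr0 mul1mx (ev _ _ hv).
      rewrite (_ : e *m _ = 0) ?mulmx0 //.
      apply: (@coprime_kill _ _ h m%:R (m%:R - 2%:R * k.+1%:R) n.+1 1).
      - by rewrite eq_sym -subr_eq0 addrAC subrr add0r oppr_eq0 mulf_eq0 negb_or !D0.
      - by rewrite mulmxA [_ *m e]eN mul0mx.
      - rewrite expr1 mulmxA mulmxBl [h *m e]he mul_scalar_mx -mul_mx_scalar -mulmxE -mulmxBr -mulmxA mulmxBl.
        by rewrite (highest_weight_lower _ hwv) mul_scalar_mx subrr mulmx0.
    have Xl : l *m e *m (X *m v) = 0.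
      have := lin_poly_dLie (v *m (l *m e)) X.
      rewrite (Lie_zclosure _ LX) => [/esym|u gu]; last first.
        rewrite lin_polyE -mulmxA mxtrace_mulC -[(_ *m u) *m v]mulmxA (gen_highest_weight hwv l'y gu).
        by rewrite mxtrace0.
      rewrite -[v *m _ *m X]mulmxA [\tr _]mxtrace_mulC -[_ *m X *m v]mulmxA => t0.
      by apply/matrixP => i j; rewrite (ord1 i) (ord1 j) [RHS]mxE; move: t0; rewrite /mxtrace big_ord1.
    have sl : l *m e *m (s *m v) = 0.
      have /triple_spanP [a [b [c ->]]] := sW.
      rewrite /comb !mulmxDl -!scalemxAl xv hv scaler0 add0r !mulmxDr -!scalemxAr.
      have := l'y 0%N; rewrite expr0 mul1mx => ->.
      by have := l'y 1%N; rewrite expr1 => ->; rewrite !scaler0 addr0.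
    have zl : l *m e *m (z *m v) = 0 by rewrite /z mulmxBl mulmxBr Xl sl subrr.
    move: zl; rewrite -mulmxA (mulmxA e) [e *m z](esym ze) -mulmxA (ev _ _ hv).
    by [].
  case: (eqVneq v 0) => [->|v0]; first by rewrite mulmx0.
  by rewrite zv (nilp_scaled nz zv v0) scale0r.
by rewrite XE (comm_kills_hw D0 tr3 nx zxM zyM kz) addr0.
Qed.
End LieS.

(** * The isomorphism with sl2 *)

Section SLof.
Variables (D : closedFieldType) (n : nat).
Hypothesis D0 : natr_inj0 D.
Local Notation gl := ('M[D]_n.+1).
Variables x h y : gl.
Hypotheses (tr3 : triple x h y) (nx : nilp x) (ny : nilp y) (x0 : x != 0).

Definition sl2_mx (a b c : D) : 'M[D]_2 :=
  a *: delta_mx 0 1 + b *: (delta_mx 0 0 - delta_mx 1 1) + c *: delta_mx 1 0.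

Lemma sl2_mx_sl a b c : sl (sl2_mx a b c).
Proof.
rewrite /sl /sl2_mx !mxtraceD !mxtraceZ raddfB /= /mxtrace !big_ord_recl !big_ord0 !mxE /=.
by ring.
Qed.

Lemma sl2_mx_bracket a b c a' b' c' : lie_bracket (sl2_mx a b c) (sl2_mx a' b' c') =
  sl2_mx (2%:R * (b * a' - a * b')) (a * c' - c * a') (2%:R * (c * b' - b * c')).
Proof.
apply/matrixP => i j; rewrite !mxE !big_ord_recl !big_ord0 !mxE.
by case: i => [[|[|i]] hi] //; case: j => [[|[|j]] hj] //=; ring.
Qed.

Lemma sl_mk2 (Y : 'M[D]_2) : sl Y -> Y = sl2_mx (Y 0 1) (Y 0 0) (Y 1 0).
Proof.
rewrite /sl /mxtrace !big_ord_recl big_ord0 addr0 => t0.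
have t1 : Y 1 1 = - Y 0 0.
  apply/eqP; rewrite -addr_eq0 addrC; apply/eqP; rewrite -t0; congr (_ + Y _ _); exact: val_inj.
apply/matrixP => i j; rewrite !mxE.
have [-> | ->] : i = 0 \/ i = 1 by case: i => [[|[|i]] hi] //; [left|right]; apply: val_inj.
all: have [-> | ->] : j = 0 \/ j = 1 by case: j => [[|[|j]] hj] //; [left|right]; apply: val_inj.
all: rewrite /= ?t1; ring.
Qed.

Lemma SL_of G : algebraic_group G -> G (expm x) -> G (expm y) -> is_SL_of G (expm x) (SLgroup x y).
Proof.
move=> GG Gx Gy; have GLg := gen_group_GL D0 nx ny.
have hW X : Lie (SLgroup x y) X <-> exists a b c, X = comb x h y a b c.
  by split; [move/(Lie_SLgroup D0 tr3 nx ny x0)/triple_spanP | move/triple_spanP/(Lie_SLgroup D0 tr3 nx ny x0)].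
split.
- exact: SLgroup_alg.
- by apply: zclosure_sub => //; apply: gen_in.
- by apply: sub_zclosure => //; apply: gen_expx.
- by rewrite log_expm //; have [] := Lie_triple D0 tr3 nx ny.
have [phi hphi] : exists phi : gl -> 'M[D]_2, forall X a b c, X = comb x h y a b c -> phi X = sl2_mx a b c.
  apply: (functional_choice (fun X M => forall a b c, X = comb x h y a b c -> M = sl2_mx a b c)) => X.
  case: (classic (exists a b c, X = comb x h y a b c)) => [[a [b [c ->]]]|nX].
    by exists (sl2_mx a b c) => a' b' c' /(comb_inj D0 tr3 x0) [-> -> ->].
  by exists 0 => a b c e; case: nX; exists a, b, c.
have pE a b c : phi (comb x h y a b c) = sl2_mx a b c by apply: hphi.
have mkl k a b c a' b' c' : sl2_mx (k * a + a') (k * b + b') (k * c + c') = k *: sl2_mx a b c + sl2_mx a' b' c'.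
  by apply/matrixP => i j; rewrite !mxE; ring.
exists phi; split; last first.
  rewrite log_expm // [X in phi X](_ : x = comb x h y 1 0 0); last exact: comb_x.
  by rewrite pE /sl2_mx !scale0r !addr0 scale1r.
split.
- by move=> X /hW [a [b [c ->]]]; rewrite pE; apply: sl2_mx_sl.
- move=> k X Y /hW [a [b [c ->]]] /hW [a' [b' [c' ->]]].
  by rewrite combZ combD !pE mkl.
- move=> X Y /hW [a [b [c ->]]] /hW [a' [b' [c' ->]]].
  rewrite -[lie_bracket (comb _ _ _ _ _ _) _]/(ad (comb x h y a b c) (comb x h y a' b' c')).
  by rewrite (ad_comb2 tr3) !pE sl2_mx_bracket.
- move=> X Y /hW [a [b [c ->]]] /hW [a' [b' [c' ->]]]; rewrite !pE => e.
  have [e1 e2 e3] : [/\ a = a', b = b' & c = c'].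
    have E i j := congr1 (fun M : 'M[D]_2 => M i j) e.
    have m1 u v w : sl2_mx u v w 0 1 = u by rewrite !mxE /=; ring.
    have m2 u v w : sl2_mx u v w 0 0 = v by rewrite !mxE /=; ring.
    have m3 u v w : sl2_mx u v w 1 0 = w by rewrite !mxE /=; ring.
    by split; [rewrite -(m1 a b c) e m1 | rewrite -(m2 a b c) e m2 | rewrite -(m3 a b c) e m3].
  by rewrite e1 e2 e3.
- move=> Y /sl_mk2 ->; exists (comb x h y (Y 0 1) (Y 0 0) (Y 1 0)); last exact: pE.
  by apply/hW; exists (Y 0 1), (Y 0 0), (Y 1 0).
Qed.
End SLof.

(** * Specializations of subrings of a field *)

Section Specialize.
Variable D : closedFieldType.
Hypothesis D0 : natr_inj0 D.
Implicit Types (R : D -> Prop) (Gam : D -> D -> Prop) (p q : {poly D}).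

Record subring R : Prop := Subring {
  sr0 : R 0; sr1 : R 1; srN : forall a, R a -> R (- a);
  srD : forall a b, R a -> R b -> R (a + b); srM : forall a b, R a -> R b -> R (a * b) }.

(** A ring morphism from R to D is given by its graph, a relation on D: R needs no
type of its own, and extending a morphism means enlarging a relation. *)
Record morph R Gam : Prop := Morph {
  m_dom : forall a a', Gam a a' -> R a;
  m_tot : forall a, R a -> exists a', Gam a a';
  m_fun : forall a', Gam 0 a' -> a' = 0;
  m_1 : Gam 1 1;
  m_N : forall a a', Gam a a' -> Gam (- a) (- a');
  m_D : forall a a' b b', Gam a a' -> Gam b b' -> Gam (a + b) (a' + b');
  m_M : forall a a' b b', Gam a a' -> Gam b b' -> Gam (a * b) (a' * b') }.

Lemma m_0 R Gam : morph R Gam -> Gam 0 0.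
Proof. by move=> m; rewrite -(subrr 1); apply: (m_D m); [|apply: (m_N m)]; apply: (m_1 m). Qed.

Lemma m_eq R Gam a b c : morph R Gam -> Gam a b -> Gam a c -> b = c.
Proof.
move=> m h1 h2; apply/subr0_eq; apply: (m_fun m); rewrite -(subrr a).
by apply: (m_D m) => //; apply: (m_N m).
Qed.

Definition poly_over R p := forall i, R p`_i.
Definition poly_rel Gam p p' := forall i, Gam p`_i p'`_i.
Definition adjoin R c a := exists2 p, poly_over R p & a = p.[c].
Definition ext_graph Gam c c' a a' := exists p p', [/\ poly_rel Gam p p', a = p.[c] & a' = p'.[c']].

Section POver.
Variables (R : D -> Prop).
Hypothesis sR : subring R.

Lemma sr_sum I (r : seq I) (F : I -> D) : (forall i, R (F i)) -> R (\sum_(i <- r) F i).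
Proof. by move=> h; elim/big_ind: _ => //; [apply: sr0 | apply: srD]. Qed.
Lemma sr_exp a k : R a -> R (a ^+ k).
Proof. by move=> h; elim: k => [|k IH]; rewrite ?expr0 ?exprS; [apply: sr1 | apply: srM]. Qed.

Lemma poly_overD p q : poly_over R p -> poly_over R q -> poly_over R (p + q).
Proof. by move=> hp hq i; rewrite coefD; apply: srD. Qed.
Lemma poly_overN p : poly_over R p -> poly_over R (- p).
Proof. by move=> hp i; rewrite coefN; apply: srN. Qed.
Lemma poly_overM p q : poly_over R p -> poly_over R q -> poly_over R (p * q).
Proof. by move=> hp hq i; rewrite coefM; apply: sr_sum => j; apply: srM. Qed.
Lemma poly_overC a : R a -> poly_over R a%:P.
Proof. by move=> h i; rewrite coefC; case: ifP => // _; apply: sr0. Qed.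
Lemma poly_overX k : poly_over R 'X^k.
Proof. by move=> i; rewrite coefXn; case: eqP => _; [apply: sr1 | apply: sr0]. Qed.
Lemma poly_overZ a p : R a -> poly_over R p -> poly_over R (a *: p).
Proof. by move=> ha hp i; rewrite coefZ; apply: srM. Qed.

Lemma adjoin_subring c : subring (adjoin R c).
Proof.
split.
- by exists 0; rewrite ?horner0 // => i; rewrite coef0; apply: sr0.
- by exists 1; rewrite ?hornerC // -polyC1; apply: poly_overC; apply: sr1.
- by move=> _ [p hp ->]; exists (- p); rewrite ?hornerN //; apply: poly_overN.
- by move=> _ _ [p hp ->] [q hq ->]; exists (p + q); rewrite ?hornerD //; apply: poly_overD.
- by move=> _ _ [p hp ->] [q hq ->]; exists (p * q); rewrite ?hornerM //; apply: poly_overM.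
Qed.

Lemma pdiv_over p q : poly_over R p -> p != 0 -> poly_over R q ->
  exists k u rho, [/\ poly_over R u, poly_over R rho, (size rho < size p)%N & lead_coef p ^+ k *: q = u * p + rho].
Proof.
move=> hp p0; move: {2}(size q) (leqnn (size q)) => m; elim: m q => [|m IH] q qm hq.
  exists 0%N, 0, q; rewrite expr0 scale1r mul0r add0r; split => //.
    by move=> i; rewrite coef0; apply: sr0.
  by move: qm; rewrite leqn0 size_poly_eq0 => /eqP ->; rewrite size_poly0 size_poly_gt0.
case: (ltnP (size q) (size p)) => [lt|le].
  exists 0%N, 0, q; rewrite expr0 scale1r mul0r add0r; split => //.
  by move=> i; rewrite coef0; apply: sr0.
pose a := lead_coef p.
pose t := (lead_coef q)%:P * 'X^(size q - size p).
pose q2 := a *: q - t * p.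
have ht : poly_over R t by apply: poly_overM; [apply: poly_overC; apply: hq | apply: poly_overX].
have hq2 : poly_over R q2.
  by apply: poly_overD; [apply: poly_overZ => //; apply: hp | apply: poly_overN; apply: poly_overM].
have sq2 : (size q2 <= m)%N.
  have sp : (0 < size p)%N by rewrite size_poly_gt0.
  apply/leq_sizeP => j mj; rewrite /q2 coefB coefZ /t -mulrA coefCM coefXnM.
  case: (ltnP j (size q - size p)) => h.
    by move: qm mj h sp; lia.
  have qp : (0 < size q)%N by apply: leq_trans le; rewrite size_poly_gt0.
  case: (ltngtP j (size q).-1) => hj.
  - by move: qm mj hj qp; lia.
  - rewrite [q`_j]nth_default; last exact: leq_trans (leqSpred _) hj.
    have key u v i : (v <= u -> u.-1 < i -> v <= i - (u - v))%N by lia.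
    by rewrite nth_default ?mulr0 ?subrr //; apply: key le hj.
  - rewrite hj /a !lead_coefE mulrC; apply/eqP; rewrite subr_eq0; apply/eqP; congr (_ * p`_ _).
    by move: le qp sp; lia.
have [k [u [rho [hu hr sr e]]]] := IH q2 sq2 hq2.
exists k.+1, (u + a ^+ k *: t), rho; split => //.
  by apply: poly_overD => //; apply: poly_overZ => //; apply: sr_exp; apply: hp.
rewrite exprSr -scalerA -/a -[a *: q](subrK (t * p)) -/q2 scalerDr e.
by rewrite mulrDl -scalerAl -!addrA [rho + _]addrC.
Qed.

(** Minimality is among polynomials over the ring R, whose leading coefficients
need not be invertible in R. *)
Lemma min_annihilator c : (exists2 p, poly_over R p & p != 0 /\ p.[c] = 0) ->
  exists p, [/\ poly_over R p, p != 0, p.[c] = 0 & forall q, poly_over R q -> q.[c] = 0 -> (size q < size p)%N -> q = 0].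
Proof.
case=> p hp [p0 pc]; move: {2}(size p) (leqnn (size p)) => m.
elim: m p hp p0 pc => [|m IH] p hp p0 pc sp.
  by move: p0; rewrite -size_poly_gt0 ltnNge sp.
case: (classic (exists q, [/\ poly_over R q, q.[c] = 0, (size q < size p)%N & q != 0])).
  by move=> [q [hq qc sq q0]]; apply: (IH q) => //; rewrite -ltnS; apply: leq_trans sp.
move=> nq; exists p; split => // q hq qc sq; apply/eqP/negPn/negP => q0.
by apply: nq; exists q.
Qed.
End POver.

Section PRel.
Variables (R : D -> Prop) (Gam : D -> D -> Prop).
Hypothesis mG : morph R Gam.

Lemma m_sum I (r : seq I) (F F' : I -> D) : (forall i, Gam (F i) (F' i)) -> Gam (\sum_(i <- r) F i) (\sum_(i <- r) F' i).
Proof. by move=> h; elim/big_rec2: _ => [|i x y _]; [apply: (m_0 mG) | apply: (m_D mG)]. Qed.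
Lemma m_exp a a' k : Gam a a' -> Gam (a ^+ k) (a' ^+ k).
Proof. by move=> h; elim: k => [|k IH]; rewrite ?expr0 ?exprS; [apply: (m_1 mG) | apply: (m_M mG)]. Qed.

Lemma poly_relD p q p' q' : poly_rel Gam p p' -> poly_rel Gam q q' -> poly_rel Gam (p + q) (p' + q').
Proof. by move=> hp hq i; rewrite !coefD; apply: (m_D mG). Qed.
Lemma poly_relN p p' : poly_rel Gam p p' -> poly_rel Gam (- p) (- p').
Proof. by move=> hp i; rewrite !coefN; apply: (m_N mG). Qed.
Lemma poly_relM p q p' q' : poly_rel Gam p p' -> poly_rel Gam q q' -> poly_rel Gam (p * q) (p' * q').
Proof. by move=> hp hq i; rewrite !coefM; apply: m_sum => j; apply: (m_M mG). Qed.
Lemma poly_relC a a' : Gam a a' -> poly_rel Gam a%:P a'%:P.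
Proof. by move=> h i; rewrite !coefC; case: ifP => // _; apply: (m_0 mG). Qed.
Lemma poly_relZ a a' p p' : Gam a a' -> poly_rel Gam p p' -> poly_rel Gam (a *: p) (a' *: p').
Proof. by move=> ha hp i; rewrite !coefZ; apply: (m_M mG). Qed.

Lemma poly_rel_tot p : poly_over R p -> exists p', poly_rel Gam p p'.
Proof.
elim/poly_ind: p => [|p c IH] hp.
  by exists 0 => i; rewrite coef0; apply: (m_0 mG).
have hp' : poly_over R p by move=> i; have := hp i.+1; rewrite coefD coefMX coefC addr0.
have [p' pp'] := IH hp'.
have [c' cc'] : exists c', Gam c c'.
  by apply: (m_tot mG); have := hp 0%N; rewrite coefD coefMX coefC add0r.
exists (p' * 'X + c'%:P) => i; rewrite !coefD !coefMX !coefC; apply: (m_D mG).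
  by case: (i == 0%N); [apply: (m_0 mG) | apply: pp'].
by case: (i == 0%N) => //; apply: (m_0 mG).
Qed.

Lemma poly_rel_eq p q q' : poly_rel Gam p q -> poly_rel Gam p q' -> q = q'.
Proof. by move=> h1 h2; apply/polyP => i; apply: (m_eq mG). Qed.

Lemma ext_morph c c' : (forall p p', poly_rel Gam p p' -> p.[c] = 0 -> p'.[c'] = 0) ->
  morph (adjoin R c) (ext_graph Gam c c').
Proof.
move=> hf; split.
- by move=> _ _ [p [p' [pp' -> _]]]; exists p => // i; apply: (m_dom mG (pp' i)).
- by move=> _ [p hp ->]; have [p' pp'] := poly_rel_tot hp; exists p'.[c'], p, p'.
- by move=> a' [p [p' [pp' e ->]]]; apply: (hf p).
- by exists 1, 1; split; rewrite ?hornerC // -polyC1; apply: poly_relC; apply: (m_1 mG).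
- by move=> _ _ [p [p' [pp' -> ->]]]; exists (- p), (- p'); rewrite !hornerN; split => //; apply: poly_relN.
- move=> _ _ _ _ [p [p' [pp' -> ->]]] [q [q' [qq' -> ->]]]; exists (p + q), (p' + q').
  by rewrite !hornerD; split => //; apply: poly_relD.
- move=> _ _ _ _ [p [p' [pp' -> ->]]] [q [q' [qq' -> ->]]]; exists (p * q), (p' * q').
  by rewrite !hornerM; split => //; apply: poly_relM.
Qed.
End PRel.

Section Algebraic.
Variables (R : D -> Prop) (c : D) (p : {poly D}).
Hypothesis sR : subring R.
Hypotheses (hp : poly_over R p) (p0 : p != 0) (pc : p.[c] = 0).
Hypothesis pmin : forall q, poly_over R q -> q.[c] = 0 -> (size q < size p)%N -> q = 0.

Lemma alg_size : (1 < size p)%N.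
Proof.
rewrite ltnNge; apply/negP => /size1_polyC e; move: pc p0; rewrite e hornerC => ->.
by rewrite polyC0 eqxx.
Qed.

Lemma alg_divides q : poly_over R q -> q.[c] = 0 -> exists k u, poly_over R u /\ lead_coef p ^+ k *: q = u * p.
Proof.
move=> hq qc; have [k [u [rho [hu hr sr e]]]] := pdiv_over sR hp p0 hq.
exists k, u; split => //; rewrite e (pmin hr) ?addr0 //.
have := congr1 (fun f : {poly D} => f.[c]) e; rewrite hornerZ hornerD hornerM pc qc !mulr0 add0r.
by move/esym.
Qed.

(** Up to a power of the leading coefficient of p, a polynomial over R that
vanishes at c is a multiple of p; that power does not go to 0. *)
Lemma alg_ext Gam p' c' : morph R Gam -> poly_rel Gam p p' -> p'.[c'] = 0 -> (forall a', Gam (lead_coef p) a' -> a' != 0) ->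
  morph (adjoin R c) (ext_graph Gam c c').
Proof.
move=> mG pp' pc' la; apply: (ext_morph mG) => q q' qq' qc.
have hq : poly_over R q by move=> i; apply: (m_dom mG (qq' i)).
have [k [u [hu e]]] := alg_divides hq qc.
have [u' uu'] := poly_rel_tot mG hu.
have [a' aa'] : exists a', Gam (lead_coef p) a' by apply: (m_tot mG); apply: hp.
have e' : a' ^+ k *: q' = u' * p'.
  apply: (poly_rel_eq mG (p := lead_coef p ^+ k *: q)); first by apply: (poly_relZ mG) => //; apply: (m_exp mG).
  by rewrite e; apply: (poly_relM mG).
have := congr1 (fun f : {poly D} => f.[c']) e'; rewrite hornerZ hornerM pc' mulr0 => /eqP.
by rewrite mulf_eq0 expf_eq0 (negPf (la _ aa')) andbF /= => /eqP.
Qed.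

(** Among the nonzero multiples of s, take one that is the value at c of a
polynomial tau of least degree.  If tau were not constant, its remainder in the
division of p by tau would be a smaller one, or p would not be minimal. *)
Lemma alg_multiple s : adjoin R c s -> s != 0 -> exists w e, [/\ adjoin R c w, R e, e != 0 & w * s = e].
Proof.
move=> [sig hsig sE] s0.
have [tau] : exists tau, [/\ poly_over R tau, tau.[c] != 0, (exists2 w, poly_over R w & tau.[c] = w.[c] * s) &
   forall t, poly_over R t -> t.[c] != 0 -> (exists2 w, poly_over R w & t.[c] = w.[c] * s) -> (size tau <= size t)%N].
  have : exists tau, [/\ poly_over R tau, tau.[c] != 0 & exists2 w, poly_over R w & tau.[c] = w.[c] * s].
    exists sig; rewrite -sE; split => //; exists 1; rewrite ?hornerC ?mul1r //.
    by rewrite -polyC1; apply: (poly_overC sR); apply: (sr1 sR).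
  case=> t0 [h1 h2 h3]; move: {2}(size t0) (leqnn (size t0)) => m.
  elim: m t0 h1 h2 h3 => [|m IH] t0 h1 h2 h3 st.
    by move: st h2; rewrite leqn0 size_poly_eq0 => /eqP ->; rewrite horner0 eqxx.
  case: (classic (exists t, [/\ poly_over R t, t.[c] != 0, (exists2 w, poly_over R w & t.[c] = w.[c] * s) & (size t < size t0)%N])).
    by move=> [t [k1 k2 k3 k4]]; apply: (IH t) => //; rewrite -ltnS; apply: leq_trans st.
  move=> nt; exists t0; split => // t k1 k2 k3; rewrite leqNgt; apply/negP => k4.
  by apply: nt; exists t.
move=> [htau tc [w hw wE] tmin].
have t0 : tau != 0 by apply: contraNneq tc => ->; rewrite horner0.
have lp0 : lead_coef p != 0 by rewrite lead_coef_eq0.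
have lt0 : lead_coef tau != 0 by rewrite lead_coef_eq0.
have st : (size tau < size p)%N.
  have [k [u [rho [hu hr sr e]]]] := pdiv_over sR hp p0 htau.
  apply: leq_ltn_trans sr; apply: tmin => //.
    have := congr1 (fun f : {poly D} => f.[c]) e; rewrite hornerZ hornerD hornerM pc mulr0 add0r => <-.
    by rewrite mulf_neq0 // expf_neq0.
  have := congr1 (fun f : {poly D} => f.[c]) e; rewrite hornerZ hornerD hornerM pc mulr0 add0r => <-.
  exists (lead_coef p ^+ k *: w); first by apply: (poly_overZ sR) => //; apply: (sr_exp sR); apply: hp.
  by rewrite wE hornerZ mulrA.
have s1 : (size tau <= 1)%N.
  rewrite leqNgt; apply/negP => st1.
  have [k [u [rho [hu hr sr e]]]] := pdiv_over sR htau t0 hp.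
  have rc : rho.[c] = 0.
    apply/eqP/negPn/negP => rc; have : (size tau <= size rho)%N.
      apply: tmin => //; exists (- (u * w)); first by apply: (poly_overN sR); apply: (poly_overM sR).
      have := congr1 (fun f : {poly D} => f.[c]) e; rewrite hornerZ hornerD hornerM pc mulr0 => /esym/eqP.
      by rewrite addrC addr_eq0 => /eqP ->; rewrite hornerN hornerM wE mulNr mulrA.
    by rewrite leqNgt sr.
  have r0 : rho = 0 by apply: pmin => //; apply: ltn_trans st.
  have uc : u.[c] = 0.
    have := congr1 (fun f : {poly D} => f.[c]) e; rewrite hornerZ hornerD hornerM pc mulr0 rc addr0 => /esym/eqP.
    by rewrite mulf_eq0 (negPf tc) orbF => /eqP.
  have u0 : u != 0.
    apply: contraTneq isT => u0; move: e; rewrite u0 r0 mul0r addr0 => /eqP.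
    by rewrite scaler_eq0 expf_eq0 (negPf lt0) andbF (negPf p0).
  have : u = 0.
    apply: pmin => //; have := congr1 (fun f : {poly D} => size f) e.
    rewrite r0 addr0 size_scale ?expf_neq0 // size_mul // => ->.
    have key i j : (0 < i -> 1 < j -> i < (i + j).-1)%N by lia.
    by apply: key => //; rewrite size_poly_gt0.
  by move/eqP; rewrite (negPf u0).
have tE : tau.[c] = tau`_0 by rewrite {1}(size1_polyC s1) hornerC.
exists w.[c], tau`_0; split.
- by exists w.
- exact: htau.
- by rewrite -tE.
- by rewrite -wE.
Qed.

End Algebraic.

Definition adjoin_seq := foldl (fun (R : D -> Prop) c => adjoin R c).

Lemma ext_base R Gam c c' a a' : morph R Gam -> Gam a a' -> ext_graph Gam c c' a a'.
Proof. by move=> mG h; exists a%:P, a'%:P; rewrite !hornerC; split => //; apply: (poly_relC mG). Qed.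
Lemma ext_gen R Gam c c' : morph R Gam -> ext_graph Gam c c' c c'.
Proof.
move=> mG; exists 'X, 'X; rewrite !hornerX; split => // i; rewrite coefX.
by case: eqP => _; [apply: (m_1 mG) | apply: (m_0 mG)].
Qed.

Definition nonvan Gam r := forall r', Gam r r' -> r' != 0.

(** If c is algebraic over R, then r forces the image of the leading coefficient of
its polynomial to be nonzero, so that the image polynomial has a root; it also
takes care of a multiple of s lying in R.  If c is transcendental, it may go to
any natural number outside the roots of the image of a polynomial representing
s. *)
Lemma extend1 R c s : subring R -> adjoin R c s -> s != 0 ->
  exists r, [/\ R r, r != 0 & forall Gam, morph R Gam -> nonvan Gam r ->
    exists c', morph (adjoin R c) (ext_graph Gam c c') /\ nonvan (ext_graph Gam c c') s].
Proof.
move=> sR Rs s0.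
case: (classic (exists2 p, poly_over R p & p != 0 /\ p.[c] = 0)) => [/min_annihilator [p [hp p0 pc pmin]]|tr].
  have [w [e [Rw Re e0 we]]] := alg_multiple sR hp p0 pc pmin Rs s0.
  have Ra : R (lead_coef p) by apply: hp.
  exists (lead_coef p * e); split; [exact: srM | by rewrite mulf_neq0 ?lead_coef_eq0 |].
  move=> Gam mG nv.
  have [a' aa'] := m_tot mG Ra; have [e' ee'] := m_tot mG Re.
  have := nv _ (m_M mG aa' ee'); rewrite mulf_eq0 negb_or => /andP [a'0 e'0].
  have [p' pp'] := poly_rel_tot mG hp.
  have sp' : size p' != 1%N.
    have : ((size p).-1 < size p')%N.
      rewrite ltnNge; apply/negP => h; case/negP: a'0; apply/eqP.
      by rewrite -(nth_default 0 h); apply: (m_eq mG aa' (pp' _)).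
    by have := alg_size p0 pc; case: (size p) => [|[|k]] //= _; case: (size p') => [|[|l]].
  have /closed_rootP [c' /rootP pc'] := sp'.
  exists c'.
  have mE : morph (adjoin R c) (ext_graph Gam c c').
    apply: (alg_ext sR hp p0 pc pmin mG pp' pc') => a1 h1.
    by rewrite (m_eq mG h1 aa').
  split => // s' ss'; have [w' ww'] := m_tot mE Rw.
  have h1 := m_M mE ww' ss'; rewrite we in h1.
  have h2 := m_eq mE h1 (ext_base c c' mG ee').
  by apply: contraNneq e'0 => s'0; rewrite -h2 s'0 mulr0.
have [sig hsig sE] := Rs.
have sig0 : sig != 0 by apply: contraNneq s0 => sz; rewrite sE sz horner0.
exists (lead_coef sig); split; [exact: hsig | by rewrite lead_coef_eq0 |].
move=> Gam mG nv; have [sig' ss'] := poly_rel_tot mG hsig.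
have sig'0 : sig' != 0.
  by apply: contraTneq (nv _ (ss' (size sig).-1)) => ->; rewrite coef0 eqxx.
have [k hk] : exists k : nat, sig'.[k%:R] != 0.
  apply: NNPP => h; case/negP: sig'0; apply/eqP; apply: (poly_nat_roots D0) => k.
  by apply/eqP/negPn/negP => hk; apply: h; exists k.
exists k%:R.
have mE : morph (adjoin R c) (ext_graph Gam c k%:R).
  apply: (ext_morph mG) => p p' pp' pc.
  have hp : poly_over R p by move=> i; apply: (m_dom mG (pp' i)).
  have p0 : p = 0 by apply: NNPP => p0; apply: tr; exists p => //; split => //; apply/eqP.
  have -> : p' = 0 by apply/polyP => i; rewrite coef0; apply: (m_fun mG); have := pp' i; rewrite p0 coef0.
  by rewrite horner0.
split => // s1 h1.
have h2 : ext_graph Gam c k%:R s sig'.[k%:R] by exists sig, sig'.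
by rewrite (m_eq mE h1 h2).
Qed.

Lemma extend_seq (l : seq D) R s : subring R -> adjoin_seq R l s -> s != 0 ->
  exists r, [/\ R r, r != 0 & forall Gam, morph R Gam -> nonvan Gam r ->
    exists Gam', [/\ morph (adjoin_seq R l) Gam', forall a a', Gam a a' -> Gam' a a' &
       forall c, c \in l -> exists c', Gam' c c']].
Proof.
elim: l R s => [|c l IH] R s sR /= Rs s0.
  by exists s; split => // Gam mG _; exists Gam.
have sR' := adjoin_subring sR c.
have [r1 [Rr1 r10 h1]] := IH _ _ sR' Rs s0.
have [r [Rr r0 h]] := extend1 sR Rr1 r10.
exists r; split => // Gam mG nv; have [c' [mE nE]] := h _ mG nv.
have [Gam' [mG' sub tot]] := h1 _ mE nE.
exists Gam'; split => //.
  by move=> a a' aa'; apply: sub; apply: (ext_base _ _ mG).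
move=> d; rewrite inE => /orP [/eqP ->|]; last exact: tot.
by exists c'; apply: sub; apply: (ext_gen _ _ mG).
Qed.

Variable F : divringClosed D.

Definition inF a := a \in F.
Definition idF (a a' : D) := a \in F /\ a = a'.

Lemma inF_subring : subring inF.
Proof.
split; rewrite /inF; rewrite ?rpred0 ?rpred1 //.
- by move=> a h; rewrite rpredN.
- by move=> a b ha hb; rewrite rpredD.
- by move=> a b ha hb; rewrite rpredM.
Qed.

Lemma idF_morph : morph inF idF.
Proof.
split; rewrite /idF.
- by move=> a a' [].
- by move=> a h; exists a.
- by move=> a' [].
- by rewrite rpred1.
- by move=> a _ [h <-]; rewrite rpredN.
- by move=> a _ b _ [ha <-] [hb <-]; rewrite rpredD.
- by move=> a _ b _ [ha <-] [hb <-]; rewrite rpredM.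
Qed.

(** If b is algebraic over F and its minimal polynomial had b as its only root, b
would be rational in the two leading coefficients, characteristic being 0.  If b
is transcendental it can be sent to almost any natural number.  The element r
given by [extend_seq] has nonzero image in both cases, so that the morphism
extends to the members of l. *)
Lemma other_conjugate (b : D) (l : seq D) : b \notin F ->
  exists Gam, [/\ morph (adjoin_seq (adjoin inF b) l) Gam, forall a, a \in F -> Gam a a,
    exists2 b', Gam b b' & b' != b & forall c, c \in l -> exists c', Gam c c'].
Proof.
move=> bF; have sF := inF_subring; have mF := idF_morph.
have sb := adjoin_subring sF b.
have [|r [Rr r0 h]] := @extend_seq l _ 1 sb _ (oner_neq0 D).
  suff : subring (adjoin_seq (adjoin inF b) l) by move=> s; apply: (sr1 s).
  by elim: l (adjoin inF b) sb => //= c l IH R sR; apply: IH; apply: adjoin_subring.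
suff [b' [mE nv b'b]] : exists b', [/\ morph (adjoin inF b) (ext_graph idF b b'), nonvan (ext_graph idF b b') r & b' != b].
  have [Gam [mG sub tot]] := h _ mE nv.
  exists Gam; split => //.
    by move=> a aF; apply: sub; apply: (ext_base _ _ mF).
  by exists b' => //; apply: sub; apply: (ext_gen _ _ mF).
case: (classic (exists2 p, poly_over inF p & p != 0 /\ p.[b] = 0)) => [/min_annihilator [p [hp p0 pb pmin]]|tr].
  have pp' : poly_rel idF p p by move=> i; split => //; apply: hp.
  have lF (a' : D) : idF (lead_coef p) a' -> a' != 0 by move=> [_ <-]; rewrite lead_coef_eq0.
  suff [b' pb' b'b] : exists2 b', p.[b'] = 0 & b' != b.
    exists b'; have mE := alg_ext sF hp p0 pb pmin mF pp' pb' lF; split => //.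
    move=> r' rr'; have [w [e [Rw Re e0 we]]] := alg_multiple sF hp p0 pb pmin Rr r0.
    have [w' ww'] := m_tot mE Rw.
    have h1 := m_M mE ww' rr'; rewrite we in h1.
    have ee : idF e e by split.
    have h2 := m_eq mE h1 (ext_base b b' mF ee).
    by apply: contraNneq e0 => r'0; rewrite -h2 r'0 mulr0.
  apply: NNPP => nb; case/negP: bF.
  have [rs rsE] := closed_field_poly_normal p.
  have allb : all (pred1 b) rs.
    apply/allP => z zr; apply/negPn/negP => zb; apply: nb; exists z => //.
    by rewrite rsE hornerZ (eqP (_ : root (\prod_(z <- rs) ('X - z%:P)) z)) ?mulr0 // root_prod_XsubC.
  have rsb : rs = nseq (size rs) b by apply/all_pred1P.
  have d0 : (0 < size rs)%N.
    have := alg_size p0 pb; rewrite rsE size_scale ?lead_coef_eq0 // size_prod_XsubC //.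
  have cE : p`_(size rs).-1 = lead_coef p * (- (b * (size rs)%:R)).
    rewrite {1}rsE coefZ coefPn_prod_XsubC -?lt0n //; congr (_ * - _).
    by rewrite {1}rsb big_nseq mulr_natr -Monoid.iteropE.
  have d1 : (size rs)%:R != 0 :> D by rewrite D0 -lt0n.
  have l0 : lead_coef p != 0 by rewrite lead_coef_eq0.
  have -> : b = - (p`_(size rs).-1 / lead_coef p / (size rs)%:R).
    rewrite cE; field.
    by rewrite d1 l0.
  have nF k : (k%:R : D) \in F by apply: rpred_nat.
  by rewrite rpredN; apply: rpred_div => //; apply: rpred_div; apply: hp.
have [rho hrho rE] := Rr.
have rho0 : rho != 0 by apply: contraNneq r0 => e; rewrite rE e horner0.
have [k hk] : exists k : nat, (rho * ('X - b%:P)).[k%:R] != 0.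
  apply: NNPP => hk; have : rho * ('X - b%:P) = 0.
    by apply: (poly_nat_roots D0) => k; apply/eqP/negPn/negP => hk'; apply: hk; exists k.
  by move/eqP; rewrite mulf_eq0 (negPf rho0) polyXsubC_eq0.
move: hk; rewrite hornerM hornerXsubC mulf_eq0 negb_or subr_eq0 => /andP [k1 k2].
exists k%:R; have mE : morph (adjoin inF b) (ext_graph idF b k%:R).
  apply: (ext_morph mF) => p p' pp' pb.
  have hp : poly_over inF p by move=> i; have [] := pp' i.
  have p0 : p = 0 by apply: NNPP => p0; apply: tr; exists p => //; split => //; apply/eqP.
  have -> : p' = 0 by apply/polyP => i; rewrite coef0; have [_ <-] := pp' i; rewrite p0 coef0.
  by rewrite horner0.
split => // r' h1.
have h2 : ext_graph idF b k%:R r rho.[k%:R] by exists rho, rho; split => // i; split => //; apply: hrho.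
by rewrite (m_eq mE h1 h2).
Qed.
End Specialize.

(** * Descent of the triple to F *)

(** J is a minimal set of positions such that only the zero matrix of U vanishes on
J; minimality provides a basis of U dual to the positions in J. *)
Lemma pivots (K : fieldType) (n : nat) (U : {vspace 'M[K]_n}) : exists J : {set 'I_n * 'I_n},
  (forall u, u \in U -> (forall j, j \in J -> u j.1 j.2 = 0) -> u = 0) /\
  (forall A : 'M[K]_n, exists2 u, u \in U & forall j, j \in J -> (A - u) j.1 j.2 = 0).
Proof.
pose inj (J : {set 'I_n * 'I_n}) := forall u, u \in U -> (forall j, j \in J -> u j.1 j.2 = 0) -> u = 0.
suff H : forall k (J : {set 'I_n * 'I_n}), (#|J| <= k)%N -> inj J ->
    exists J : {set 'I_n * 'I_n}, inj J /\ (forall j, j \in J -> ~ inj (J :\ j)).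
  have [J [iJ mJ]] : exists J : {set 'I_n * 'I_n}, inj J /\ (forall j, j \in J -> ~ inj (J :\ j)).
    apply: (H _ [set: 'I_n * 'I_n] (leqnn _)) => u _ h.
    by apply/matrixP => a b; rewrite (h (a, b)) ?inE // mxE.
  exists J; split => // A.
  have dual j : j \in J -> exists u, [/\ u \in U, u j.1 j.2 = 1 & forall i, i \in J -> i != j -> u i.1 i.2 = 0].
    move=> jJ; have [u [uU uz u0]] : exists u, [/\ u \in U, forall i, i \in J :\ j -> u i.1 i.2 = 0 & u <> 0].
      by apply: NNPP => hn; apply: (mJ j jJ) => u uU uz; apply: NNPP => u0; apply: hn; exists u.
    have uj : u j.1 j.2 != 0.
      apply/eqP => uj; apply: u0; apply: iJ => // i iJ'.
      by case: (eqVneq i j) => [->//|ij]; apply: (uz i); rewrite in_setD1 ij.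
    exists ((u j.1 j.2)^-1 *: u); split; [exact: memvZ | by rewrite mxE mulVf |].
    by move=> i iJ' ij; rewrite mxE (uz i) ?mulr0 // in_setD1 ij.
  have [d hd] : exists d : 'I_n * 'I_n -> 'M[K]_n, forall j, j \in J ->
      [/\ d j \in U, d j j.1 j.2 = 1 & forall i, i \in J -> i != j -> d j i.1 i.2 = 0].
    apply: (functional_choice (fun j u => j \in J -> [/\ u \in U, u j.1 j.2 = 1 & forall i, i \in J -> i != j -> u i.1 i.2 = 0])) => j.
    case: (boolP (j \in J)) => [/dual [u hu]|_]; first by exists u.
    by exists 0.
  exists (\sum_(j in J) A j.1 j.2 *: d j).
    by apply: memv_suml => j jJ; apply: memvZ; have [] := hd j jJ.
  move=> i iJ'; rewrite !mxE summxE (bigD1 i) //= mxE; have [_ -> _] := hd i iJ'.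
  rewrite mulr1 big1 ?addr0 ?subrr // => j /andP [jJ ji]; rewrite mxE.
  by have [_ _ ->] := hd j jJ; rewrite ?mulr0 // eq_sym.
elim=> [|k IH] J Jk iJ.
  exists J; split => // j jJ; move: Jk; rewrite leqn0 cards_eq0 => /eqP J0.
  by move: jJ; rewrite J0 inE.
case: (classic (exists2 j, j \in J & inj (J :\ j))) => [[j jJ ij]|nj].
  apply: (IH (J :\ j)) => //; move: Jk; rewrite (cardsD1 j) jJ add1n ltnS //.
by exists J; split => // j jJ ij; apply: nj; exists j.
Qed.

Section Descent.
Variables (D : closedFieldType) (n : nat).
Hypothesis D0 : natr_inj0 D.
Local Notation gl := ('M[D]_n.+1).
Local Notation N := (n.+1 * n.+1 + 1)%N.
Local Notation P := {mpoly D[N]}.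
Variable F : divringClosed D.
Implicit Types (x h y : gl).

Section MRel.
Variables (R : D -> Prop) (Gam : D -> D -> Prop).
Hypothesis mG : morph R Gam.
Hypothesis GF : forall a, a \in F -> Gam a a.

Definition mx_rel (A A' : gl) := forall i j, Gam (A i j) (A' i j).

Lemma mx_rel_F A : A \is a mxOver F -> mx_rel A A.
Proof. by move=> /mxOverP h i j; apply: GF. Qed.
Lemma mx_relM A A' B B' : mx_rel A A' -> mx_rel B B' -> mx_rel (A * B) (A' * B').
Proof. by move=> hA hB i j; rewrite !mxE; apply: (m_sum mG) => k; apply: (m_M mG). Qed.
Lemma mx_relD A A' B B' : mx_rel A A' -> mx_rel B B' -> mx_rel (A + B) (A' + B').
Proof. by move=> hA hB i j; rewrite !mxE; apply: (m_D mG). Qed.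
Lemma mx_relN A A' : mx_rel A A' -> mx_rel (- A) (- A').
Proof. by move=> hA i j; rewrite !mxE; apply: (m_N mG). Qed.
Lemma mx_relZ a A A' : a \in F -> mx_rel A A' -> mx_rel (a *: A) (a *: A').
Proof. by move=> aF hA i j; rewrite !mxE; apply: (m_M mG) => //; apply: GF. Qed.
Lemma mx_rel0 : mx_rel 0 0.
Proof. by move=> i j; rewrite mxE; apply: (m_0 mG). Qed.
Lemma mx_rel1 : mx_rel 1 1.
Proof. by move=> i j; rewrite !mxE; case: (i == j); [apply: (m_1 mG) | apply: (m_0 mG)]. Qed.
Lemma mx_relX A A' k : mx_rel A A' -> mx_rel (A ^+ k) (A' ^+ k).
Proof. by move=> h; elim: k => [|k IH]; rewrite ?expr0 ?exprS; [apply: mx_rel1 | apply: mx_relM]. Qed.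
Lemma mx_rel_ad A A' B B' : mx_rel A A' -> mx_rel B B' -> mx_rel (ad A B) (ad A' B').
Proof. by move=> hA hB; apply: mx_relD; [apply: mx_relM | apply: mx_relN; apply: mx_relM]. Qed.
Lemma mx_rel_exp A A' : mx_rel A A' -> mx_rel (expm A) (expm A').
Proof.
move=> h; rewrite /expm; elim/big_rec2: _ => [|k B B' _ hB]; first exact: mx_rel0.
apply: mx_relD => //; apply: mx_relZ; last exact: mx_relX.
by rewrite rpredV rpred_nat.
Qed.
Lemma mx_rel_eq0 A : mx_rel 0 A -> A = 0.
Proof. by move=> h; apply/matrixP => i j; rewrite mxE; apply: (m_fun mG); have := h i j; rewrite mxE. Qed.

Lemma mx_rel_meval (p : P) A A' : p \is a mpolyOver _ F -> mx_rel A A' -> Gam p.@[coords A 1] p.@[coords A' 1].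
Proof.
move=> /mpolyOverP hp h; rewrite !mevalE; apply: (m_sum mG) => m.
apply: (m_M mG); first exact: GF.
elim/big_rec2: _ => [|i u v _ huv]; first exact: (m_1 mG).
apply: (m_M mG) => //; apply: (m_exp mG).
by elim/coord_ind: i => [i j|]; rewrite ?coordsEl ?coordsEr //; apply: (m_1 mG).
Qed.
End MRel.

Variable G : gl -> Prop.
Hypothesis ssG : semisimple_group G.

Lemma Lie_vspace : exists L : {vspace gl}, forall X, X \in L <-> Lie G X.
Proof. by apply: subspace_vspace; [apply: Lie0 | move=> a u v; apply: Lie_linear]. Qed.

Lemma triple_in_Lie x : Lie G x -> nilp x -> exists h y, triple x h y /\ Lie G y.
Proof.
have [GG _ _] := ssG; have [L LP] := Lie_vspace.
move=> /LP xL nx.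
have sL : stable L L by move=> u v /LP hu /LP hv; apply/LP; apply: Lie_bracket.
have nd X : X \in L -> (forall Y, Y \in L -> \tr (X *m Y) = 0) -> X = 0.
  by move=> /LP LX h; apply: (Lie_nondeg D0 ssG LX) => Y /LP; apply: h.
have [w wL hx] := neutral_element D0 sL nd xL nx.
have [y yL t] := morozov D0 sL nx erefl hx (sL _ _ xL wL) wL.
by exists (ad x w), y; split => //; apply/LP.
Qed.

(** Two completions of x to a triple in L differ, in h, by an element of U, the
intersection of [x, L] with the kernel of ad x.  Subtracting from h an element
of U so that its entries at pivots of U vanish makes it unique, and then y is
unique by [lower_unique].  All the conditions on y are polynomial over F. *)
Lemma triple_over_F x : defined_over F G -> x \is a mxOver F -> Lie G x -> nilp x ->
  exists h y, [/\ triple x h y, Lie G y & y \is a mxOver F].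
Proof.
move=> [I [IF hI]] xF Lx nx; have [GG _ _] := ssG; have [L LP] := Lie_vspace.
have sL : stable L L by move=> u v /LP hu /LP hv; apply/LP; apply: Lie_bracket.
have xL : x \in L by apply/LP.
have [h0 [y0 [[t1 t2 t3] /LP y0L]]] := triple_in_Lie Lx nx.
pose PU u := exists2 w, w \in L & u = ad x w /\ ad x u = 0.
have [||U UP] := @subspace_vspace _ _ PU.
- by exists 0; rewrite ?mem0v // !ad0.
- move=> a _ _ [u uL [-> h1]] [v vL [-> h2]]; exists (a *: u + v); first by rewrite memvD ?memvZ.
  split; first by rewrite ad_linear.
  by rewrite (ad_linear x a (ad x u)) h1 h2 scaler0 addr0.
have [J [injJ surJ]] := pivots U.
have [u /UP [w wL [uE xu]] uJ] := surJ h0.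
pose h := h0 - u.
have hw : ad x (y0 - w) = h by rewrite adB t3 -uE.
have hx : ad h x = 2%:R *: x by rewrite adC /h adB (adC x h0) t1 xu subr0 opprK.
have y0wL : y0 - w \in L by apply: memvB.
have [y yL tr] := morozov D0 sL nx hw hx (eq_ind _ (fun z => z \in L) (sL _ _ xL y0wL) _ hw) y0wL.
exists h, y; split => //; first exact/LP.
have ny := triple_nilp D0 tr.
apply/mxOverP => i j; apply/negPn/negP => yF.
have [Gam [mG GF [b' bb' b'b] tot]] := other_conjugate D0 [seq y k.1 k.2 | k : 'I_n.+1 * 'I_n.+1] yF.
have [y' yy' y'E] : exists2 y', mx_rel Gam y y' & y' i j = b'.
  have [f hf] : exists f : 'I_n.+1 * 'I_n.+1 -> D, forall k, Gam (y k.1 k.2) (f k).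
    apply: (functional_choice (fun k c => Gam (y k.1 k.2) c)) => k.
    by apply: tot; apply/mapP; exists k; rewrite ?mem_enum.
  exists (\matrix_(a, b) f (a, b)); first by move=> a b; rewrite mxE; apply: (hf (a, b)).
  by rewrite mxE; apply: (m_eq mG (hf (i, j)) bb').
suff : y = y' by move=> e; move: b'b; rewrite -y'E -e eqxx.
have [r1 r2 r3] := tr.
have xx := mx_rel_F GF xF.
have F2 : (2%:R : D) \in F by apply: rpred_nat.
have ny' : nilp y'.
  by have := mx_relX mG n.+1 yy'; rewrite (ny : y ^+ n.+1 = 0) => /(mx_rel_eq0 mG).
have hh' : mx_rel Gam h (ad x y') by have := mx_rel_ad mG xx yy'; rewrite r3.
have r1' : ad (ad x y') x = 2%:R *: x.
  have := mx_relD mG (mx_rel_ad mG hh' xx) (mx_relN mG (mx_relZ mG GF F2 xx)).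
  by rewrite r1 subrr => /(mx_rel_eq0 mG)/subr0_eq.
have r2' : ad (ad x y') y' = - (2%:R *: y').
  have := mx_relD mG (mx_rel_ad mG hh' yy') (mx_relZ mG GF F2 yy').
  by rewrite r2 addNr => /(mx_rel_eq0 mG)/eqP; rewrite addr_eq0 => /eqP.
(* Membership of y' in Lie G is expressed through exp y', since the equations
   over F are those of G. *)
have Gy' : G (expm y').
  apply/hI; split; first exact: expm_unit.
  move=> p Ip; have Gy : G (expm y) by apply: exp_in_group => //; apply/LP.
  have py : p.@[coords (expm y) 1] = 0.
    by have /hI [_ /(_ p Ip)] := Gy; rewrite GL_coordE det_expm // invr1.
  rewrite GL_coordE det_expm // invr1; apply: (m_fun mG); rewrite -py.
  exact: (mx_rel_meval mG GF (IF p Ip) (mx_rel_exp mG GF yy')).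
have y'L : y' \in L.
  by apply/LP; rewrite -(log_expm D0 ny'); apply: log_in_Lie => //; apply: nilp_expm1.
(* The entries of h at the pivots are 0, and so are those of its image. *)
have hJ : h = ad x y'.
  apply/subr0_eq; apply: injJ.
    apply/UP; exists (y - y'); first exact: memvB.
    by rewrite adB r3; split => //; rewrite adB (adC x h) r1 (adC x (ad x y')) r1' subrr.
  move=> k kJ; have hk : h k.1 k.2 = 0 by apply: uJ.
  have := hh' k.1 k.2; rewrite hk => /(m_fun mG) e.
  by rewrite [LHS]mxE [X in _ + X]mxE hk e subrr.
apply/subr0_eq; apply: (lower_unique D0 nx hw hx).
  by rewrite adB r3 -hJ subrr.
have e : ad h y' = - (2%:R *: y') by rewrite hJ.
by rewrite adB r2 e opprK addrC scalerBr opprB.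
Qed.

Lemma mx_over_expm x : x \is a mxOver F -> expm x \is a mxOver F.
Proof.
move=> xF; rewrite /expm rpred_sum // => k _; apply: mxOverZ; first by rewrite rpredV rpred_nat.
elim: (nat_of_ord k) => [|j IH]; first by rewrite expr0; apply: mxOver_scalar; rewrite ?rpred0 ?rpred1.
by rewrite exprS -mulmxE mxOverM.
Qed.

Lemma gen_over x y u : x \is a mxOver F -> y \is a mxOver F -> gen_group x y u -> u \is a mxOver F.
Proof.
move=> xF yF; have sF b (z : gl) : z \is a mxOver F -> expm (sgn b z) \is a mxOver F.
  move=> zF; apply: mx_over_expm; apply: mxOverZ => //; case: b; by rewrite ?expr0 ?expr1 ?rpredN rpred1.
elim=> [|b w _ IH|b w _ IH]; first by apply: mxOver_scalar; rewrite ?rpred0 ?rpred1.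
  by apply: mxOverM => //; apply: sF.
by apply: mxOverM => //; apply: sF.
Qed.
End Descent.

(** * Descent of the group to F *)

Section OverF.
Variables (D : fieldType) (F : divringClosed D).

Definition F_indep (c : seq D) := forall f : nat -> D, (forall i, f i \in F) ->
  \sum_(i < size c) f i * c`_i = 0 -> forall i, (i < size c)%N -> f i = 0.
Definition F_span (c : seq D) a := exists f : nat -> D, (forall i, f i \in F) /\ a = \sum_(i < size c) f i * c`_i.

Lemma F_basis (l : seq D) : exists c, F_indep c /\ forall a, a \in l -> F_span c a.
Proof.
elim: l => [|a l [c [ic sc]]]; first by exists [::]; split => // f _ _ i.
have ext b : F_span c b -> F_span (a :: c) b.
  move=> [f [fF ->]]; exists (fun i => if i is j.+1 then f j else 0); split.
    by case=> [|i]; rewrite ?rpred0.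
  by rewrite big_ord_recl mul0r add0r; apply: eq_bigr.
case: (classic (F_span c a)) => [sa|na].
  by exists c; split => // b; rewrite inE => /orP [/eqP ->|/sc].
exists (a :: c); split.
  move=> f fF; rewrite big_ord_recl /= => e.
  have f0 : f 0%N = 0.
    apply/eqP/negPn/negP => f0; apply: na; exists (fun i => - f i.+1 / f 0%N); split.
      by move=> i; apply: rpred_div => //; rewrite rpredN.
    move: e => /eqP; rewrite addrC addr_eq0 => /eqP e.
    transitivity ((f 0%N)^-1 * (f 0%N * a)); first by rewrite mulKf.
    rewrite -[f 0%N * a]opprK -e mulrN -mulNr mulr_sumr; apply: eq_bigr => i _.
    by rewrite mulrA !mulNr [_^-1 * _]mulrC.
  case=> [//|i]; rewrite ltnS; apply: (ic (fun i => f i.+1)) => //.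
  by move: e; rewrite f0 mul0r add0r.
move=> b; rewrite inE => /orP [/eqP ->|/sc /ext //].
exists (fun i => if i is 0%N then 1 else 0); split; first by case=> [|i]; rewrite ?rpred1 ?rpred0.
by rewrite big_ord_recl mul1r big1 ?addr0 // => i _; rewrite mul0r.
Qed.

(** Expand the coefficients of p in a basis over F of the space they span. *)
Lemma mpoly_F_decomp (N : nat) (p : {mpoly D[N]}) : exists c (q : nat -> {mpoly D[N]}),
  [/\ F_indep c, forall i, q i \is a mpolyOver _ F & p = \sum_(i < size c) c`_i *: q i].
Proof.
have [c [ic sc]] := F_basis [seq p@_m | m <- msupp p].
have [f hf] : exists f : 'X_{1..N} -> nat -> D, forall m, (forall i, f m i \in F) /\
    (m \in msupp p -> p@_m = \sum_(i < size c) f m i * c`_i).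
  apply: (functional_choice (fun m (g : nat -> D) => (forall i, g i \in F) /\
    (m \in msupp p -> p@_m = \sum_(i < size c) g i * c`_i))) => m.
  case: (boolP (m \in msupp p)) => [mp|_].
    by have [|g [gF gE]] := sc p@_m; [apply/mapP; exists m | exists g].
  by exists (fun _ => 0); split => // i; rewrite rpred0.
exists c, (fun i => \sum_(m <- msupp p) f m i *: 'X_[m]); split => //.
  move=> i; apply: rpred_sum => m _; apply: mpolyOverZ; last exact: mpolyOverX.
  by have [h _] := hf m; apply: h.
rewrite {1}[p]mpolyE.
under [RHS]eq_bigr do rewrite scaler_sumr.
rewrite exchange_big /= big_seq [RHS]big_seq; apply: eq_bigr => m mp.
have [_ /(_ mp) ->] := hf m; rewrite scaler_suml; apply: eq_bigr => i _.
by rewrite scalerA mulrC.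
Qed.
End OverF.

Section SLover.
Variables (D : closedFieldType) (n : nat).
Hypothesis D0 : natr_inj0 D.
Local Notation gl := ('M[D]_n.+1).
Variable F : divringClosed D.

(** The group generated by exp x and exp y consists of matrices over F of
determinant 1.  By F-independence, a combination of polynomials over F vanishes
at such a point only if each of them does. *)
Lemma SLgroup_over (x y : gl) : nilp x -> nilp y -> x \is a mxOver F -> y \is a mxOver F ->
  defined_over F (SLgroup x y).
Proof.
move=> nx ny xF yF.
exists (fun p => p \is a mpolyOver _ F /\ vanish (gen_group x y) p); split; first by move=> p [].
move=> g; split; first by case=> ug h; split => // p [_ /h].
case=> ug h; split => // p vp.
have [c [q [ic qF pE]]] := mpoly_F_decomp F p.
suff vq i : (i < size c)%N -> vanish (gen_group x y) (q i).
  rewrite pE raddf_sum big1 // => i _ /=; rewrite mevalZ h ?mulr0 //.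
  by split => //; apply: vq.
move=> ic' u gu; move: i ic'.
apply: (ic (fun i => (q i).@[GL_coord u])) => [i|].
  have uF := gen_over xF yF gu.
  have du : \det u = 1.
    have [] := gen_det D0 nx ny (e := 1) _ _ _ gu; rewrite ?mulr1 ?mul1r // mulmx1 subrr addr0 //.
  apply: rpred_mhorner => //; apply/forallP => k; rewrite GL_coordE du invr1.
  elim/coord_ind: k => [a b|]; rewrite ?coordsEl ?coordsEr ?rpred1 //.
  exact: (mxOverP uF).
have := vp u gu; rewrite {1}pE raddf_sum => e.
by rewrite -[RHS]e; apply: eq_bigr => i _; rewrite /= mevalZ mulrC.
Qed.

Lemma log_over (g : gl) : g \is a mxOver F -> log_mx g \is a mxOver F.
Proof.
move=> gF; rewrite /log_mx rpred_sum // => k _; apply: mxOverZ.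
  by rewrite rpred_div ?rpred_nat // rpredX // rpredN rpred1.
have g1 : g - 1%:M \is a mxOver F.
  by rewrite rpredB //; apply: mxOver_scalar; rewrite ?rpred0 ?rpred1.
elim: k => [|k IH]; first by rewrite expr0; apply: mxOver_scalar; rewrite ?rpred0 ?rpred1.
by rewrite exprS -mulmxE mxOverM.
Qed.
End SLover.

Theorem proposition5p18 (D : closedFieldType) (charD : [pchar D] =i pred0)
    (n : nat) (G : 'M[D]_n -> Prop) (ssG : semisimple_group G)
    (g : 'M[D]_n) (Gg : G g) (ug : unipotent g) (g_neq1 : g <> 1%:M) :
  Lie G (log_mx g) /\
  (exists S : 'M[D]_n -> Prop, is_SL_of G g S) /\
  (forall F : divringClosed D, defined_over F G -> g \is a mxOver F ->
     exists S : 'M[D]_n -> Prop, is_SL_of G g S /\ defined_over F S).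
Proof.
have D0 := pchar0_natf_eq0 charD.
case: n G ssG g Gg ug g_neq1 => [|n] G ssG g Gg [k uk] g1.
  by case: g1; rewrite [LHS]flatmx0 [RHS]flatmx0.
have [GG _ _] := ssG.
have ng : nilp (g - 1) := nilp_bound uk.
have nx := nilp_log ng; set x := log_mx g in nx *.
have gE : g = expm x by rewrite /x expm_log.
have Lx : Lie G x by apply: log_in_Lie.
have x0 : x != 0 by apply: contra_notN g1 => /eqP x0; rewrite gE x0 expm0.
have Gx : G (expm x) by rewrite -gE.
have concl h y : triple x h y -> Lie G y -> is_SL_of G g (SLgroup x y).
  move=> tr Ly; have ny := triple_nilp D0 tr.
  by rewrite gE; apply: (SL_of D0 tr) => //; apply: exp_in_group.
split=> //; split.
  by have [h [y [tr Ly]]] := triple_in_Lie D0 ssG Lx nx; exists (SLgroup x y); apply: concl tr Ly.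
move=> F FG gF; have xF : x \is a mxOver F by apply: log_over.
have [h [y [tr Ly yF]]] := triple_over_F D0 ssG FG xF Lx nx.
exists (SLgroup x y); split; first exact: concl tr Ly.
by apply: SLgroup_over => //; apply: triple_nilp tr.
Qed.
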